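(* Let $T$ be a compact tree as described in the context, and let $\tilde T$ be the same tree (same vertices, edges, edge lengths $1$, and the same matching coefficients $a_{kj},a^1_{kj},a^0_{kj}$) but with possibly different potential $\tilde q=[\tilde q_j]_{j=1}^r$ and boundary coefficients $\tilde h_0,\dots,\tilde h_p$. Fix $k\in\{1,\dots,p\}$. If $M_k(\lambda)\equiv\tilde M_k(\lambda)$ (as meromorphic functions of $\lambda$), then $q_k(x)=\tilde q_k(x)$ for a.e. $x\in[0,1]$ and $h_k=\tilde h_k$. That is, the Weyl function $M_k$ uniquely determines the potential on the boundary edge $e_k$ and the coefficient $h_k$.
   Context: Tree setup. $T$ is a compact connected tree with vertices $v_0,\dots,v_r$ and edges $e_1,\dots,e_r$, each of length $1$. The root $v_0$ is a boundary vertex (a vertex belonging to exactly one edge). The boundary vertices are $v_0,v_1,\dots,v_p$; every edge is $e_j=[v_{j_k},v_j]$ with $j_k<j$, where $v_{j_k}$ (initial point) lies on the simple path from $v_0$ to $v_j$ (end point); in particular $e_{p+1}=[v_0,v_{p+1}]$, and $e_1,\dots,e_p$ are the boundary edges ending at $v_1,\dots,v_p$. Each edge $e_j$ is parametrized by $x\in[0,1]$ with $x=0$ at its end point $v_j$ and $x=1$ at its initial point. For an internal vertex $v_k$ ($k=p+1,\dots,r$), $R(v_k)$ is the set of edges $e_j=[v_k,v_j]$ emanating from $v_k$. A function on $T$ is $Y=[y_j]_{j=1}^r$ with $y_j$ defined on $e_j$. Equation. $q=[q_j]_{j=1}^r$ with $q_j\in L^1(0,1)$ complex-valued (the potential). Consider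 $-y_j''+q_j(x)y_j=\lambda y_j$, $x\in[0,1]$, $j=1,\dots,r$, with $y_j,y_j'$ absolutely continuous, and matching conditions at each internal vertex $v_k$, $k=p+1,\dots,r$: $y_k(0)=a_{kj}y_j(1)$ for all $e_j\in R(v_k)$, and $y_k'(0)=\sum_{e_j\in R(v_k)}(a^1_{kj}y_j'(1)+a^0_{kj}y_j(1))$, where $a_{kj},a^1_{kj},a^0_{kj}\in\mathbb C$, $a_{kj}a^1_{kj}\neq0$, and the regularity condition $\sum_{e_j\in R(v_k)}a^1_{kj}/a_{kj}\neq-1$ holds for every internal $v_k$. Boundary forms. For $j=1,\dots,p$: $U_{j0}(Y)=y_j'(0)+h_jy_j(0)$, $U_{j1}(Y)=y_j(0)$; at the root: $U_{00}(Y)=y_{p+1}'(1)+h_0y_{p+1}(1)$, $U_{01}(Y)=y_{p+1}(1)$; here $h_0,\dots,h_p\in\mathbb C$. Weyl functions. For $k=1,\dots,p$, the Weyl solution $\Psi_k=[\psi_{kj}]_{j=1}^r$ is the solution of the equation satisfying the matching conditions and $U_{j0}(\Psi_k)=\delta_{jk}$, $j=0,\dots,p$. Writing each component as a combination of the fundamental solutions on the edge reduces this to a linear algebraic system whose determinant $\Delta(\lambda)$ (the characteristic function of the problem $B$: equation, matching conditions, and $U_{j0}(Y)=0$, $j=0,\dots,p$) is entire; $\Psi_k$ exists for $\lambda$ outside the zeros of $\Delta$. The Weyl function is $M_k(\lambda):=U_{k1}(\Psi_k)=\psi_{kk}(0,\lambda)$, a meromorphic function; $M(\lambda)=[M_k(\lambda)]_{k=1}^p$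 is the Weyl vector. *)

(* Defs.v *)
From HB Require Import structures.
From mathcomp Require Import all_boot all_order all_algebra.
From mathcomp Require Import all_classical all_reals all_analysis.
From mathcomp Require Import complex.
Import Order.TTheory GRing.Theory Num.Theory.

Set Implicit Arguments.
Unset Strict Implicit.
Unset Printing Implicit Defensive.

Local Open Scope ring_scope.

Section TreeDefs.
Variable R : realType.
Local Notation C := R[i].
Local Notation mu := (@lebesgue_measure R).

Definition cintegrable (f : R -> C) : Prop :=
  mu.-integrable `[0%R, 1%R]%classic (EFin \o (fun t => complex.Re (f t))) /\
  mu.-integrable `[0%R, 1%R]%classic (EFin \o (fun t => complex.Im (f t))).

Definition cint (f : R -> C) (x : R) : C :=
  ((Rintegral mu `[0%R, x]%classic (fun t => complex.Re (f t)))
  +i* (Rintegral mu `[0%R, x]%classic (fun t => complex.Im (f t))))%C.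

(* (y, z) is a solution on [0,1] of  -y'' + q y = lam y  with y, y' absolutely
   continuous, z playing the role of y' : y(x) = y(0) + \int_0^x y',
   y'(x) = y'(0) + \int_0^x (q - lam) y  (Caratheodory solution). *)
Definition edge_sol (q : R -> C) (lam : C) (y z : R -> C) : Prop :=
  cintegrable z /\ cintegrable (fun t => (q t - lam) * y t) /\
  forall x : R, 0 <= x <= 1 ->
    y x = y 0 + cint z x /\ z x = z 0 + cint (fun t => (q t - lam) * y t) x.

(* Tree: vertices v_0..v_r, edges e_1..e_r, e_j = [v_(par j), v_j];
   boundary vertices v_0..v_p, internal vertices v_(p+1)..v_r;
   e_(p+1) = [v_0, v_(p+1)] is the only edge at the root. *)
Definition tree_ok (r p : nat) (par : nat -> nat) : Prop :=
  [/\ (0 < p < r)%N, par p.+1 = 0%N,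
      (forall j, (1 <= j <= r)%N -> j != p.+1 -> (p < par j <= r)%N),
      (forall j, (p.+1 < j <= r)%N -> (par j < j)%N) &
      (forall k, (p < k <= r)%N -> exists j, (1 <= j <= r)%N /\ par j = k)].

(* Coefficients: a j = a_{par j, j}, a1 j = a^1_{par j, j}, a0 j = a^0_{par j, j}
   for the edges e_j emanating from an internal vertex (j <> p+1). *)
Definition coeffs_ok (r p : nat) (par : nat -> nat) (a a1 : nat -> C) : Prop :=
  (forall j, (1 <= j <= r)%N -> j != p.+1 -> a j * a1 j != 0) /\
  (forall k, (p < k <= r)%N ->
     \sum_(1 <= j < r.+1 | par j == k) (a1 j / a j) != -1).

Definition matching (r p : nat) (par : nat -> nat) (a a1 a0 : nat -> C)
  (Y Y' : nat -> R -> C) : Prop :=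
  forall k, (p < k <= r)%N ->
    (forall j, (1 <= j <= r)%N -> par j = k -> Y k 0 = a j * Y j 1) /\
    Y' k 0 = \sum_(1 <= j < r.+1 | par j == k) (a1 j * Y' j 1 + a0 j * Y j 1).

Definition tree_sol (r p : nat) (par : nat -> nat) (a a1 a0 : nat -> C)
  (q : nat -> R -> C) (lam : C) (Y Y' : nat -> R -> C) : Prop :=
  (forall j, (1 <= j <= r)%N -> edge_sol (q j) lam (Y j) (Y' j)) /\
  matching r p par a a1 a0 Y Y'.

Definition U0 (p : nat) (h : nat -> C) (Y Y' : nat -> R -> C) (j : nat) : C :=
  if j == 0%N then Y' p.+1 1 + h 0%N * Y p.+1 1
  else Y' j 0 + h j * Y j 0.

(* lam is not a zero of the characteristic function Delta of problem B:
   problem B (equation, matching, U_{j0} = 0, j = 0..p) has only the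
   trivial solution. *)
Definition regular_pt (r p : nat) (par : nat -> nat) (a a1 a0 : nat -> C)
  (q : nat -> R -> C) (h : nat -> C) (lam : C) : Prop :=
  forall Y Y' : nat -> R -> C,
    tree_sol r p par a a1 a0 q lam Y Y' ->
    (forall j, (j <= p)%N -> U0 p h Y Y' j = 0) ->
    forall j, (1 <= j <= r)%N -> forall x : R, 0 <= x <= 1 -> Y j x = 0.

Definition weyl_sol (r p : nat) (par : nat -> nat) (a a1 a0 : nat -> C)
  (q : nat -> R -> C) (h : nat -> C) (k : nat) (lam : C)
  (Y Y' : nat -> R -> C) : Prop :=
  tree_sol r p par a a1 a0 q lam Y Y' /\
  forall j, (j <= p)%N -> U0 p h Y Y' j = (if j == k then 1 else 0).

Definition weyl_value (r p : nat) (par : nat -> nat) (a a1 a0 : nat -> C)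
  (q : nat -> R -> C) (h : nat -> C) (k : nat) (lam mk : C) : Prop :=
  regular_pt r p par a a1 a0 q h lam /\
  exists Y Y' : nat -> R -> C,
    weyl_sol r p par a a1 a0 q h k lam Y Y' /\ Y k 0 = mk.

End TreeDefs.

(* Main.v *)
Require Import Defs.
From HB Require Import structures.
From mathcomp Require Import all_boot all_order all_algebra.
From mathcomp Require Import all_classical all_reals all_analysis.
From mathcomp Require Import measurable_realfun cyclotomic separable cyclic.
From mathcomp Require Import complex ring lra zify.
Import Order.TTheory GRing.Theory Num.Theory.
Import numFieldNormedType.Exports.

(* On the edge [e_k] let [phi, s] solve the equation for [q_k] with data
   [phi(0) = 1], [phi'(0) = - h_k], [s(0) = 0], [s'(0) = 1], and let [phi~, s~]
   be their analogues for [q~_k], [h~_k].  The Weyl solution on [e_k] is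
   [s + M_k phi], so equality of the Weyl functions gives
     [G(x, lam) := s phi~ - phi s~ = psi phi~ - phi psi~].
   For [lam = - kap ^ 2] on the imaginary axis and large, regularity of the
   matching forces [psi = O(exp (- Re kap x) / kap)], while
   [phi = O(exp (Re kap x))]; hence [G = O(lam ^ (- 1 / 2))] there.  For fixed
   [x], [G] is entire of order 1/2 in [lam]: on the disc of radius [n ^ 2] it is
   approximated, up to an exponentially small error, by polynomials of degree
   [O(n)].  Bernstein's inequality for [lam G ^ 2] on [[- i n ^ 2, i n ^ 2]] then
   gives [G(x, 0) ^ 2 = O(1 / n)], that is [G(x, 0) = 0] for all [x].  Together
   with the Wronskian relations this yields [phi ^ 2 = phi~ ^ 2] and
   [s ^ 2 = s~ ^ 2], and differentiating twice recovers [h_k] and [q_k]. *)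

Set Implicit Arguments.
Unset Strict Implicit.
Unset Printing Implicit Defensive.

Local Open Scope classical_set_scope.
Local Open Scope ring_scope.

(** * Lebesgue integrals on the unit interval *)

(** The decay of [G] is known only where [Re kap] is large, that is for [lam] outside a parabola
    around the positive real axis, so Liouville's theorem does not apply directly. Bernstein's
    inequality needs a bound on one segment only. Since [G] is [O(lam ^ (- 1 / 2))], [lam G ^ 2] is
    bounded there, and the factor [lam] makes its derivative at 0 equal to [G(x, 0) ^ 2]; order 1/2
    lets the length [n ^ 2] beat the degree [O(n)]. Regularity of the matching acts through
    [S = sum a1 / a]. Split a solution into a growing part [u = z + kap y] and a decaying part
    [v = z - kap y]. Crossing an edge away from a leaf squeezes a cone [|v| <= K |u|] to
    [z ~ kap y]; a vertex turns this into [z ~ S kap y], and [S <> -1] says that [u] survives.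
    Towards [v_k] the same condition works in reverse: [z ~ - kap y] at a vertex and [z ~ kap y] on
    the off-path children bound [v] from below on the remaining child. The single value [lam = 0]
    suffices at the end. As [phi] and [s] may vanish, nothing is divided by them: the potentials are
    compared after multiplication by [phi ^ 4] and by [s ^ 4]. *)

Section RealIntegral.
Variable R : realType.
Implicit Types (f g : R -> R) (x a b c t B : R).
Local Notation mu := (@lebesgue_measure R).
Local Notation I01 := (`[0%R, 1%R]%classic : set R).

Definition rint f : Prop := mu.-integrable I01 (EFin \o f).
Definition J f x : R := Rintegral mu `[0%R, x]%classic f.

Lemma rint_sub f x : 0 <= x <= 1 -> rint f -> mu.-integrable `[0, x]%classic (EFin \o f).
Proof.
move=> /andP[x0 x1]; apply: integrableS => //.
by apply: subset_itvl; rewrite bnd_simp.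
Qed.

Lemma rint_eq f g : (forall t, 0 <= t <= 1 -> f t = g t) -> rint f -> rint g.
Proof.
move=> fg; apply: eq_integrable => // t; rewrite inE /= in_itv /= => ht.
by rewrite fg.
Qed.

Lemma rintD f g : rint f -> rint g -> rint (fun t => f t + g t).
Proof. by move=> fi gi; have := integrableD _ fi gi; exact. Qed.

Lemma rintZ c f : rint f -> rint (fun t => c * f t).
Proof. by move=> fi; have := integrableZl _ c fi; exact. Qed.

Lemma rintN f : rint f -> rint (fun t => - f t).
Proof. by move=> /(rintZ (-1)); apply: rint_eq => t _; rewrite mulN1r. Qed.

Lemma rintB f g : rint f -> rint g -> rint (fun t => f t - g t).
Proof. by move=> fi gi; exact: (rintD fi (rintN gi)). Qed.

Lemma rint_norm f : rint f -> rint (fun t => `|f t|).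
Proof. exact: integrable_norm. Qed.

Lemma rint_bounded f B : measurable_fun I01 f ->
  (forall t, 0 <= t <= 1 -> `|f t| <= B) -> rint f.
Proof.
move=> mf fB; apply: measurable_bounded_integrable => //.
  have muE : mu I01 = (1 - 0)%:E by rewrite (lebesgue_measure_itv `[0%R, 1%R]) /= lte_fin ltr01 -EFinD.
  have : (mu I01 < +oo)%E by rewrite muE ltry.
  exact.
exists B; split; first exact: num_real.
move=> M BM t /=; rewrite in_itv /= => ht.
by apply: le_trans (fB _ ht) _; exact: ltW.
Qed.

Lemma rintM f g B : rint f -> measurable_fun I01 g ->
  (forall t, 0 <= t <= 1 -> `|g t| <= B) -> rint (fun t => f t * g t).
Proof.
move=> fi mg gB.
have := integrableMl _ fi mg; apply => //.
exists B; split; first exact: num_real.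
move=> M BM t /=; rewrite in_itv /= => ht.
by apply: le_trans (gB _ ht) _; exact: ltW.
Qed.

Lemma rint_cst c : rint (fun _ => c).
Proof. by apply: (@rint_bounded _ `|c|) => //; exact: measurable_cst. Qed.

Lemma eq_J f g x : 0 <= x <= 1 -> (forall t, 0 <= t <= 1 -> f t = g t) -> J f x = J g x.
Proof.
move=> /andP[x0 x1] fg; apply: eq_Rintegral => t; rewrite inE /= in_itv /= => /andP[t0 tx].
by rewrite fg // t0 (le_trans tx).
Qed.

Lemma JD f g x : 0 <= x <= 1 -> rint f -> rint g ->
  J (fun t => f t + g t) x = J f x + J g x.
Proof. by move=> hx fi gi; apply: RintegralD => //; exact: rint_sub. Qed.

Lemma JZ c f x : 0 <= x <= 1 -> rint f -> J (fun t => c * f t) x = c * J f x.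
Proof. by move=> hx fi; apply: RintegralZl => //; exact: rint_sub. Qed.

Lemma JN f x : 0 <= x <= 1 -> rint f -> J (fun t => - f t) x = - J f x.
Proof.
move=> hx fi; rewrite -mulN1r -JZ //; apply: eq_J => // t _; by rewrite mulN1r.
Qed.

Lemma JB f g x : 0 <= x <= 1 -> rint f -> rint g ->
  J (fun t => f t - g t) x = J f x - J g x.
Proof. by move=> hx fi gi; rewrite JD //; [rewrite JN|exact: rintN]. Qed.

Lemma J0 f : J f 0 = 0.
Proof. by rewrite /J set_itv1 Rintegral_set1. Qed.

Lemma J_cst c x : 0 <= x -> J (fun _ => c) x = c * x.
Proof.
move=> x0; transitivity (c * fine (lebesgue_measure (`[0%R, x]%classic : set R))).
  exact: Rintegral_cst.
rewrite (lebesgue_measure_itv `[0%R, x]) /= lte_fin.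
by case: ltP => [_|x1] /=; rewrite ?subr0 //; have -> : x = 0 by apply/eqP; rewrite eq_le x0 x1.
Qed.

Lemma J_diff f a b : 0 <= a <= b -> b <= 1 -> rint f ->
  J f b - J f a = Rintegral mu `]a, b]%classic f.
Proof.
move=> /andP[a0 ab] b1 fi; apply: Rintegral_itvB; rewrite ?bnd_simp //.
by apply: rint_sub => //; rewrite (le_trans a0).
Qed.

Lemma J_le_diff f g a b : 0 <= a <= b -> b <= 1 -> rint f -> rint g ->
  (forall t, a <= t <= b -> `|f t| <= g t) -> `|J f b - J f a| <= J g b - J g a.
Proof.
move=> hab b1 fi gi fg; rewrite !J_diff //.
case/andP: hab => a0 ab.
have sub : (`]a, b] `<=` I01)%classic.
  by move=> t /=; rewrite !in_itv /= => /andP[/ltW at_ tb]; rewrite (le_trans a0 at_) (le_trans tb b1).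
have fi' : mu.-integrable `]a, b]%classic (EFin \o f) by apply: integrableS fi.
apply: le_trans (le_normr_Rintegral _ _) _ => //.
apply: le_Rintegral => //.
- by apply: integrableS (rint_norm fi).
- by apply: integrableS gi.
- by move=> t /=; rewrite in_itv /= => /andP[/ltW at_ tb]; rewrite fg ?at_.
Qed.

Lemma J_mono f a b : 0 <= a <= b -> b <= 1 -> rint f ->
  (forall t, 0 <= t <= 1 -> 0 <= f t) -> J f a <= J f b.
Proof.
move=> hab b1 fi f0; rewrite -subr_ge0.
apply: le_trans (normr_ge0 (J f b - J f a)) _; apply: J_le_diff => // t /andP[at_ tb].
case/andP: hab => a0 ab.
by rewrite ger0_norm // f0 // (le_trans a0 at_) (le_trans tb b1).
Qed.

Lemma J_ge0 f x : (forall t, 0 <= t <= 1 -> 0 <= f t) -> 0 <= x <= 1 -> 0 <= J f x.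
Proof.
move=> f0 /andP[x0 x1]; apply: Rintegral_ge0 => t /=; rewrite in_itv /= => /andP[t0 tx].
by apply: f0; rewrite t0 (le_trans tx).
Qed.

Lemma J_continuous f : rint f -> {within `[0%R, 1%R], continuous (J f)}.
Proof. by move=> fi; exact: parameterized_integral_continuous. Qed.

Lemma within_continuous_measurable f : {within `[0%R, 1%R], continuous f} -> measurable_fun I01 f.
Proof. by move=> cf; exact: (subspace_continuous_measurable_fun _ cf). Qed.

Lemma J_measurable f : rint f -> measurable_fun I01 (J f).
Proof. by move=> /J_continuous; exact: within_continuous_measurable. Qed.

Lemma J_bound f x : 0 <= x <= 1 -> rint f -> `|J f x| <= J (fun t => `|f t|) 1.
Proof.
move=> /andP[x0 x1] fi; have := @J_le_diff f (fun t => `|f t|) 0 x; rewrite !J0 !subr0.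
move=> h; apply: (le_trans (h _ _ _ _ _)); rewrite ?lexx ?x0 //; first exact: rint_norm.
by apply: J_mono; rewrite ?x0 ?x1 //; exact: rint_norm.
Qed.

(** Stands in for the limit [n -> oo] in the bisection, bootstrap and Picard arguments, whose errors
    have the form [B / 2 ^+ n]. *)
Lemma le_halving a b B : 0 <= B -> (forall n, a <= b + B / 2 ^+ n) -> a <= b.
Proof.
move=> B0 h; apply/ler_addgt0Pr => e e0.
pose n := Num.bound (B / e).
have hn : B / e < n%:R by apply: archi_boundP; rewrite divr_ge0 // ltW.
apply: le_trans (h n) _; rewrite lerD2l ler_pdivrMr ?exprn_gt0 //.
move: hn; rewrite ltr_pdivrMr // => hn; apply/ltW/(lt_le_trans hn).
by rewrite mulrC ler_pM2l // -natrX ler_nat; exact/ltnW/ltn_expl.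
Qed.

(* The value of [m] along the interval is halved by the intermediate value theorem. *)
Lemma quadratic_increment_constant (H m : R -> R) :
  {within `[0%R, 1%R], continuous m} ->
  (forall a b, 0 <= a <= b -> b <= 1 -> m a <= m b) ->
  (forall a b, 0 <= a <= b -> b <= 1 -> `|H b - H a| <= (m b - m a) ^+ 2) ->
  forall x, 0 <= x <= 1 -> H x = H 0.
Proof.
move=> cm mm hH.
have key n a b : 0 <= a <= b -> b <= 1 -> `|H b - H a| <= (m b - m a) ^+ 2 / 2 ^+ n.
  elim: n a b => [|n IH] a b hab b1; first by rewrite expr0 divr1 hH.
  have /andP[a0 ab] := hab.
  have mab := mm _ _ hab b1.
  have : exists2 c, c \in `[a, b] & m c = (m a + m b) / 2.
    apply: IVT => //.
      apply: continuous_subspaceW cm => t /=; rewrite !in_itv /= => /andP[? ?].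
      by rewrite (le_trans a0) //= (le_trans _ b1).
    by rewrite minEle maxEle mab; lra.
  move=> [c]; rewrite in_itv /= => /andP[ac cb] mc.
  have h1 := IH a c; have h2 := IH c b.
  have {}h1 : `|H c - H a| <= (m c - m a) ^+ 2 / 2 ^+ n by apply: h1; rewrite ?a0 ?ac // (le_trans cb).
  have {}h2 : `|H b - H c| <= (m b - m c) ^+ 2 / 2 ^+ n by apply: h2; rewrite ?cb ?(le_trans a0 ac) ?b1.
  have -> : H b - H a = (H b - H c) + (H c - H a) by lra.
  apply: le_trans (ler_normD _ _) _; apply: le_trans (lerD h2 h1) _.
  have t0 : 2 ^+ n != 0 :> R by rewrite expf_neq0.
  rewrite mc (_ : 2 ^+ n.+1 = 2 * 2 ^+ n); last by rewrite exprS.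
  by rewrite le_eqVlt; apply/orP; left; apply/eqP; field; rewrite t0.
move=> x /andP[x0 x1]; apply/eqP; rewrite -subr_eq0 -normr_eq0 eq_le normr_ge0 andbT.
apply: (@le_halving _ _ ((m x - m 0) ^+ 2)); first exact: sqr_ge0.
by move=> n; rewrite add0r; apply: key; rewrite ?lexx.
Qed.

(* No Fubini: the defect of the product rule on [a, b] is at most
   the square of the increment of [J (|f| + |g|)]. *)
Lemma J_prod f g x : rint f -> rint g -> 0 <= x <= 1 ->
  J f x * J g x = J (fun t => f t * J g t + J f t * g t) x.
Proof.
move=> fi gi hx.
have fJ : rint (fun t => f t * J g t).
  by apply: (@rintM _ _ (J (fun t => `|g t|) 1)) => //; [exact: J_measurable|move=> t ht; exact: J_bound].
have gJ : rint (fun t => J f t * g t).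
  apply: (@rint_eq (fun t => g t * J f t)); first by move=> t _; rewrite mulrC.
  by apply: (@rintM _ _ (J (fun t => `|f t|) 1)) => //; [exact: J_measurable|move=> t ht; exact: J_bound].
pose h t := `|f t| + `|g t|.
have hi : rint h by apply: rintD; exact: rint_norm.
pose H y := J f y * J g y - J (fun t => f t * J g t + J f t * g t) y.
have := @quadratic_increment_constant H (fun y => 2 * J h y).
suff hH : forall a b, 0 <= a <= b -> b <= 1 -> `|H b - H a| <= (2 * J h b - 2 * J h a) ^+ 2.
  move=> /(_ _ _ hH x hx); rewrite /H !J0 mul0r subrr => hq; apply/eqP; rewrite -subr_eq0; apply/eqP/hq.
    move=> t; apply: cvgM; [exact: cvg_cst|exact: J_continuous].
  move=> a b hab b1; rewrite ler_pM2l //; apply: J_mono => // t ht.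
  by rewrite /h addr_ge0.
move=> a b hab b1.
have /andP[a0 ab] := hab.
have ha : 0 <= a <= 1 by rewrite a0 (le_trans ab).
have hb : 0 <= b <= 1 by rewrite b1 (le_trans a0).
set d := J h b - J h a.
have d0 : 0 <= d by rewrite subr_ge0; apply: J_mono => // t ht; rewrite /h addr_ge0.
have fb (t1 t2 : R) : a <= t1 <= t2 -> t2 <= b -> `|J f t2 - J f t1| <= d.
  move=> /andP[at1 t12] t2b.
  have h1 : `|J f t2 - J f t1| <= J h t2 - J h t1.
    apply: J_le_diff => //; first by rewrite t12 (le_trans a0).
      exact: le_trans t2b b1.
    by move=> t _; rewrite /h lerDl.
  have h2 : J h t2 <= J h b by apply: J_mono => //; [rewrite t2b (le_trans a0) // (le_trans at1)|by move=> t _; rewrite addr_ge0].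
  have h3 : J h a <= J h t1.
    by apply: J_mono => //; [rewrite a0 at1|rewrite (le_trans t12) // (le_trans t2b)|by move=> t _; rewrite addr_ge0].
  rewrite /d; lra.
have gb (t1 t2 : R) : a <= t1 <= t2 -> t2 <= b -> `|J g t2 - J g t1| <= d.
  move=> /andP[at1 t12] t2b.
  have h1 : `|J g t2 - J g t1| <= J h t2 - J h t1.
    apply: J_le_diff => //; first by rewrite t12 (le_trans a0).
      exact: le_trans t2b b1.
    by move=> t _; rewrite /h lerDr.
  have h2 : J h t2 <= J h b by apply: J_mono => //; [rewrite t2b (le_trans a0) // (le_trans at1)|by move=> t _; rewrite addr_ge0].
  have h3 : J h a <= J h t1.
    by apply: J_mono => //; [rewrite a0 at1|rewrite (le_trans t12) // (le_trans t2b)|by move=> t _; rewrite addr_ge0].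
  rewrite /d; lra.
(* The integral of [F] over []a, b]] is exactly the defect [H b - H a], and both brackets are
   increments over subintervals of [[a, b]], hence at most [d] in modulus. *)
pose F t := f t * (J g b - J g t) + g t * (J f a - J f t).
have Fi : rint F.
  apply: (@rint_eq (fun t => (J g b * f t - f t * J g t) + (J f a * g t - J f t * g t))).
    by move=> t _; rewrite /F; ring.
  by apply: rintD; apply: rintB => //; exact: rintZ.
have -> : H b - H a = J F b - J F a.
  have JF y : 0 <= y <= 1 -> J F y = (J g b * J f y + J f a * J g y) - J (fun t => f t * J g t + J f t * g t) y.
    move=> hy; rewrite -!JZ // -JD; [|by []|exact: rintZ|exact: rintZ].
    rewrite -JB; [|by []|by apply: rintD; exact: rintZ|exact: rintD].
    by apply: eq_J => // t _; rewrite /F; ring.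
  by rewrite !JF // /H; ring.
rewrite J_diff //.
have sub : (`]a, b] `<=` I01)%classic.
  by move=> t /=; rewrite !in_itv /= => /andP[/ltW at_ tb]; rewrite (le_trans a0 at_) (le_trans tb b1).
apply: le_trans (le_normr_Rintegral _ _) _ => //; first by apply: integrableS Fi.
apply: (@le_trans _ _ (Rintegral mu `]a, b]%classic (fun t => d * h t))).
  apply: le_Rintegral => //.
  - by apply: integrableS (rint_norm Fi).
  - by apply: integrableS (rintZ d hi).
  - move=> t /=; rewrite in_itv /= => /andP[/ltW at_ tb].
    rewrite /F /h [d * _]mulrDr; apply: le_trans (ler_normD _ _) _.
    rewrite !normrM ![d * _]mulrC; apply: lerD.
      by apply: ler_pM => //; rewrite gb // at_ tb.
    by apply: ler_pM => //; rewrite distrC fb // lexx at_.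
have -> : Rintegral mu `]a, b] (fun t => d * h t) = d * d.
  rewrite -J_diff //; last exact: rintZ.
  by rewrite !JZ // -mulrBr.
rewrite -mulrBr -/d exprMn -!expr2; nra.
Qed.

(** At a Lebesgue point inside the interval [J f] has derivative [f x], while it is zero nearby; the
    two endpoints form a null set. Extending [f] by zero makes it locally integrable on the line. *)
Lemma J_eq0_ae f : rint f -> (forall x, 0 <= x <= 1 -> J f x = 0) ->
  {ae mu, forall x, 0 <= x <= 1 -> f x = 0}.
Proof.
move=> fi f0.
have loc : locally_integrable [set: R] (f \_ I01) by apply: integrable_locally.
have n0 : {ae mu, forall x : R, x != 0}.
  exists [set 0%R]%classic; split; [exact: measurable_set1|exact: lebesgue_measure_set1|].
  by move=> x /= /negP; rewrite negbK => /eqP.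
have n1 : {ae mu, forall x : R, x != 1}.
  exists [set 1%R]%classic; split; [exact: measurable_set1|exact: lebesgue_measure_set1|].
  by move=> x /= /negP; rewrite negbK => /eqP.
have := lebesgue_differentiation loc.
move: n0 n1; apply: filterS3; first exact: (ae_filter_ringOfSetsType mu).
move=> x x0 x1 hx /andP[]; rewrite !le_eqVlt eq_sym (negbTE x0) (negbTE x1) /= => x0' x1'.
have fi2 : rint (f \_ I01).
  apply: rint_eq fi => t ht; rewrite patchE mem_set //=; by rewrite in_itv.
have [] := @FTC1_lebesgue_pt R (f \_ I01) (BLeft 0) x 1 x1' fi2 _ hx.
  by rewrite /= lte_fin.
move=> _; rewrite patchE mem_set /=; last by rewrite in_itv /= !ltW.
move=> <-; rewrite derive1E.
rewrite (_ : 'D_1 _ x = 'D_1 (cst (0 : R)) x); last first.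
  apply: near_eq_derive.
  have : \forall y \near x, y \in `]0, 1[ by apply: near_in_itvoo; rewrite in_itv /= x0'.
  apply: filterS => y; rewrite in_itv /= => /andP[y0 y1].
  have hy : 0 <= y <= 1 by rewrite !ltW.
  rewrite -[RHS](f0 y hy); apply: eq_J => //.
  by move=> t ht; rewrite patchE mem_set //= in_itv.
by rewrite derive_cst.
Qed.

End RealIntegral.

(** * Complex-valued primitives *)

Section Modulus.
Variable R : realType.
Implicit Types (x y z : R[i]).

(** The norm of [R[i]] takes values in [R[i]], where the order is partial; estimates are carried out
    in [R]. *)
Definition nm (z : R[i]) : R := Normc.normc z.

Lemma normC_nm z : `|z| = (nm z)%:C%C.
Proof. by case: z. Qed.

Lemma nm_ge0 z : 0 <= nm z.
Proof. by case: z => a b; exact: sqrtr_ge0. Qed.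

Lemma nmM x y : nm (x * y) = nm x * nm y. Proof. exact: Normc.normcM. Qed.
Lemma nmD x y : nm (x + y) <= nm x + nm y. Proof. exact: le_normcD. Qed.
Lemma nmN x : nm (- x) = nm x. Proof. exact: (@normcN R). Qed.
Lemma nmV x : nm x^-1 = (nm x)^-1. Proof. exact: Normc.normcV. Qed.
Lemma nm0 : nm 0 = 0. Proof. exact: Normc.normc0. Qed.
Lemma nm1 : nm 1 = 1. Proof. exact: Normc.normc1. Qed.
Lemma nm_eq0 z : (nm z == 0) = (z == 0).
Proof. by apply/eqP/eqP => [/Normc.eq0_normc|->]; rewrite ?nm0. Qed.
Lemma nm_gt0 z : (0 < nm z) = (z != 0).
Proof. by rewrite lt_def nm_ge0 andbT nm_eq0. Qed.
Lemma nm_le0 z : nm z <= 0 -> z = 0.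
Proof. by move=> h; apply/eqP; rewrite -nm_eq0 eq_le h nm_ge0. Qed.
Lemma nmB x y : nm (x - y) <= nm x + nm y.
Proof. by rewrite -(nmN y); exact: nmD. Qed.
Lemma nm_distC x y : nm (x - y) = nm (y - x).
Proof. by rewrite -nmN opprB. Qed.
Lemma nm_tri x y : nm x <= nm y + nm (x - y).
Proof. by rewrite -{1}(subrK y x) addrC; exact: nmD. Qed.
Lemma nmX z n : nm (z ^+ n) = nm z ^+ n.
Proof. by elim: n => [|n IH]; rewrite ?expr0 ?nm1 // !exprS nmM IH. Qed.
Lemma nm_real (a : R) : nm a%:C%C = `|a|.
Proof. by rewrite /nm /= expr0n addr0 sqrtr_sqr. Qed.
Lemma nm_nat n : nm n%:R = n%:R.
Proof. by rewrite -(rmorph_nat (real_complex R)) nm_real ger0_norm ?ler0n. Qed.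

Lemma nm_Re z : `|complex.Re z| <= nm z.
Proof.
case: z => a b /=; rewrite -[`|a|]sqrtr_sqr /nm /=.
by apply: ler_wsqrtr; rewrite lerDl sqr_ge0.
Qed.

Lemma nm_Im z : `|complex.Im z| <= nm z.
Proof.
case: z => a b /=; rewrite -[`|b|]sqrtr_sqr /nm /=.
by apply: ler_wsqrtr; rewrite lerDr sqr_ge0.
Qed.

Lemma nm_ReIm z : nm z <= `|complex.Re z| + `|complex.Im z|.
Proof.
case: z => a b /=; have h : 0 <= `|a| + `|b| by rewrite addr_ge0.
rewrite -[leRHS]ger0_norm // -sqrtr_sqr /nm /=; apply: ler_wsqrtr.
rewrite sqrrD !real_normK ?num_real //.
have : 0 <= `|a| * `|b| by rewrite mulr_ge0.
lra.
Qed.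

Lemma cReD x y : complex.Re (x + y) = complex.Re x + complex.Re y.
Proof. by case: x; case: y. Qed.
Lemma cImD x y : complex.Im (x + y) = complex.Im x + complex.Im y.
Proof. by case: x; case: y. Qed.
Lemma cReM x y : complex.Re (x * y) = complex.Re x * complex.Re y - complex.Im x * complex.Im y.
Proof. by case: x; case: y. Qed.
Lemma cImM x y : complex.Im (x * y) = complex.Re x * complex.Im y + complex.Im x * complex.Re y.
Proof. by case: x; case: y. Qed.
Lemma cReN x : complex.Re (- x) = - complex.Re x.
Proof. by case: x. Qed.
Lemma cImN x : complex.Im (- x) = - complex.Im x.
Proof. by case: x. Qed.
Lemma complex_ext x y : complex.Re x = complex.Re y -> complex.Im x = complex.Im y -> x = y.
Proof. by case: x => a b; case: y => c d /= -> ->. Qed.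

End Modulus.

Section ComplexIntegral.
Variable R : realType.
Local Notation C := R[i].
Local Notation mu := (@lebesgue_measure R).
Local Notation I01 := (`[0%R, 1%R]%classic : set R).
Local Notation re := (@complex.Re R).
Local Notation im := (@complex.Im R).
Implicit Types (f g F G : R -> C) (x t a b e B : R) (c : C).

Definition cmeas g := measurable_fun I01 (fun t => re (g t)) /\ measurable_fun I01 (fun t => im (g t)).

Lemma cintegrable_eq f g : (forall t, 0 <= t <= 1 -> f t = g t) -> cintegrable f -> cintegrable g.
Proof. by move=> fg [h1 h2]; split; [apply: rint_eq h1|apply: rint_eq h2] => t ht; rewrite fg. Qed.

Lemma cintegrableD f g : cintegrable f -> cintegrable g -> cintegrable (fun t => f t + g t).
Proof.
move=> [f1 f2] [g1 g2]; split.
  by apply: rint_eq (rintD f1 g1) => t _; rewrite cReD.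
by apply: rint_eq (rintD f2 g2) => t _; rewrite cImD.
Qed.

Lemma cintegrableZ c f : cintegrable f -> cintegrable (fun t => c * f t).
Proof.
move=> [f1 f2]; split.
  by apply: rint_eq (rintB (rintZ (re c) f1) (rintZ (im c) f2)) => t _; rewrite cReM.
by apply: rint_eq (rintD (rintZ (re c) f2) (rintZ (im c) f1)) => t _; rewrite cImM.
Qed.

Lemma cintegrableN f : cintegrable f -> cintegrable (fun t => - f t).
Proof. by move=> /(cintegrableZ (-1)); apply: cintegrable_eq => t _; rewrite mulN1r. Qed.

Lemma cintegrableB f g : cintegrable f -> cintegrable g -> cintegrable (fun t => f t - g t).
Proof. by move=> fi gi; exact: (cintegrableD fi (cintegrableN gi)). Qed.

Lemma cintegrableM f g B : cintegrable f -> cmeas g ->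
  (forall t, 0 <= t <= 1 -> nm (g t) <= B) -> cintegrable (fun t => f t * g t).
Proof.
move=> [f1 f2] [g1 g2] gB.
have b1 (t : R) : 0 <= t <= 1 -> `|re (g t)| <= B by move=> /gB; exact: le_trans (nm_Re _).
have b2 (t : R) : 0 <= t <= 1 -> `|im (g t)| <= B by move=> /gB; exact: le_trans (nm_Im _).
split.
  by apply: rint_eq (rintB (rintM f1 g1 b1) (rintM f2 g2 b2)) => t _; rewrite cReM.
by apply: rint_eq (rintD (rintM f1 g2 b2) (rintM f2 g1 b1)) => t _; rewrite cImM.
Qed.

Lemma cintegrable_cst c : cintegrable (fun _ : R => c).
Proof. by split; exact: rint_cst. Qed.

Lemma cintE f x : cint f x = (J (fun t => re (f t)) x +i* J (fun t => im (f t)) x)%C.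
Proof. by []. Qed.

Lemma eq_cint f g x : 0 <= x <= 1 -> (forall t, 0 <= t <= 1 -> f t = g t) -> cint f x = cint g x.
Proof. by move=> hx fg; rewrite !cintE; congr (_ +i* _)%C; apply: eq_J => // t ht; rewrite fg. Qed.

Lemma cint0 f : cint f 0 = 0.
Proof. by rewrite cintE !J0. Qed.

Lemma cintD f g x : 0 <= x <= 1 -> cintegrable f -> cintegrable g ->
  cint (fun t => f t + g t) x = cint f x + cint g x.
Proof.
move=> hx [f1 f2] [g1 g2]; rewrite !cintE; apply: complex_ext => /=; rewrite -JD //.
  by apply: eq_J => // t _; rewrite cReD.
by apply: eq_J => // t _; rewrite cImD.
Qed.

Lemma cintZ c f x : 0 <= x <= 1 -> cintegrable f ->
  cint (fun t => c * f t) x = c * cint f x.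
Proof.
move=> hx [f1 f2]; rewrite !cintE; apply: complex_ext; rewrite ?cReM ?cImM /= -!JZ //.
  by rewrite -JB //; [apply: eq_J => // t _; rewrite cReM|exact: rintZ|exact: rintZ].
by rewrite -JD //; [apply: eq_J => // t _; rewrite cImM|exact: rintZ|exact: rintZ].
Qed.

Lemma cintN f x : 0 <= x <= 1 -> cintegrable f -> cint (fun t => - f t) x = - cint f x.
Proof.
move=> hx fi; rewrite -mulN1r -cintZ //; apply: eq_cint => // t _; by rewrite mulN1r.
Qed.

Lemma cintB f g x : 0 <= x <= 1 -> cintegrable f -> cintegrable g ->
  cint (fun t => f t - g t) x = cint f x - cint g x.
Proof. by move=> hx fi gi; rewrite cintD //; [rewrite cintN|exact: cintegrableN]. Qed.

(** The factor 2 comes from bounding real and imaginary parts separately; it enters the constants of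
    later estimates. *)
Lemma cint_le_diff f (g : R -> R) a b : 0 <= a <= b -> b <= 1 -> cintegrable f -> rint g ->
  (forall t, a <= t <= b -> nm (f t) <= g t) ->
  nm (cint f b - cint f a) <= 2 * (J g b - J g a).
Proof.
move=> hab b1 [f1 f2] gi fg.
apply: le_trans (nm_ReIm _) _; rewrite !cReD !cImD !cReN !cImN /=.
rewrite mulr_natl mulr2n; apply: lerD; apply: J_le_diff => // t ht.
  by apply: le_trans (fg t ht); exact: nm_Re.
by apply: le_trans (fg t ht); exact: nm_Im.
Qed.

Lemma cint_le f (g : R -> R) x : 0 <= x <= 1 -> cintegrable f -> rint g ->
  (forall t, 0 <= t <= 1 -> nm (f t) <= g t) -> nm (cint f x) <= 2 * J g x.
Proof.
move=> /andP[x0 x1] fi gi fg; have := @cint_le_diff f g 0 x.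
rewrite cint0 J0 !subr0 lexx x0 /=; apply=> // t /andP[t0 tx].
by rewrite fg // t0 (le_trans tx).
Qed.

Lemma rint_ReIm f : cintegrable f -> rint (fun t => `|re (f t)| + `|im (f t)|).
Proof. by move=> [f1 f2]; apply: rintD; exact: rint_norm. Qed.

(** Absolute continuity of [F] with density [f], in the integral form used by [edge_sol]; no
    pointwise derivative is needed. *)
Definition prim f F := cintegrable f /\ forall x, 0 <= x <= 1 -> F x = F 0 + cint f x.

Lemma prim_cint f : cintegrable f -> prim f (cint f).
Proof. by move=> fi; split=> // x _; rewrite cint0 add0r. Qed.

Lemma prim_eq f g F G : (forall t, 0 <= t <= 1 -> f t = g t) ->
  (forall t, 0 <= t <= 1 -> F t = G t) -> prim f F -> prim g G.
Proof.
move=> fg FG [fi hF]; split; first exact: cintegrable_eq fi.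
move=> x hx; rewrite -!FG ?lexx ?ler01 // hF //; congr (_ + _); exact: eq_cint.
Qed.

Lemma prim_cst c : prim (fun _ => 0) (fun _ => c).
Proof.
split=> [|x /andP[x0 _]]; first exact: cintegrable_cst.
have -> : cint (fun _ : R => 0 : C) x = 0 by rewrite cintE /= !J_cst ?mul0r.
by rewrite addr0.
Qed.

Lemma primD f g F G : prim f F -> prim g G -> prim (fun t => f t + g t) (fun t => F t + G t).
Proof.
move=> [fi hF] [gi hG]; split; first exact: cintegrableD.
move=> x hx; rewrite cintD // hF // hG //; ring.
Qed.

Lemma primZ c f F : prim f F -> prim (fun t => c * f t) (fun t => c * F t).
Proof.
move=> [fi hF]; split; first exact: cintegrableZ.
move=> x hx; rewrite cintZ // hF //; ring.
Qed.

Lemma primB f g F G : prim f F -> prim g G -> prim (fun t => f t - g t) (fun t => F t - G t).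
Proof.
move=> [fi hF] [gi hG]; split; first exact: cintegrableB.
move=> x hx; rewrite cintB // hF // hG //; ring.
Qed.

Lemma prim_bounded f F : prim f F -> exists2 B, 0 <= B & forall t, 0 <= t <= 1 -> nm (F t) <= B.
Proof.
move=> [fi hF]; have gi := rint_ReIm fi.
have g0 (t : R) : 0 <= `|re (f t)| + `|im (f t)| by rewrite addr_ge0.
exists (nm (F 0) + 2 * J (fun t => `|re (f t)| + `|im (f t)|) 1).
  by rewrite addr_ge0 ?nm_ge0 // mulr_ge0 // J_ge0 // ler01 lexx.
move=> t ht; rewrite hF //; apply: le_trans (nmD _ _) _; rewrite lerD2l.
apply: le_trans (cint_le ht fi gi _) _; first by move=> s _; exact: nm_ReIm.
by rewrite ler_pM2l // J_mono //; case/andP: ht => -> ->.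
Qed.

Lemma cmeas_eq f g : (forall t, 0 <= t <= 1 -> f t = g t) -> cmeas f -> cmeas g.
Proof.
move=> fg [h1 h2]; split; [apply: eq_measurable_fun h1|apply: eq_measurable_fun h2] => t;
  by rewrite inE /= in_itv /= => ht; rewrite fg.
Qed.

Lemma prim_cmeas f F : prim f F -> cmeas F.
Proof.
move=> [[f1 f2] hF]; apply: (@cmeas_eq (fun x => F 0 + cint f x)) => [t /hF//|].
split.
  have -> : (fun t => re (F 0 + cint f t)) = (fun t => re (F 0) + J (fun t => re (f t)) t).
    by apply/funext => t; rewrite cReD.
  by apply: measurable_funD; [exact: measurable_cst|exact: J_measurable].
have -> : (fun t => im (F 0 + cint f t)) = (fun t => im (F 0) + J (fun t => im (f t)) t).
  by apply/funext => t; rewrite cImD.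
by apply: measurable_funD; [exact: measurable_cst|exact: J_measurable].
Qed.

Lemma cintegrable_prim f F : prim f F -> cintegrable F.
Proof.
move=> pF; have [B _ FB] := prim_bounded pF.
apply: (@cintegrable_eq (fun t => 1 * F t)); first by move=> t _; rewrite mul1r.
by apply: (cintegrableM _ (prim_cmeas pF) FB); exact: cintegrable_cst.
Qed.

Lemma cintegrableMprim h g G : cintegrable h -> prim g G -> cintegrable (fun t => h t * G t).
Proof.
by move=> hi pG; have [B _ FB] := prim_bounded pG; exact: (cintegrableM hi (prim_cmeas pG) FB).
Qed.

Lemma cint_prod f g x : cintegrable f -> cintegrable g -> 0 <= x <= 1 ->
  cint f x * cint g x = cint (fun t => f t * cint g t + cint f t * g t) x.
Proof.
move=> fi gi hx; have [f1 f2] := fi; have [g1 g2] := gi.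
have M (u v : R -> R) : rint u -> rint v -> rint (fun t => u t * J v t).
  by move=> ui vi; apply: (@rintM _ _ _ (J (fun t => `|v t|) 1)) => //; [exact: J_measurable|move=> t ht; exact: J_bound].
have M' (u v : R -> R) : rint u -> rint v -> rint (fun t => J u t * v t).
  by move=> ui vi; apply: rint_eq (M _ _ vi ui) => t _; rewrite mulrC.
have M2 (u v : R -> R) : rint u -> rint v -> rint (fun t => u t * J v t + J u t * v t).
  by move=> ui vi; apply: rintD; [exact: M|exact: M'].
apply: complex_ext.
  rewrite cReM !cintE /= !J_prod // -JB //; [|exact: M2|exact: M2].
  by apply: eq_J => // t _; rewrite cReD !cReM !cintE /=; ring.
rewrite cImM !cintE /= !J_prod // -JD //; [|exact: M2|exact: M2].
by apply: eq_J => // t _; rewrite cImD !cImM !cintE /=; ring.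
Qed.

(** Splitting off the initial values reduces this to [cint_prod]. It yields the Wronskians, the
    integrating factors and the derivatives of squares. *)
Lemma prim_mul f g F G : prim f F -> prim g G ->
  prim (fun t => f t * G t + F t * g t) (fun t => F t * G t).
Proof.
move=> pF pG; have [fi hF] := pF; have [gi hG] := pG.
split.
  apply: cintegrableD; first exact: (cintegrableMprim fi pG).
  by apply: cintegrable_eq (cintegrableMprim gi pF) => t _; rewrite mulrC.
move=> x hx; rewrite [F x]hF // [G x]hG //.
have fg : cintegrable (fun t => f t * cint g t) by apply: cintegrableMprim (prim_cint gi).
have gf : cintegrable (fun t => cint f t * g t).
  by apply: cintegrable_eq (cintegrableMprim gi (prim_cint fi)) => t _; rewrite mulrC.
rewrite (@eq_cint (fun t => f t * G t + F t * g t) (fun t => (G 0 * f t + F 0 * g t) + (f t * cint g t + cint f t * g t))) //; last first.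
  by move=> t ht; rewrite [F t]hF // [G t]hG //; ring.
rewrite cintD //; [|by apply: cintegrableD; exact: cintegrableZ|exact: cintegrableD].
rewrite -cint_prod // cintD //; [|exact: cintegrableZ|exact: cintegrableZ].
rewrite !cintZ //; ring.
Qed.

Lemma prim_diff f F (g : R -> R) a b : prim f F -> 0 <= a <= b -> b <= 1 -> rint g ->
  (forall t, a <= t <= b -> nm (f t) <= g t) -> nm (F b - F a) <= 2 * (J g b - J g a).
Proof.
move=> [fi hF] hab b1 gi fg; have /andP[a0 ab] := hab.
rewrite (hF b) ?(hF a) ?b1 ?(le_trans a0 ab) ?a0 ?(le_trans ab b1) //.
have -> : F 0 + cint f b - (F 0 + cint f a) = cint f b - cint f a by ring.
exact: cint_le_diff.
Qed.

Lemma prim_eq0_ae f F : prim f F -> (forall x, 0 <= x <= 1 -> F x = F 0) ->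
  {ae mu, forall x, 0 <= x <= 1 -> f x = 0}.
Proof.
move=> [[f1 f2] hF] F0.
have h (x : R) : 0 <= x <= 1 -> cint f x = 0.
  by move=> hx; have := hF x hx; rewrite F0 // => /esym/(canRL (addKr _)); rewrite addNr.
have h1 := J_eq0_ae f1; have h2 := J_eq0_ae f2.
have {}h1 := h1 (fun x hx => congr1 re (h x hx)).
have {}h2 := h2 (fun x hx => congr1 im (h x hx)).
move: h1 h2; apply: filterS2; first exact: (ae_filter_ringOfSetsType mu).
by move=> x h1 h2 hx; apply: complex_ext; [exact: h1|exact: h2].
Qed.

(** Bisection by values of [m]: the intermediate value theorem halves the increment and the piece
    containing [x] is kept. Distinct end values keep that piece nondegenerate; equal ones end the
    search. *)
Lemma small_increment (m : R -> R) x e :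
  {within `[0%R, 1%R], continuous m} -> 0 < e ->
  (forall a b, 0 <= a <= b -> b <= 1 -> m a <= m b) -> 0 <= x <= 1 ->
  exists a b, [/\ 0 <= a, a < b, b <= 1, a <= x <= b & m b - m a <= e].
Proof.
move=> cm e0 mm hx.
have key n : exists a b, [/\ 0 <= a, a < b, b <= 1, a <= x <= b & m b - m a <= (m 1 - m 0) / 2 ^+ n].
  elim: n => [|n [a [b [a0 ab b1 /andP[ax xb] hm]]]].
    by exists 0, 1; rewrite !lexx ltr01 expr0 divr1.
  have p0 : 0 < 2 ^+ n :> R by rewrite exprn_gt0.
  have D0 : 0 <= m 1 - m 0 by rewrite subr_ge0 mm // lexx ler01.
  have mab : m a <= m b by apply: mm b1; rewrite a0 ltW.
  have [eqm|neqm] := eqVneq (m a) (m b).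
    exists a, b; rewrite a0 ab b1 ax xb eqm subrr; split=> //.
    by apply: divr_ge0 => //; apply: exprn_ge0.
  have : exists2 c, c \in `[a, b] & m c = (m a + m b) / 2.
    apply: IVT; first exact: ltW.
      apply: continuous_subspaceW cm => t /=; rewrite !in_itv /= => /andP[? ?].
      by rewrite (le_trans a0) //= (le_trans _ b1).
    by rewrite minEle maxEle mab; lra.
  move=> [c]; rewrite in_itv /= => /andP[ac cb] mc.
  have ac' : a < c.
    rewrite lt_neqAle ac andbT; apply/eqP => ec; move: mc neqm; rewrite -ec => mc /eqP; apply; lra.
  have cb' : c < b.
    rewrite lt_neqAle cb andbT; apply/eqP => ec; move: mc neqm; rewrite ec => mc /eqP; apply; lra.
  have half : (m b - m a) / 2 <= (m 1 - m 0) / 2 ^+ n.+1.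
    have -> : (m 1 - m 0) / 2 ^+ n.+1 = ((m 1 - m 0) / 2 ^+ n) / 2.
      by rewrite exprS; field; rewrite lt0r_neq0.
    by rewrite ler_pM2r ?invr_gt0.
  have [xc|cx] := leP x c.
    exists a, c; split=> //; [exact: le_trans b1|by rewrite ax xc|].
    apply: le_trans half; lra.
  exists c, b; split=> //; [exact: le_trans ac|by rewrite (ltW cx) xb|].
  apply: le_trans half; lra.
have D0 : 0 <= m 1 - m 0 by rewrite subr_ge0 mm // lexx ler01.
have [n hn] : exists n, (m 1 - m 0) / 2 ^+ n <= e.
  apply: contrapT => /forallNP hn.
  suff : e <= 0 by rewrite leNgt e0.
  apply: (le_halving D0) => n; rewrite add0r ltW // ltNge; exact/negP.
have [a [b [? ? ? ? hm]]] := key n; exists a, b; split=> //; exact: le_trans hn.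
Qed.

(** Vanishing everywhere, not just almost everywhere, because [f] is itself absolutely continuous:
    on a short interval around [x] the integral of [f - f x] is small compared with the length,
    while [F] has increment 0. *)
Lemma prim_eq0 f g F : prim f F -> prim g f -> (forall x, 0 <= x <= 1 -> F x = F 0) ->
  forall x, 0 <= x <= 1 -> f x = 0.
Proof.
move=> pF pf F0 x hx; apply/nm_le0/ler_addgt0Pl => e e0; rewrite addr0.
have [fi hF] := pF; have [gi hf] := pf.
have hi := rint_ReIm gi; set h := (fun t => _) in hi.
have h0 (t : R) : 0 <= h t by rewrite addr_ge0.
have mh a b : 0 <= a <= b -> b <= 1 -> J h a <= J h b by move=> hab b1; apply: J_mono.
(* [prim_diff] doubles the increment of [J h], so [f] varies by at most [e / 2]; real and imaginary
   parts then add up to [e]. *)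
have e8 : 0 < e / 4 by rewrite divr_gt0.
have [a [b [a0 ab b1 /andP[ax xb] hm]]] := small_increment (J_continuous hi) e8 mh hx.
have pd : prim (fun t => f t - f x) (fun t => F t - f x * t%:C%C).
  apply: primB => //.
  have pt : prim (fun=> 1) (fun t : R => t%:C%C).
    split=> [|y hy]; first exact: cintegrable_cst.
    have /andP[y0 _] := hy.
    by rewrite cintE /= !J_cst // mul1r mul0r; apply: complex_ext => /=; rewrite ?add0r.
  by apply: prim_eq (primZ (f x) pt) => // t _; rewrite mulr1.
have hd : nm (f x * (b - a)%:C%C) <= e * (b - a).
  have -> : f x * (b - a)%:C%C = - ((F b - f x * b%:C%C) - (F a - f x * a%:C%C)).
    by rewrite (F0 b) ?(F0 a) ?rmorphB //=; [ring| |]; rewrite ?a0 ?b1 ?(le_trans a0 (ltW ab)) ?(le_trans (ltW ab)).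
  rewrite nmN.
  have step t : a <= t <= b -> nm (f t - f x) <= e / 2.
    move=> /andP[at_ tb].
    have ht0 : 0 <= t by exact: le_trans at_.
    have hx0 : 0 <= x by exact: le_trans ax.
    have ha : J h a <= J h t by apply: mh => //; [rewrite a0|exact: le_trans b1].
    have ha' : J h a <= J h x by apply: mh => //; [rewrite a0|exact: le_trans b1].
    have hb : J h t <= J h b by apply: mh => //; rewrite ht0.
    have hb' : J h x <= J h b by apply: mh => //; rewrite hx0.
    have gh (c d s : R) : c <= s <= d -> nm (g s) <= h s by move=> _; exact: nm_ReIm.
    have [tx|xt] := leP t x.
      have h1 : 0 <= t <= x by rewrite ht0.
      rewrite nm_distC; apply: le_trans (prim_diff pf h1 (le_trans xb b1) hi (gh _ _)) _; lra.
    have h1 : 0 <= x <= t by rewrite hx0 ltW.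
    apply: le_trans (prim_diff pf h1 (le_trans tb b1) hi (gh _ _)) _; lra.
  have [fdi hFd] := pd.
  have -> : F b - f x * b%:C%C - (F a - f x * a%:C%C) = cint (fun t => f t - f x) b - cint (fun t => f t - f x) a.
    rewrite hFd ?b1 ?(le_trans a0 (ltW ab)) // [F a - _]hFd ?a0 ?(le_trans (ltW ab)) //; ring.
  apply: le_trans (nm_ReIm _) _; rewrite !cReD !cImD !cReN !cImN /=.
  have [d1 d2] := fdi.
  have hab : 0 <= a <= b by rewrite a0 ltW.
  rewrite !J_diff //.
  have sub : (`]a, b] `<=` I01)%classic.
    by move=> t /=; rewrite !in_itv /= => /andP[/ltW at_ tb]; rewrite (le_trans a0 at_) (le_trans tb b1).
  have bnd (k : R -> R) : rint k -> (forall t, a <= t <= b -> `|k t| <= e / 2) ->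
      `|Rintegral mu `]a, b] k| <= e / 2 * (b - a).
    move=> ki kb; apply: le_trans (le_normr_Rintegral _ _) _ => //; first by apply: integrableS ki.
    apply: (@le_trans _ _ (Rintegral mu `]a, b] (fun=> e / 2))).
      apply: le_Rintegral => //.
      - by apply: integrableS (rint_norm ki).
      - by apply: integrableS (rint_cst (e / 2)).
      - by move=> t /=; rewrite in_itv /= => /andP[/ltW at_ tb]; rewrite kb ?at_.
    rewrite -J_diff //; last exact: rint_cst.
    by rewrite !J_cst ?(le_trans a0 (ltW ab)) // mulrBr.
  have -> : e * (b - a) = e / 2 * (b - a) + e / 2 * (b - a) by field.
  by apply: lerD; apply: bnd => // t /step; apply: le_trans; [exact: nm_Re|exact: nm_Im].
move: hd; rewrite nmM nm_real ger0_norm; last by rewrite subr_ge0 ltW.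
by rewrite ler_pM2r ?subr_gt0.
Qed.

Lemma J_FTC (F f : R -> R) : (forall t, is_derive t 1 F (f t)) -> continuous f ->
  rint f /\ forall x, 0 <= x -> J f x = F x - F 0.
Proof.
move=> dF cf; split.
  apply: continuous_compact_integrable; first exact: segment_compact.
  exact: continuous_subspaceT.
move=> x; rewrite le_eqVlt => /predU1P[<-|x0]; first by rewrite J0 subrr.
have cF : continuous F.
  move=> t; apply: differentiable_continuous; apply/derivable1_diffP.
  by have [] := dF t.
rewrite /J /Rintegral (@continuous_FTC2 _ f F) //.
- exact: continuous_subspaceT.
- split; first by move=> t _; have [] := dF t.
  + exact/cvg_at_right_filter/cF.
  + exact/cvg_at_left_filter/cF.
- by move=> t _; rewrite derive1E; have [] := dF t.
Qed.

(** Euler's formula for [exp (c t)], the integrating factor of the edge equation. *)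
Definition cexp c (t : R) : C :=
  ((expR (re c * t) * cos (im c * t)) +i* (expR (re c * t) * sin (im c * t)))%C.

Lemma cexp0 c : cexp c 0 = 1.
Proof. by rewrite /cexp !mulr0 expR0 cos0 sin0 mul1r mulr0. Qed.

Lemma cexpK c t : cexp c t * cexp (- c) t = 1.
Proof.
rewrite /cexp cReN cImN !mulNr cosN sinN expRN.
apply: complex_ext; rewrite ?cReM ?cImM /=.
  have e0 : expR (re c * t) != 0 by rewrite lt0r_neq0 // expR_gt0.
  have := cos2Dsin2 (im c * t); set u := cos _; set v := sin _ => huv.
  by rewrite -[RHS]huv; field.
by ring.
Qed.

Lemma nm_cexp c t : nm (cexp c t) = expR (re c * t).
Proof.
rewrite /nm /cexp /= !exprMn -mulrDr cos2Dsin2 mulr1 sqrtr_sqr.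
by rewrite ger0_norm // expR_ge0.
Qed.

Lemma prim_cexp c : prim (fun t => c * cexp c t) (cexp c).
Proof.
set a := re c; set b := im c.
have cexpR : continuous (fun t : R => expR (a * t)).
  move=> t; apply: continuous_comp; last exact: continuous_expR.
  by apply: cvgM; [exact: cvg_cst|exact: cvg_id].
have ccos : continuous (fun t : R => cos (b * t)).
  move=> t; apply: continuous_comp; last exact: continuous_cos.
  by apply: cvgM; [exact: cvg_cst|exact: cvg_id].
have csin : continuous (fun t : R => sin (b * t)).
  move=> t; apply: continuous_comp; last exact: continuous_sin.
  by apply: cvgM; [exact: cvg_cst|exact: cvg_id].
have cc : continuous (fun t : R => expR (a * t) * cos (b * t)).
  by move=> t; apply: cvgM; [exact: cexpR|exact: ccos].
have cs : continuous (fun t : R => expR (a * t) * sin (b * t)).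
  by move=> t; apply: cvgM; [exact: cexpR|exact: csin].
have sc (k : R) (f : R -> R) : continuous f -> continuous (fun t => k * f t).
  by move=> cf t; apply: cvgM; [exact: cvg_cst|exact: cf].
have [i1 e1] := @J_FTC (fun t => expR (a * t) * cos (b * t))
  (fun t => a * (expR (a * t) * cos (b * t)) - b * (expR (a * t) * sin (b * t)))
  (fun t => ltac:(apply: is_derive_eq; rewrite /GRing.scale /=; ring))
  (fun t => cvgB (sc a _ cc t) (sc b _ cs t)).
have [i2 e2] := @J_FTC (fun t => expR (a * t) * sin (b * t))
  (fun t => a * (expR (a * t) * sin (b * t)) + b * (expR (a * t) * cos (b * t)))
  (fun t => ltac:(apply: is_derive_eq; rewrite /GRing.scale /=; ring))
  (fun t => cvgD (sc a _ cs t) (sc b _ cc t)).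
split; first by split; [apply: rint_eq i1|apply: rint_eq i2] => t _; rewrite ?cReM ?cImM.
move=> x /andP[x0 x1]; have hx : 0 <= x <= 1 by rewrite x0.
rewrite cexp0 cintE; apply: complex_ext; rewrite ?cReD ?cImD /=.
  rewrite (@eq_J _ _ (fun t => a * (expR (a * t) * cos (b * t)) - b * (expR (a * t) * sin (b * t)))) //.
    by rewrite e1 // !mulr0 expR0 cos0 mulr1 addrC subrK.
  by move=> t _; rewrite cReM.
rewrite (@eq_J _ _ (fun t => a * (expR (a * t) * sin (b * t)) + b * (expR (a * t) * cos (b * t)))) //.
  by rewrite e2 // !mulr0 sin0 mulr0 subr0 add0r.
by move=> t _; rewrite cImM.
Qed.

End ComplexIntegral.

(** * Solutions on one edge for large spectral parameter *)

Section Edge.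
Variable R : realType.
Local Notation C := R[i].
Local Notation re := (@complex.Re R).
Local Notation im := (@complex.Im R).
Implicit Types (q y z : R -> C) (x t S w W : R) (kap lam c : C).

Lemma edge_solP q lam y z :
  edge_sol q lam y z <-> prim z y /\ prim (fun t => (q t - lam) * y t) z.
Proof.
split=> [[zi [qi h]]|[[zi h1] [qi h2]]]; last by split=> //; split=> // x hx; split; [exact: h1|exact: h2].
by split; split=> // x /h [].
Qed.

Lemma edge_sol_lin q lam y z y' z' c c' : edge_sol q lam y z -> edge_sol q lam y' z' ->
  edge_sol q lam (fun t => c * y t + c' * y' t) (fun t => c * z t + c' * z' t).
Proof.
move=> /edge_solP[p1 p2] /edge_solP[p3 p4]; apply/edge_solP; split.
  exact: primD (primZ c p1) (primZ c' p3).
by apply: prim_eq (primD (primZ c p2) (primZ c' p4)) => // t _; ring.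
Qed.

Lemma wronskian_const q lam y z y' z' : edge_sol q lam y z -> edge_sol q lam y' z' ->
  forall x, 0 <= x <= 1 -> y x * z' x - y' x * z x = y 0 * z' 0 - y' 0 * z 0.
Proof.
move=> /edge_solP[p1 p2] /edge_solP[p3 p4] x hx.
have := primB (prim_mul p1 p4) (prim_mul p3 p2).
have e (t : R) : 0 <= t <= 1 -> z t * z' t + y t * ((q t - lam) * y' t) - (z' t * z t + y' t * ((q t - lam) * y t)) = 0.
  by move=> _; ring.
move=> /(prim_eq e (fun t _ => erefl)) [_ /(_ x hx) ->].
by have [_ /(_ x hx)] := prim_cst (0 : C); rewrite add0r => <-; rewrite addr0.
Qed.

(** Equivalent to the [L^1] norm; the only feature of the potential that enters the bounds. *)
Definition mass q : R := J (fun t => `|re (q t)| + `|im (q t)|) 1.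

Lemma mass_ge0 q : 0 <= mass q.
Proof. by apply: J_ge0 => [t _|]; rewrite ?addr_ge0 // ler01 lexx. Qed.

(** For [q = 0] and [lam = - kap ^ 2], [uu] is a multiple of [exp (kap t)] and [vv] one of
    [exp (- kap t)]: the growing and decaying components when [Re kap > 0]. *)
Definition uu kap y z t : C := z t + kap * y t.
Definition vv kap y z t : C := z t - kap * y t.

Lemma nm_y kap y z t : kap != 0 ->
  nm (y t) * (2 * nm kap) <= nm (uu kap y z t) + nm (vv kap y z t).
Proof.
move=> k0; rewrite -nm_nat -!nmM; apply: le_trans (nmB _ _).
by rewrite /uu /vv le_eqVlt; apply/orP; left; apply/eqP; congr nm; ring.
Qed.

(** Variation of constants: the integrating factor cancels every term in [kap] and leaves only the
    perturbation [q y]. *)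
Lemma prim_uu q kap y z : edge_sol q (- kap ^+ 2) y z ->
  prim (fun t => cexp (- kap) t * (q t * y t)) (fun t => cexp (- kap) t * uu kap y z t).
Proof.
move=> /edge_solP[p1 p2].
have p3 := prim_mul (prim_cexp (- kap)) (primD p2 (primZ kap p1)).
by apply: prim_eq p3 => // t _; rewrite /uu; ring.
Qed.

Lemma prim_vv q kap y z : edge_sol q (- kap ^+ 2) y z ->
  prim (fun t => cexp kap t * (q t * y t)) (fun t => cexp kap t * vv kap y z t).
Proof.
move=> /edge_solP[p1 p2].
have p3 := prim_mul (prim_cexp kap) (primB p2 (primZ kap p1)).
by apply: prim_eq p3 => // t _; rewrite /vv; ring.
Qed.

(** Iterating [S -> c0 + S / 2] from any finite bound converges to its fixed point [2 * c0]; the a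
    priori bound serves only as a start. *)
Lemma self_bound (N : R -> R) (c0 : R) :
  (exists B, forall t, 0 <= t <= 1 -> N t <= B) -> 0 <= c0 ->
  (forall S, 0 <= S -> (forall t, 0 <= t <= 1 -> N t <= S) ->
     forall t, 0 <= t <= 1 -> N t <= c0 + S / 2) ->
  forall t, 0 <= t <= 1 -> N t <= 2 * c0.
Proof.
move=> [B hB] c00 step t ht.
have [D D0 hD] : exists2 D, 0 <= D & forall t, 0 <= t <= 1 -> N t <= D.
  by exists `|B| => // s hs; apply: le_trans (hB s hs) (ler_norm _).
apply: (le_halving D0) => n; elim: n t ht => [|n IH] t ht.
  by rewrite expr0 divr1; apply: le_trans (hD t ht) _; rewrite lerDr mulr_ge0.
apply: le_trans (step _ _ IH t ht) _.
  by rewrite addr_ge0 ?mulr_ge0 // invr_ge0 exprn_ge0.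
have p0 : 2 ^+ n != 0 :> R by rewrite expf_neq0.
by rewrite le_eqVlt; apply/orP; left; apply/eqP; rewrite exprS; field; rewrite p0.
Qed.

Section Bounds.
Variables (q : R -> C) (kap : C) (y z : R -> C).
Hypothesis qi : cintegrable q.
Hypothesis yz : edge_sol q (- kap ^+ 2) y z.
Hypothesis s0 : 0 < re kap.
Hypothesis kQ : 4 * mass q <= nm kap.

Let s := re kap.
Let u := uu kap y z.
Let v := vv kap y z.
Let h := fun t => `|re (q t)| + `|im (q t)|.

Let k0 : 0 < nm kap.
Proof. by apply: lt_le_trans (nm_Re kap); rewrite normr_gt0 lt0r_neq0. Qed.

Let kn0 : kap != 0. Proof. by rewrite -nm_gt0. Qed.

Let uv_bounded : exists B, forall t, 0 <= t <= 1 -> nm (u t) <= B /\ nm (v t) <= B.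
Proof.
have /edge_solP[p1 p2] := yz.
have [B1 B10 hB1] := prim_bounded p1; have [B2 B20 hB2] := prim_bounded p2.
exists (B2 + nm kap * B1) => t ht; split.
  by apply: le_trans (nmD _ _) _; rewrite nmM; apply: lerD; [exact: hB2|rewrite ler_pM2l //; exact: hB1].
by apply: le_trans (nmB _ _) _; rewrite nmM; apply: lerD; [exact: hB2|rewrite ler_pM2l //; exact: hB1].
Qed.

Let y_bound S w t : nm (u t) <= S * w -> nm (v t) <= S * w -> nm (y t) <= S * w / nm kap.
Proof.
move=> hu hv; rewrite ler_pdivlMr //.
have := nm_y y z t kn0; rewrite -/u -/v; nra.
Qed.

Let expR_cancel (a : R) : expR a * expR (- a) = 1.
Proof. by rewrite -expRD subrr expR0. Qed.

Let nmE t : nm (cexp kap t) = expR (s * t). Proof. exact: nm_cexp. Qed.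
Let nmEN t : nm (cexp (- kap) t) = expR (- (s * t)).
Proof. by rewrite nm_cexp cReN mulNr. Qed.

Let hi : rint h. Proof. exact: rint_ReIm. Qed.
Let h0 t : 0 <= h t. Proof. exact: addr_ge0. Qed.
Let qh t : nm (q t) <= h t. Proof. exact: nm_ReIm. Qed.

Let mass_between a b : 0 <= a <= b -> b <= 1 -> J h b - J h a <= mass q.
Proof.
move=> /andP[a0 ab] b1; rewrite lerBlDr.
have h1 : J h b <= mass q by apply: J_mono => //; rewrite b1 (le_trans a0).
have h2 : 0 <= J h a by apply: J_ge0 => //; rewrite a0 (le_trans ab).
lra.
Qed.

Let increment (E F : R -> C) S W a b :
  0 <= S -> 0 <= W -> 0 <= a <= b -> b <= 1 -> prim (fun t => E t * (q t * y t)) F ->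
  (forall t, a <= t <= b -> nm (E t) * nm (y t) <= S * W / nm kap) ->
  nm (F b - F a) <= W * (2 * S * mass q / nm kap).
Proof.
move=> S0 W0 hab b1 pF hE.
apply: le_trans (prim_diff (g := fun t => (S * W / nm kap) * h t) pF hab b1 _ _) _.
- exact: rintZ.
- move=> t ht; rewrite !nmM mulrCA mulrC; apply: ler_pM; rewrite ?mulr_ge0 ?nm_ge0 //.
  exact: hE.
have /andP[a0 ab] := hab.
rewrite !JZ ?a0 ?b1 ?(le_trans a0 ab) ?(le_trans ab b1) // -mulrBr.
have -> : W * (2 * S * mass q / nm kap) = 2 * ((S * W / nm kap) * mass q).
  by field; rewrite lt0r_neq0.
rewrite ler_pM2l // ler_wpM2l ?mass_between //.
by rewrite divr_ge0 ?mulr_ge0 // ltW.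
Qed.

(** Here [kQ] makes the perturbation at most half of [S], the contraction that [self_bound] asks
    for. *)
Let small S : 0 <= S -> 2 * S * mass q / nm kap <= S / 2.
Proof.
move=> S0; rewrite ler_pdivrMr //.
have := ler_wpM2l S0 kQ; lra.
Qed.

(** Both components are first bounded with the weight [exp (s t)]; inserting this into the
    integrated equations measures the distance to free motion. For [v] the error carries
    [exp (2 s)], as its integrating factor and [y] both grow. The 4 is a 2 from [cint] times a 2
    from [self_bound]. *)
Lemma forward_bound (c0 : R) : nm (u 0) <= c0 -> nm (v 0) <= c0 ->
  [/\ forall t, 0 <= t <= 1 -> nm (u t) <= 2 * c0 * expR (s * t) /\ nm (v t) <= 2 * c0 * expR (s * t),
      nm (cexp (- kap) 1 * u 1 - u 0) <= 4 * c0 * mass q / nm kap &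
      nm (cexp kap 1 * v 1 - v 0) <= expR (2 * s) * (4 * c0 * mass q / nm kap)].
Proof.
move=> hu0 hv0.
have c00 : 0 <= c0 by apply: le_trans hu0; exact: nm_ge0.
have incU S : 0 <= S -> (forall t, 0 <= t <= 1 -> nm (y t) <= S * expR (s * t) / nm kap) ->
    forall x, 0 <= x <= 1 -> nm (cexp (- kap) x * u x - u 0) <= 2 * S * mass q / nm kap.
  move=> S0 hy x /andP[x0 x1].
  have e0 : cexp (- kap) 0 * u 0 = u 0 by rewrite cexp0 mul1r.
  rewrite -e0 -[leRHS]mul1r; apply: (increment (E := cexp (- kap)) (F := fun t => cexp (- kap) t * u t)) => //; rewrite ?lexx ?x0 //.
    exact: prim_uu.
  move=> t /andP[t0 tx]; rewrite mulr1 nmEN.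
  have ht : 0 <= t <= 1 by rewrite t0 (le_trans tx).
  apply: le_trans (ler_wpM2l _ (hy t ht)) _; first exact: expR_ge0.
  by rewrite [S * _]mulrC !mulrA [expR _ * expR _]mulrC expR_cancel mul1r.
have incV S : 0 <= S -> (forall t, 0 <= t <= 1 -> nm (y t) <= S * expR (s * t) / nm kap) ->
    forall x, 0 <= x <= 1 -> nm (cexp kap x * v x - v 0) <= expR (2 * (s * x)) * (2 * S * mass q / nm kap).
  move=> S0 hy x /andP[x0 x1].
  have e0 : cexp kap 0 * v 0 = v 0 by rewrite cexp0 mul1r.
  rewrite -e0; apply: (increment (E := cexp kap) (F := fun t => cexp kap t * v t)) => //; rewrite ?lexx ?x0 ?expR_ge0 //.
    exact: prim_vv.
  move=> t /andP[t0 tx]; rewrite nmE.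
  have ht : 0 <= t <= 1 by rewrite t0 (le_trans tx).
  apply: le_trans (ler_wpM2l _ (hy t ht)) _; first exact: expR_ge0.
  rewrite [S * expR _]mulrC !mulrA -expRD [expR _ * S]mulrC ler_pM2r ?invr_gt0 // ler_wpM2l //.
  rewrite ler_expR; have : s * t <= s * x by rewrite ler_pM2l. lra.
(* The two components are coupled through [y], so their maximum is bootstrapped at once. *)
have main : forall t, 0 <= t <= 1 -> Num.max (nm (u t)) (nm (v t)) * expR (- (s * t)) <= 2 * c0.
  apply: self_bound => //.
    have [B hB] := uv_bounded; exists `|B| => t ht.
    have [b1 b2] := hB t ht.
    have m1 : Num.max (nm (u t)) (nm (v t)) <= `|B|.
      by rewrite ge_max; apply/andP; split; apply: le_trans (ler_norm B).
    have e1 : expR (- (s * t)) <= 1.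
      by rewrite -[leRHS]expR0 ler_expR oppr_le0 mulr_ge0 //; [exact: ltW|by case/andP: ht].
    rewrite -[leRHS]mulr1; apply: ler_pM; rewrite ?le_max ?nm_ge0 ?expR_ge0 //.
  move=> S S0 hS.
  have hS' t : 0 <= t <= 1 -> nm (u t) <= S * expR (s * t) /\ nm (v t) <= S * expR (s * t).
    move=> /hS; rewrite -ler_pdivlMr ?expR_gt0 // -expRN opprK ge_max => /andP[]; split=> //.
  have hy t : 0 <= t <= 1 -> nm (y t) <= S * expR (s * t) / nm kap.
    by move=> /hS' [h1 h2]; exact: y_bound.
  move=> t ht; rewrite -ler_pdivlMr ?expR_gt0 // -expRN opprK.
  have iu := incU S S0 hy t ht; have iv := incV S S0 hy t ht.
  have sm := small S0.
  rewrite ge_max; apply/andP; split.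
    have -> : u t = cexp kap t * (cexp (- kap) t * u t) by rewrite mulrA cexpK mul1r.
    rewrite nmM nmE mulrC ler_wpM2r //.
    apply: le_trans (nm_tri _ (u 0)) _; apply: lerD => //; exact: le_trans sm.
  have -> : v t = cexp (- kap) t * (cexp kap t * v t) by rewrite mulrA [cexp (- _) _ * _]mulrC cexpK mul1r.
  rewrite nmM nmEN.
  have h1 : nm (cexp kap t * v t) <= expR (2 * (s * t)) * (c0 + S / 2).
    apply: le_trans (nm_tri _ (v 0)) _; rewrite [leRHS]mulrDr; apply: lerD.
      apply: le_trans hv0 _; rewrite -[leLHS]mul1r ler_wpM2r // -expR0 ler_expR.
      by rewrite !mulr_ge0 //; [exact: ltW|by case/andP: ht].
    by apply: le_trans iv _; rewrite ler_wpM2l ?expR_ge0.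
  apply: le_trans (ler_wpM2l (expR_ge0 _) h1) _.
  rewrite [leLHS]mulrA -expRD [leRHS]mulrC ler_wpM2r ?addr_ge0 ?divr_ge0 //.
  by rewrite ler_expR; lra.
have main' t : 0 <= t <= 1 -> nm (u t) <= 2 * c0 * expR (s * t) /\ nm (v t) <= 2 * c0 * expR (s * t).
  by move=> /main; rewrite -ler_pdivlMr ?expR_gt0 // -expRN opprK ge_max => /andP[].
have hy t : 0 <= t <= 1 -> nm (y t) <= 2 * c0 * expR (s * t) / nm kap.
  by move=> /main' [h1 h2]; exact: y_bound.
have c20 : 0 <= 2 * c0 by rewrite mulr_ge0.
have e4 : 2 * (2 * c0) = 4 * c0 by ring.
split=> //.
  have := incU _ c20 hy 1; rewrite ler01 lexx e4; exact.
have := incV _ c20 hy 1; rewrite ler01 lexx e4 mulr1; exact.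
Qed.

(** Mirror image of [forward_bound], with data at 1 and weight [exp (s (1 - t))]. *)
Lemma backward_bound (c0 : R) : nm (u 1) <= c0 -> nm (v 1) <= c0 ->
  [/\ forall t, 0 <= t <= 1 -> nm (u t) <= 2 * c0 * expR (s * (1 - t)) /\ nm (v t) <= 2 * c0 * expR (s * (1 - t)),
      nm (u 0 - cexp (- kap) 1 * u 1) <= expR s * (4 * c0 * mass q / nm kap) &
      nm (v 0 - cexp kap 1 * v 1) <= expR s * (4 * c0 * mass q / nm kap)].
Proof.
move=> hu1 hv1.
have c00 : 0 <= c0 by apply: le_trans hu1; exact: nm_ge0.
(* The integrating factor times the weight is [exp (s (1 - 2 t))], largest at the lower end [x]. *)
have incU S : 0 <= S -> (forall t, 0 <= t <= 1 -> nm (y t) <= S * expR (s * (1 - t)) / nm kap) ->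
    forall x, 0 <= x <= 1 ->
    nm (cexp (- kap) x * u x - cexp (- kap) 1 * u 1) <= expR (s * (1 - 2 * x)) * (2 * S * mass q / nm kap).
  move=> S0 hy x hx; have /andP[x0 x1] := hx.
  rewrite nm_distC; apply: (increment (E := cexp (- kap)) (F := fun t => cexp (- kap) t * u t)) => //; rewrite ?lexx ?expR_ge0 //.
    exact: prim_uu.
  move=> t /andP[xt t1]; rewrite nmEN.
  have ht : 0 <= t <= 1 by rewrite t1 (le_trans x0).
  apply: le_trans (ler_wpM2l _ (hy t ht)) _; first exact: expR_ge0.
  rewrite [S * expR _]mulrC !mulrA -expRD [expR _ * S]mulrC ler_pM2r ?invr_gt0 // ler_wpM2l //.
  rewrite ler_expR; have : s * x <= s * t by rewrite ler_pM2l. lra.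
have incV S : 0 <= S -> (forall t, 0 <= t <= 1 -> nm (y t) <= S * expR (s * (1 - t)) / nm kap) ->
    forall x, 0 <= x <= 1 -> nm (cexp kap x * v x - cexp kap 1 * v 1) <= expR s * (2 * S * mass q / nm kap).
  move=> S0 hy x hx; have /andP[x0 x1] := hx.
  rewrite nm_distC; apply: (increment (E := cexp kap) (F := fun t => cexp kap t * v t)) => //; rewrite ?lexx ?expR_ge0 //.
    exact: prim_vv.
  move=> t /andP[xt t1]; rewrite nmE.
  have ht : 0 <= t <= 1 by rewrite t1 (le_trans x0).
  apply: le_trans (ler_wpM2l _ (hy t ht)) _; first exact: expR_ge0.
  rewrite [S * expR _]mulrC !mulrA -expRD [expR _ * S]mulrC.
  by rewrite (_ : s * t + s * (1 - t) = s) //; ring.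
have main : forall t, 0 <= t <= 1 -> Num.max (nm (u t)) (nm (v t)) * expR (- (s * (1 - t))) <= 2 * c0.
  apply: self_bound => //.
    have [B hB] := uv_bounded; exists `|B| => t ht.
    have [b1 b2] := hB t ht.
    have m1 : Num.max (nm (u t)) (nm (v t)) <= `|B|.
      by rewrite ge_max; apply/andP; split; apply: le_trans (ler_norm B).
    have e1 : expR (- (s * (1 - t))) <= 1.
      by rewrite -[leRHS]expR0 ler_expR oppr_le0 mulr_ge0 //; [exact: ltW|by rewrite subr_ge0; case/andP: ht].
    rewrite -[leRHS]mulr1; apply: ler_pM; rewrite ?le_max ?nm_ge0 ?expR_ge0 //.
  move=> S S0 hS.
  have hS' t : 0 <= t <= 1 -> nm (u t) <= S * expR (s * (1 - t)) /\ nm (v t) <= S * expR (s * (1 - t)).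
    move=> /hS; rewrite -ler_pdivlMr ?expR_gt0 // -expRN opprK ge_max => /andP[]; split=> //.
  have hy t : 0 <= t <= 1 -> nm (y t) <= S * expR (s * (1 - t)) / nm kap.
    by move=> /hS' [h1 h2]; exact: y_bound.
  move=> t ht; rewrite -ler_pdivlMr ?expR_gt0 // -expRN opprK.
  have iu := incU S S0 hy t ht; have iv := incV S S0 hy t ht.
  have sm := small S0; have /andP[t0 t1] := ht.
  rewrite ge_max; apply/andP; split.
    have -> : u t = cexp kap t * (cexp (- kap) t * u t) by rewrite mulrA cexpK mul1r.
    rewrite nmM nmE.
    have h1 : nm (cexp (- kap) t * u t) <= expR (s * (1 - 2 * t)) * (c0 + S / 2).
      apply: le_trans (nm_tri _ (cexp (- kap) 1 * u 1)) _; rewrite [leRHS]mulrDr; apply: lerD.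
        rewrite nmM nmEN mulr1; apply: ler_pM; rewrite ?expR_ge0 ?nm_ge0 // ler_expR.
        have : s * t <= s * 1 by rewrite ler_pM2l.
        lra.
      by apply: le_trans iu _; rewrite ler_wpM2l ?expR_ge0.
    apply: le_trans (ler_wpM2l (expR_ge0 _) h1) _.
    rewrite [leLHS]mulrA -expRD [leRHS]mulrC ler_wpM2r ?addr_ge0 ?divr_ge0 //.
    by rewrite ler_expR; lra.
  have -> : v t = cexp (- kap) t * (cexp kap t * v t) by rewrite mulrA [cexp (- _) _ * _]mulrC cexpK mul1r.
  rewrite nmM nmEN.
  have h1 : nm (cexp kap t * v t) <= expR s * (c0 + S / 2).
    apply: le_trans (nm_tri _ (cexp kap 1 * v 1)) _; rewrite [leRHS]mulrDr; apply: lerD.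
      by rewrite nmM nmE mulr1 ler_wpM2l ?expR_ge0.
    by apply: le_trans iv _; rewrite ler_wpM2l ?expR_ge0.
  apply: le_trans (ler_wpM2l (expR_ge0 _) h1) _.
  rewrite [leLHS]mulrA -expRD [leRHS]mulrC ler_wpM2r ?addr_ge0 ?divr_ge0 //.
  by rewrite ler_expR; lra.
have main' t : 0 <= t <= 1 -> nm (u t) <= 2 * c0 * expR (s * (1 - t)) /\ nm (v t) <= 2 * c0 * expR (s * (1 - t)).
  by move=> /main; rewrite -ler_pdivlMr ?expR_gt0 // -expRN opprK ge_max => /andP[].
have hy t : 0 <= t <= 1 -> nm (y t) <= 2 * c0 * expR (s * (1 - t)) / nm kap.
  by move=> /main' [h1 h2]; exact: y_bound.
have c20 : 0 <= 2 * c0 by rewrite mulr_ge0.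
have e4 : 2 * (2 * c0) = 4 * c0 by ring.
split=> //.
  have := incU _ c20 hy 0; rewrite ler01 lexx e4 mulr0 subr0 mulr1 cexp0 mul1r; exact.
have := incV _ c20 hy 0; rewrite ler01 lexx e4 cexp0 mul1r; exact.
Qed.

Lemma uv0_zero t : u t = 0 -> v t = 0 -> y t = 0 /\ z t = 0.
Proof.
move=> hu hv.
have hy : 2 * kap * y t = 0 by rewrite -[RHS](subrr (0 : C)) -{1}hu -{1}hv /u /v /uu /vv; ring.
have y0 : y t = 0.
  by move/eqP: hy; rewrite !mulf_eq0 (negbTE kn0) orbF pnatr_eq0 /= => /eqP.
by split=> //; have := hu; rewrite /u /uu y0 mulr0 addr0.
Qed.

(** Uniqueness for the Cauchy problem, read off [forward_bound] with [c0 = 0]; the largeness of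
    [kap] is inherited from there. *)
Lemma zero_at0 : y 0 = 0 -> z 0 = 0 -> forall t, 0 <= t <= 1 -> y t = 0 /\ z t = 0.
Proof.
move=> y0 z0 t ht.
have [||hb _ _] := @forward_bound 0; rewrite ?/u ?/v /uu /vv ?y0 ?z0 ?mulr0 ?addr0 ?subr0 ?nm0 //.
have [h1 h2] := hb t ht; rewrite mulr0 mul0r in h1 h2.
by apply: uv0_zero; exact: nm_le0.
Qed.

Lemma zero_at1 : y 1 = 0 -> z 1 = 0 -> forall t, 0 <= t <= 1 -> y t = 0 /\ z t = 0.
Proof.
move=> y0 z0 t ht.
have [||hb _ _] := @backward_bound 0; rewrite ?/u ?/v /uu /vv ?y0 ?z0 ?mulr0 ?addr0 ?subr0 ?nm0 //.
have [h1 h2] := hb t ht; rewrite mulr0 mul0r in h1 h2.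
by apply: uv0_zero; exact: nm_le0.
Qed.

End Bounds.

(** * Contraction of cones across an edge *)

Section Cones.
Variables (q : R -> C) (kap : C) (y z : R -> C) (K e : R).
Hypothesis qi : cintegrable q.
Hypothesis yz : edge_sol q (- kap ^+ 2) y z.
Hypotheses (K1 : 1 <= K) (e0 : 0 < e) (e1 : e <= 1).
Hypothesis large : 2 * K * (1 + 4 * mass q) <= e * re kap.

Let s := re kap.
Let u := uu kap y z.
Let v := vv kap y z.

Let s0 : 0 < s.
Proof.
have := mass_ge0 q; have h := large; rewrite -/s in h => Q0.
have : 0 < e * s by apply: lt_le_trans h; rewrite !mulr_gt0 //; [exact: lt_le_trans K1|lra].
by rewrite pmulr_rgt0.
Qed.

Let sk : s <= nm kap.
Proof. by apply: le_trans (nm_Re kap); rewrite ler_norm. Qed.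

Let kQ8 : 8 * K * mass q <= nm kap.
Proof.
have := mass_ge0 q; have h := large; rewrite -/s in h => Q0.
have es : e * s <= s by rewrite ler_piMl // ltW.
apply: le_trans sk; have := K1; lra.
Qed.

Let kQ : 4 * mass q <= nm kap.
Proof.
apply: le_trans kQ8; have := ler_wpM2r (mass_ge0 q) K1.
rewrite mul1r; have := mass_ge0 q; lra.
Qed.

Let k0 : 0 < nm kap. Proof. exact: lt_le_trans sk. Qed.

(** [exp (- 2 s)] is the free contraction of the ratio of the components, [4 mass / |kap|] the
    perturbation, and [exp (- 2 s) <= 1 / s]; this is where the form of [large] comes from. *)
Let rate : 2 * K * (expR (- (2 * s)) + 4 * mass q / nm kap) <= e.
Proof.
have Q0 := mass_ge0 q.
have h1 : expR (- (2 * s)) <= s^-1.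
  rewrite expRN lef_pV2 ?posrE ?expR_gt0 //.
  have := expR_ge1Dx (2 * s); have := s0; lra.
have h2 : 4 * mass q / nm kap <= 4 * mass q / s.
  by rewrite ler_wpM2l ?mulr_ge0 // lef_pV2 ?posrE.
have h3 : 2 * K * (s^-1 + 4 * mass q / s) <= e.
  have -> : 2 * K * (s^-1 + 4 * mass q / s) = 2 * K * (1 + 4 * mass q) / s by field; rewrite lt0r_neq0.
  by rewrite ler_pdivrMr.
apply: le_trans h3; apply: ler_wpM2l; last exact: lerD.
by rewrite mulr_ge0 // (le_trans ler01).
Qed.

Let halfQ : 4 * K * mass q / nm kap <= 1 / 2.
Proof. rewrite ler_pdivrMr //; have := kQ8; lra. Qed.

(** By [halfQ] at least half of the freely grown [u] arrives at 1, while [v] there is only its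
    decayed part plus an error of relative size [1 / |kap|]. The quotient is bounded by [rate]. *)
Lemma forward_cone : nm (v 0) <= K * nm (u 0) -> nm (v 1) <= e * nm (u 1).
Proof.
move=> hv0; set a := nm (u 0).
have a0 : 0 <= a by exact: nm_ge0.
have [| |_ hu hv] := @forward_bound q kap y z qi yz s0 kQ (K * a); rewrite -?/u -?/v.
- exact: ler_peMl.
- exact: hv0.
have hu1 : a / 2 <= expR (- s) * nm (u 1).
  have e1' : nm (cexp (- kap) 1 * u 1) = expR (- s) * nm (u 1) by rewrite nmM nm_cexp cReN mulr1.
  rewrite -e1'.
  have := nm_tri (u 0) (cexp (- kap) 1 * u 1); rewrite -/a nm_distC.
  have : 4 * (K * a) * mass q / nm kap <= a / 2.
    have -> : 4 * (K * a) * mass q / nm kap = a * (4 * K * mass q / nm kap) by field; rewrite lt0r_neq0.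
    have := ler_wpM2l a0 halfQ; lra.
  move: hu; rewrite -/u; lra.
have hv1 : expR s * nm (v 1) <= K * a + expR (2 * s) * (4 * (K * a) * mass q / nm kap).
  have e1' : nm (cexp kap 1 * v 1) = expR s * nm (v 1) by rewrite nmM nm_cexp mulr1.
  rewrite -e1'; apply: le_trans (nm_tri _ (v 0)) _; exact: lerD.
have E : expR s * expR (- s) = 1 by rewrite -expRD subrr expR0.
have E2 : expR (2 * s) = expR s * expR s by rewrite -expRD; congr expR; ring.
have E3 : expR (- (2 * s)) = expR (- s) * expR (- s) by rewrite -expRD; congr expR; ring.
have p1 := expR_gt0 s; have p2 := expR_gt0 (- s).
have h1 : nm (v 1) <= expR s * (K * a * (expR (- (2 * s)) + 4 * mass q / nm kap)).
  rewrite -(ler_pM2l p1); apply: le_trans hv1 _.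
  rewrite le_eqVlt; apply/orP; left; apply/eqP.
  have -> : expR s * (expR s * (K * a * (expR (- (2 * s)) + 4 * mass q / nm kap)))
    = K * a * ((expR s * expR (- s)) ^+ 2 + expR s * expR s * (4 * mass q / nm kap)) by rewrite E3; ring.
  by rewrite E expr1n E2; field; rewrite lt0r_neq0.
have h2 : a <= 2 * (expR (- s) * nm (u 1)) by lra.
apply: le_trans h1 _.
have r := rate; set X := _ + _ in r *.
have X0 : 0 <= X by rewrite addr_ge0 ?expR_ge0 // divr_ge0 ?mulr_ge0 ?mass_ge0 // ltW.
have -> : e * nm (u 1) = expR s * (expR (- s) * (e * nm (u 1))) by rewrite [RHS]mulrA E mul1r.
rewrite ler_pM2l //.
have n0 := nm_ge0 (u 1).
have h3 : K * a * X <= K * (2 * (expR (- s) * nm (u 1))) * X.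
  by rewrite ler_wpM2r // ler_wpM2l // (le_trans ler01).
apply: le_trans h3 _.
have -> : K * (2 * (expR (- s) * nm (u 1))) * X = expR (- s) * ((2 * K * X) * nm (u 1)) by ring.
by rewrite ler_pM2l // ler_wpM2r.
Qed.

(** [forward_cone] with the roles of the ends and of [u] and [v] exchanged. The second claim holds
    since the backward bound [exp (s (1 - t)) |v 1|] can be renormalised by
    [exp s |v 1| <= 2 |v 0|]; it is the decay of the Weyl solution. *)
Lemma backward_cone : nm (u 1) <= K * nm (v 1) ->
  nm (u 0) <= e * nm (v 0) /\
  forall t, 0 <= t <= 1 -> nm (y t) <= 4 * K * nm (v 0) * expR (- (s * t)) / nm kap.
Proof.
move=> hu1; set b := nm (v 1).
have b0 : 0 <= b by exact: nm_ge0.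
have [| |hb hu hv] := @backward_bound q kap y z qi yz s0 kQ (K * b); rewrite -?/u -?/v.
- exact: hu1.
- exact: ler_peMl.
have p1 := expR_gt0 s; have p2 := expR_gt0 (- s).
have hv1 : expR s * b / 2 <= nm (v 0).
  have e1' : nm (cexp kap 1 * v 1) = expR s * b by rewrite nmM nm_cexp mulr1.
  have := nm_tri (cexp kap 1 * v 1) (v 0); rewrite e1' nm_distC.
  have : expR s * (4 * (K * b) * mass q / nm kap) <= expR s * b / 2.
    have -> : 4 * (K * b) * mass q / nm kap = b * (4 * K * mass q / nm kap) by field; rewrite lt0r_neq0.
    rewrite -[leRHS]mulrA ler_pM2l //; have := ler_wpM2l b0 halfQ; lra.
  move: hv; rewrite -/v; lra.
have hu0 : nm (u 0) <= expR (- s) * (K * b) + expR s * (4 * (K * b) * mass q / nm kap).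
  apply: le_trans (nm_tri _ (cexp (- kap) 1 * u 1)) _; apply: lerD => //.
  by rewrite nmM nm_cexp cReN mulr1 ler_pM2l.
have E : expR s * expR (- s) = 1 by rewrite -expRD subrr expR0.
have E3 : expR (- (2 * s)) = expR (- s) * expR (- s) by rewrite -expRD; congr expR; ring.
have r := rate; set X := _ + _ in r.
have h1 : nm (u 0) <= expR s * b * (K * X).
  apply: le_trans hu0 _; rewrite le_eqVlt; apply/orP; left; apply/eqP.
  have -> : expR s * b * (K * X) = b * K * ((expR s * expR (- s)) * expR (- s) + expR s * (4 * mass q / nm kap)).
    by rewrite /X E3; ring.
  by rewrite E mul1r; field; rewrite lt0r_neq0.
have X0 : 0 <= X by rewrite addr_ge0 ?expR_ge0 // divr_ge0 ?mulr_ge0 ?mass_ge0 // ltW.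
have K0 : 0 <= K by exact: le_trans K1.
split.
  apply: le_trans h1 _.
  have h2 : expR s * b <= 2 * nm (v 0) by lra.
  apply: le_trans (ler_wpM2r _ h2) _; first exact: mulr_ge0.
  have -> : 2 * nm (v 0) * (K * X) = (2 * K * X) * nm (v 0) by ring.
  by rewrite ler_wpM2r ?nm_ge0.
move=> t ht; rewrite ler_pdivlMr //.
have [h2 h3] := hb t ht.
have kn0 : kap != 0 by rewrite -nm_gt0.
have h4 := nm_y y z t kn0.
have h5 : nm (y t) * nm kap <= 2 * (K * b) * expR (s * (1 - t)) by move: h2 h3 h4; rewrite /u /v; lra.
apply: le_trans h5 _.
have -> : expR (s * (1 - t)) = expR s * expR (- (s * t)) by rewrite -expRD; congr expR; ring.
have -> : 2 * (K * b) * (expR s * expR (- (s * t))) = 4 * K * (expR s * b / 2) * expR (- (s * t)) by field.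
by rewrite ler_wpM2r ?expR_ge0 // ler_wpM2l ?mulr_ge0.
Qed.

End Cones.
End Edge.

(** * Picard iteration *)

Section Picard.
Variable R : realType.
Local Notation C := R[i].
Local Notation re := (@complex.Re R).
Local Notation im := (@complex.Im R).
Implicit Types (q y z : R -> C) (x t A B : R) (lam c al be : C).

(** The telescoping right-hand side is what makes the induction on [k] close. *)
Lemma sum_geometric_le (a : nat -> C) A N k : 0 <= A -> (forall n, nm (a n) <= A / 2 ^+ n) ->
  nm (\sum_(i < N + k) a i - \sum_(i < N) a i) <= 2 * A / 2 ^+ N - 2 * A / 2 ^+ (N + k).
Proof.
move=> A0 ha; elim: k => [|k IH]; first by rewrite addn0 !subrr nm0.
rewrite addnS big_ord_recr /= addrAC; apply: le_trans (nmD _ _) _.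
apply: le_trans (lerD IH (ha _)) _.
rewrite le_eqVlt; apply/orP; left; apply/eqP; rewrite exprS.
by field; rewrite !expf_neq0.
Qed.

Lemma real_series_limit (a : nat -> R) A : (forall n, `|a n| <= A / 2 ^+ n) ->
  exists l : R, (fun N => \sum_(i < N) a i) @ \oo --> l.
Proof.
move=> ha.
have cg : cvgn (series (geometric A (2^-1 : R))).
  by apply: is_cvg_geometric_series; rewrite ger0_norm ?invr_ge0 // invf_lt1 // ltr1n.
have cn : cvgn [normed series a].
  have gE n : `|a n| <= geometric A (2^-1 : R) n by rewrite /= exprVn; exact: ha.
  apply: series_le_cvg cg => n; [exact: normr_ge0|exact: le_trans (gE n)|exact: gE].
have ca := normed_cvg cn.
exists (limn (series a)).
have -> : (fun N => \sum_(i < N) a i) = series a; last exact: ca.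
by apply/funext => N; rewrite /series /= big_mkord.
Qed.

(** The limit is chosen before [A], so that one limit serves every admissible constant. The 4 is the
    geometric tail 2 times a 2 for real and imaginary parts. *)
Lemma complex_series_limit (a : nat -> C) : (exists A, forall n, nm (a n) <= A / 2 ^+ n) ->
  exists l, forall A, (forall n, nm (a n) <= A / 2 ^+ n) ->
    forall N, nm (l - \sum_(i < N) a i) <= 4 * A / 2 ^+ N.
Proof.
move=> [A0 hA0].
have [l1 h1] : exists l : R, (fun N => \sum_(i < N) re (a i)) @ \oo --> l.
  by apply: (@real_series_limit (fun i => re (a i)) A0) => n; apply: le_trans (hA0 n); exact: nm_Re.
have [l2 h2] : exists l : R, (fun N => \sum_(i < N) im (a i)) @ \oo --> l.
  by apply: (@real_series_limit (fun i => im (a i)) A0) => n; apply: le_trans (hA0 n); exact: nm_Im.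
exists (l1 +i* l2)%C => A hA N.
have A00 : 0 <= A by have := le_trans (nm_ge0 _) (hA 0%N); rewrite expr0 divr1.
have reS M : re (\sum_(i < M) a i) = \sum_(i < M) re (a i).
  by elim: M => [|M IH]; rewrite ?big_ord0 // !big_ord_recr /= cReD IH.
have imS M : im (\sum_(i < M) a i) = \sum_(i < M) im (a i).
  by elim: M => [|M IH]; rewrite ?big_ord0 // !big_ord_recr /= cImD IH.
set d := 2 * A / 2 ^+ N.
have tail M : (N <= M)%N -> nm (\sum_(i < M) a i - \sum_(i < N) a i) <= d.
  move=> /subnKC <-; apply: le_trans (sum_geometric_le _ _ A00 hA) _.
  by rewrite gerBl divr_ge0 ?mulr_ge0 // exprn_ge0.
have lim_le (b : nat -> R) l s : b @ \oo --> l -> (forall M, (N <= M)%N -> `|b M - s| <= d) -> `|l - s| <= d.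
  move=> bl hb; have bs : (fun M => `|b M - s|) @ \oo --> `|l - s|.
    by apply: cvg_norm; apply: cvgB => //; exact: cvg_cst.
  apply: (cvgr_to_le bs).
  by exists N => // M /= NM; exact: hb.
apply: le_trans (nm_ReIm _) _; rewrite cReD cImD cReN cImN /=.
have -> : 4 * A / 2 ^+ N = d + d by rewrite /d; field; rewrite expf_neq0.
apply: lerD; apply: lim_le; [exact: h1| |exact: h2|] => M /tail h.
  by rewrite -reS -cReN -cReD; apply: le_trans h; exact: nm_Re.
by rewrite -imS -cImN -cImD; apply: le_trans h; exact: nm_Im.
Qed.

(** The [n]-th term, not the [n]-th partial sum, of the Picard series for [(y, y')]. *)
Fixpoint pic q lam al be n : (R -> C) * (R -> C) :=
  if n is n'.+1 then
    (cint (pic q lam al be n').2, cint (fun t => (q t - lam) * (pic q lam al be n').1 t))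
  else ((fun=> al), (fun=> be)).

(** The chain rule for powers of a primitive, by induction from [J_prod]; it produces the factorials
    in the Picard bounds. *)
Lemma J_pow (m' : R -> R) n : rint m' -> (forall t, 0 <= t <= 1 -> 0 <= m' t) ->
  rint (fun t => n.+1%:R * (m' t * J m' t ^+ n)) /\
  forall x, 0 <= x <= 1 -> J (fun t => n.+1%:R * (m' t * J m' t ^+ n)) x = J m' x ^+ n.+1.
Proof.
move=> mi m0.
have mm : measurable_fun (`[0%R, 1%R] : set R) (J m') by exact: J_measurable.
have mb n' (t : R) : 0 <= t <= 1 -> `|J m' t ^+ n'| <= J m' 1 ^+ n'.
  move=> ht; have J0' : 0 <= J m' t by exact: J_ge0.
  rewrite ger0_norm ?exprn_ge0 //; apply: lerXn2r; rewrite ?nnegrE ?J_ge0 ?ler01 ?lexx //.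
  by case/andP: ht => t0 t1; apply: J_mono => //; rewrite ?t0 ?t1.
have ri n' : rint (fun t => m' t * J m' t ^+ n').
  by apply: rintM (mb n') => //; exact: measurable_funX.
split; first exact: rintZ.
elim: n => [|n IH] x hx.
  by rewrite expr1; apply: eq_J => // t _; rewrite expr0 mul1r mulr1.
rewrite exprS -IH // J_prod //; last exact: rintZ.
apply: eq_J => // t ht; rewrite IH // -[n.+2]addn1 natrD; rewrite !exprS; ring.
Qed.

Lemma pic_prim q lam al be n : cintegrable q ->
  (exists f, prim f (pic q lam al be n).1) /\ (exists f, prim f (pic q lam al be n).2).
Proof.
move=> qi; elim: n => [|n [[f pf] [g pg]]].
  by split; exists (fun=> 0); exact: prim_cst.
split.
  by exists (pic q lam al be n).2; apply: prim_cint; exact: cintegrable_prim pg.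
eexists; apply: prim_cint; apply: cintegrableMprim pf.
by apply: cintegrableB => //; exact: cintegrable_cst.
Qed.

Section Size.
Variables (q : R -> C) (lam al be : C) (r : R).
Hypotheses (qi : cintegrable q) (r1 : 1 <= r) (lr : nm lam <= r ^+ 2).

Let h t := `|re (q t)| + `|im (q t)|.
Let m' t := 2 * (r + h t).
Let hi : rint h. Proof. exact: rint_ReIm. Qed.
Let mi : rint m'. Proof. by apply: rintZ; apply: rintD => //; exact: rint_cst. Qed.
Let h0 t : 0 <= h t. Proof. exact: addr_ge0. Qed.
Let r0 : 0 <= r. Proof. exact: le_trans r1. Qed.
Let m0 t : 0 <= t <= 1 -> 0 <= m' t.
Proof. by move=> _; rewrite mulr_ge0 // addr_ge0. Qed.
Let B := r * (nm al + nm be).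
Let B0 : 0 <= B. Proof. by rewrite mulr_ge0 // addr_ge0 ?nm_ge0. Qed.

(** Weighting [y] by [r ~ |lam| ^ (1 / 2)] balances the two equations:
    [|q - lam| <= h + r ^ 2 <= (r + h) r] because [r >= 1], so each step costs [r + h] instead of
    [|lam|]. This is the origin of order 1/2. The 2 in [m'] absorbs the one from [cint_le]. *)
Lemma pic_le n x : 0 <= x <= 1 ->
  r * nm ((pic q lam al be n).1 x) <= B * (J m' x ^+ n / n`!%:R) /\
  nm ((pic q lam al be n).2 x) <= B * (J m' x ^+ n / n`!%:R).
Proof.
elim: n x => [|n IH] x hx.
  rewrite /= fact0 expr0 divr1 mulr1 /B; split.
    by rewrite ler_pM2l ?(lt_le_trans ltr01) // lerDl nm_ge0.
  apply: (@le_trans _ _ (1 * (nm al + nm be))); first by rewrite mul1r lerDr nm_ge0.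
  by rewrite ler_wpM2r // addr_ge0 ?nm_ge0.
have [[f pf] [g pg]] := pic_prim lam al be n qi.
have [ri hJ] := J_pow n mi m0.
have f0 : 0 < n`!%:R :> R by rewrite ltr0n fact_gt0.
(* The inductive bound times [r + h], rearranged into the density of [J_pow]; the [/ 2] undoes the 2
   in [m']. *)
pose G t := B / n.+1`!%:R / 2 * (n.+1%:R * (m' t * J m' t ^+ n)).
have Gi : rint G by exact: rintZ.
have GE t : G t = (r + h t) * (B * (J m' t ^+ n / n`!%:R)).
  have a0 : n.+1%:R != 0 :> R by rewrite pnatr_eq0.
  have b0 : n`!%:R != 0 :> R by rewrite lt0r_neq0.
  rewrite /G /m' factS natrM; field.
  by rewrite b0 nat1r a0.
have JG : 2 * J G x = B * (J m' x ^+ n.+1 / n.+1`!%:R).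
  have b0 : n.+1`!%:R != 0 :> R by rewrite pnatr_eq0 -lt0n fact_gt0.
  by rewrite JZ // hJ //; field.
have Jt t : 0 <= t <= 1 -> 0 <= B * (J m' t ^+ n / n`!%:R).
  by move=> ht; rewrite mulr_ge0 // divr_ge0 ?exprn_ge0 ?J_ge0 // ltW.
rewrite -JG /=; split.
  have -> : r * nm (cint (pic q lam al be n).2 x) = nm (cint (fun t => r%:C%C * (pic q lam al be n).2 t) x).
    rewrite cintZ //; last exact: cintegrable_prim pg.
    by rewrite nmM nm_real ger0_norm.
  apply: cint_le => //; first by apply: cintegrableZ; exact: cintegrable_prim pg.
  move=> t ht; rewrite nmM nm_real ger0_norm // GE.
  have [_ h2] := IH t ht; apply: ler_pM; rewrite ?nm_ge0 //.
  by rewrite lerDl.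
apply: cint_le => //.
  by apply: cintegrableMprim pf; apply: cintegrableB => //; exact: cintegrable_cst.
move=> t ht; rewrite nmM GE.
have [h1 _] := IH t ht.
have h3 : nm (q t - lam) <= (r + h t) * r.
  apply: le_trans (nmB _ _) _; have := nm_ReIm (q t); rewrite -/(h t) => h4.
  have := h0 t; have := lr; have := r1; nra.
apply: le_trans (ler_wpM2r (nm_ge0 _) h3) _; rewrite -mulrA ler_wpM2l //.
by rewrite addr_ge0.
Qed.

(** With [J m' <= M = 2 (r + mass q)], the exponent is [2 M]: the second [M] pays for the geometric
    factor [1 / 2 ^+ n] in [pic_size_le]. *)
Definition pic_size : R := (nm al + nm be) * expR (4 * (r + mass q)).

Lemma pic_size_le n x : 0 <= x <= 1 ->
  nm ((pic q lam al be n).1 x) <= pic_size / 2 ^+ n /\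
  nm ((pic q lam al be n).2 x) <= r * pic_size / 2 ^+ n.
Proof.
move=> hx; have [h1 h2] := pic_le n hx.
have rp : 0 < r by exact: lt_le_trans r1.
set M := 2 * (r + mass q).
have M0 : 0 <= M by rewrite mulr_ge0 // addr_ge0 ?mass_ge0.
have JM : J m' x <= M.
  have x01 : 0 <= (1 : R) <= 1 by rewrite ler01 /=.
  have /andP[x0 x1] := hx.
  apply: le_trans (@J_mono _ m' x 1 _ _ _ _) _; rewrite ?x0 ?x1 //.
  rewrite /m' JZ //; last by apply: rintD => //; exact: rint_cst.
  rewrite JD //; last exact: rint_cst.
  by rewrite J_cst // mulr1.
(* [M ^ n / n! = (2 M) ^ n / n! / 2 ^ n], and a single term of the exponential series is at most its
   sum. *)
have pw : J m' x ^+ n / n`!%:R <= expR (2 * M) / 2 ^+ n.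
  have e1 : (2 * M) ^+ n / n`!%:R <= expR (2 * M).
    have M20 : 0 <= 2 * M by rewrite mulr_ge0.
    case: (n) => [|k]; first by rewrite expr0 fact0 divr1 -[leLHS]expR0 ler_expR.
    by apply: le_trans (expR_ge1Dxn k M20); rewrite lerDr.
  rewrite ler_pdivlMr ?exprn_gt0 //; apply: le_trans e1.
  have h5 : J m' x ^+ n <= M ^+ n by apply: lerXn2r; rewrite ?nnegrE //; exact: J_ge0.
  have FP0 : 0 <= (n`!%:R)^-1 * 2 ^+ n :> R by rewrite mulr_ge0 ?invr_ge0 ?ler0n ?exprn_ge0.
  rewrite exprMn; have := ler_wpM2r FP0 h5; lra.
have h3 : B * (J m' x ^+ n / n`!%:R) <= r * (pic_size / 2 ^+ n).
  apply: le_trans (ler_wpM2l B0 pw) _.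
  rewrite /B /pic_size (_ : 4 * (r + mass q) = 2 * M); last by rewrite /M; ring.
  by rewrite le_eqVlt; apply/orP; left; apply/eqP; ring.
split; first by rewrite -(ler_pM2l rp); exact: le_trans h3.
by rewrite -mulrA; exact: le_trans h3.
Qed.

End Size.

(** The error bound holds for every [r] with [|lam| <= r ^ 2], so the radius and the number of terms
    can be tuned independently later. *)
Lemma picard q lam al be : cintegrable q ->
  exists y z, [/\ edge_sol q lam y z, y 0 = al, z 0 = be &
    forall r, 1 <= r -> nm lam <= r ^+ 2 -> forall x, 0 <= x <= 1 -> forall N,
      nm (y x - \sum_(n < N) (pic q lam al be n).1 x) <= 4 * pic_size q al be r / 2 ^+ N].
Proof.
move=> qi.
(* A convenient admissible radius for this fixed [lam]; it drives the existence proof, while the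
   final bound is for arbitrary [r]. *)
pose r0 := 1 + nm lam.
have r01 : 1 <= r0 by rewrite lerDl nm_ge0.
have lr0 : nm lam <= r0 ^+ 2 by rewrite /r0; have := nm_ge0 lam; nra.
pose A := pic_size q al be r0.
have A0 : 0 <= A by rewrite mulr_ge0 ?expR_ge0 // addr_ge0 ?nm_ge0.
have /choice [y hy] : forall x, exists l, 0 <= x <= 1 ->
    forall A', (forall n, nm ((pic q lam al be n).1 x) <= A' / 2 ^+ n) ->
    forall N, nm (l - \sum_(n < N) (pic q lam al be n).1 x) <= 4 * A' / 2 ^+ N.
  move=> x.
  have [hx|nx] := pselect (0 <= x <= 1); last by exists 0.
  have [|l hl] := @complex_series_limit (fun n => (pic q lam al be n).1 x); last by exists l.
  by exists A => n; have [] := pic_size_le al be qi r01 lr0 n hx.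
have /choice [z hz] : forall x, exists l, 0 <= x <= 1 ->
    forall N, nm (l - \sum_(n < N) (pic q lam al be n).2 x) <= 4 * (r0 * A) / 2 ^+ N.
  move=> x.
  have [hx|nx] := pselect (0 <= x <= 1); last by exists 0.
  have b n : nm ((pic q lam al be n).2 x) <= r0 * A / 2 ^+ n by have [] := pic_size_le al be qi r01 lr0 n hx.
  have [|l hl] := @complex_series_limit (fun n => (pic q lam al be n).2 x); first by exists (r0 * A).
  by exists l => _; exact: hl.
have {}hyA x N : 0 <= x <= 1 -> nm (y x - \sum_(n < N) (pic q lam al be n).1 x) <= 4 * A / 2 ^+ N.
  by move=> hx; apply: hy => // n; have [] := pic_size_le al be qi r01 lr0 n hx.
pose Y N t := \sum_(n < N) (pic q lam al be n).1 t.
pose Z N t := \sum_(n < N) (pic q lam al be n).2 t.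
have pY N : exists f, prim f (Y N).
  elim: N => [|N [f pf]].
    by exists (fun=> 0); apply: prim_eq (prim_cst 0) => // t _; rewrite /Y big_ord0.
  have [[g pg] _] := pic_prim lam al be N qi.
  by eexists; apply: prim_eq (primD pf pg) => // t _; rewrite /Y big_ord_recr.
have pZ N : exists f, prim f (Z N).
  elim: N => [|N [f pf]].
    by exists (fun=> 0); apply: prim_eq (prim_cst 0) => // t _; rewrite /Z big_ord0.
  have [_ [g pg]] := pic_prim lam al be N qi.
  by eexists; apply: prim_eq (primD pf pg) => // t _; rewrite /Z big_ord_recr.
have lim0 (b : nat -> R) l D : (forall N, `|l - b N| <= D / 2 ^+ N) -> b @ \oo --> l.
  move=> hb; apply/cvgrPdist_le => /= e e0.
  have D0 : 0 <= D by have := le_trans (normr_ge0 _) (hb 0%N); rewrite expr0 divr1.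
  have [n hn] : exists n, D / 2 ^+ n <= e.
    apply: contrapT => /forallNP hn.
    suff : e <= 0 by rewrite leNgt e0.
    apply: (le_halving D0) => n; rewrite add0r ltW // ltNge; exact/negP.
  exists n => // k /= nk; apply: le_trans (hb k) _; apply: le_trans hn.
  rewrite ler_wpM2l // lef_pV2 ?posrE ?exprn_gt0 //.
  by rewrite ler_eXn2l // ltr1n.
(* The pointwise limits are so far only measurable and bounded, enough to integrate them; absolute
   continuity follows from the integral equations [yE] and [zE]. *)
have lim_cmeas (F : nat -> R -> C) G D : (forall N, exists f, prim f (F N)) ->
    (forall N x, 0 <= x <= 1 -> nm (G x - F N x) <= D / 2 ^+ N) -> cmeas G.
  move=> pF hG; split.
    apply: (@measurable_fun_cvg _ _ _ _ (fun N x => re (F N x))).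
      by move=> N; have [f pf] := pF N; have [] := prim_cmeas pf.
    move=> x /=; rewrite in_itv /= => hx; apply: (@lim0 _ _ D) => N.
    by rewrite -cReN -cReD; apply: le_trans (hG N x hx); exact: nm_Re.
  apply: (@measurable_fun_cvg _ _ _ _ (fun N x => im (F N x))).
    by move=> N; have [f pf] := pF N; have [] := prim_cmeas pf.
  move=> x /=; rewrite in_itv /= => hx; apply: (@lim0 _ _ D) => N.
  by rewrite -cImN -cImD; apply: le_trans (hG N x hx); exact: nm_Im.
have my : cmeas y by apply: (lim_cmeas Y y (4 * A) pY) => N x hx; exact: hyA.
have mz : cmeas z by apply: (lim_cmeas Z z (4 * (r0 * A)) pZ) => N x hx; exact: hz.
have yb x : 0 <= x <= 1 -> nm (y x) <= 4 * A.
  by move=> hx; have := hyA x 0%N hx; rewrite big_ord0 subr0 expr0 divr1.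
have zb x : 0 <= x <= 1 -> nm (z x) <= 4 * (r0 * A).
  by move=> hx; have := hz x hx 0%N; rewrite big_ord0 subr0 expr0 divr1.
have zi : cintegrable z.
  apply: (@cintegrable_eq _ (fun t => 1 * z t)); first by move=> t _; rewrite mul1r.
  by apply: cintegrableM zb => //; exact: cintegrable_cst.
have qli : cintegrable (fun t => q t - lam) by apply: cintegrableB => //; exact: cintegrable_cst.
have qyi : cintegrable (fun t => (q t - lam) * y t) by exact: cintegrableM yb.
have r00 : 0 <= r0 by exact: le_trans r01.
have rA0 : 0 <= r0 * A by exact: mulr_ge0.
have rA40 : 0 <= 4 * (r0 * A) by exact: mulr_ge0.
have A40 : 0 <= 4 * A by exact: mulr_ge0.
have pinv N : 0 <= (2 ^+ N)^-1 :> R by rewrite invr_ge0 exprn_ge0.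
have YS N x : 0 <= x <= 1 -> Y N.+1 x = al + cint (Z N) x.
  move=> hx; rewrite /Y big_ord_recl /=; congr (_ + _).
  elim: N => [|N IH].
    rewrite big_ord0; have [_ /(_ x hx)] := prim_cst (0 : C).
    rewrite add0r => e; rewrite [LHS]e; apply: eq_cint => // t _; by rewrite /Z big_ord0.
  rewrite big_ord_recr /= IH -cintD //.
  - by apply: eq_cint => // t _; rewrite /Z big_ord_recr.
  - by have [f pf] := pZ N; exact: cintegrable_prim pf.
  - by have [_ [f pf]] := pic_prim lam al be N qi; exact: cintegrable_prim pf.
have ZS N x : 0 <= x <= 1 -> Z N.+1 x = be + cint (fun t => (q t - lam) * Y N t) x.
  move=> hx; rewrite /Z big_ord_recl /=; congr (_ + _).
  elim: N => [|N IH].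
    rewrite big_ord0; have [_ /(_ x hx)] := prim_cst (0 : C).
    rewrite add0r => e; rewrite [LHS]e; apply: eq_cint => // t _; by rewrite /Y big_ord0 mulr0.
  rewrite big_ord_recr /= IH -cintD //.
  - by apply: eq_cint => // t _; rewrite /Y big_ord_recr /= mulrDr.
  - by have [f pf] := pY N; exact: cintegrableMprim pf.
  - by have [[f pf] _] := pic_prim lam al be N qi; exact: cintegrableMprim pf.
have x01 : 0 <= (1 : R) <= 1 by rewrite ler01 /=.
have yE x : 0 <= x <= 1 -> y x = al + cint z x.
  move=> hx; apply/eqP; rewrite -subr_eq0 -nm_eq0 eq_le nm_ge0 andbT.
  apply: (@le_halving _ _ _ (4 * A + 2 * (4 * (r0 * A)))).
    by apply: addr_ge0 => //; apply: mulr_ge0 => //; exact: mulr_ge0.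
  move=> N; rewrite add0r.
  have -> : y x - (al + cint z x) = (y x - Y N.+1 x) - cint (fun t => z t - Z N t) x.
    rewrite YS // cintB //; first by ring.
    by have [f pf] := pZ N; exact: cintegrable_prim pf.
  apply: le_trans (nmB _ _) _; rewrite mulrDl; apply: lerD.
    apply: le_trans (hyA x N.+1 hx) _; rewrite ler_wpM2l //.
    by rewrite lef_pV2 ?posrE ?exprn_gt0 // ler_eXn2l // ltr1n.
  apply: le_trans (cint_le (g := fun=> 4 * (r0 * A) / 2 ^+ N) hx _ _ _) _.
  - by apply: cintegrableB => //; have [f pf] := pZ N; exact: cintegrable_prim pf.
  - exact: rint_cst.
  - by move=> t ht; exact: hz.
  have /andP[x0 x1] := hx.
  have hc : 0 <= 2 * (4 * (r0 * A)) / 2 ^+ N by rewrite mulr_ge0 // mulr_ge0.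
  rewrite J_cst //; apply: le_trans (ler_piMr hc x1); rewrite le_eqVlt; apply/orP; left; apply/eqP; ring.
have zE x : 0 <= x <= 1 -> z x = be + cint (fun t => (q t - lam) * y t) x.
  move=> hx; apply/eqP; rewrite -subr_eq0 -nm_eq0 eq_le nm_ge0 andbT.
  pose g t := `|re (q t - lam)| + `|im (q t - lam)|.
  have gi : rint g by exact: rint_ReIm.
  have g0 : 0 <= J g x by apply: J_ge0 => // t _; rewrite addr_ge0.
  apply: (@le_halving _ _ _ (4 * (r0 * A) + 2 * (4 * A * J g x))).
    by apply: addr_ge0 => //; apply: mulr_ge0 => //; exact: mulr_ge0.
  move=> N; rewrite add0r.
  have [f pf] := pY N.
  have -> : z x - (be + cint (fun t => (q t - lam) * y t) x) = (z x - Z N.+1 x) - cint (fun t => (q t - lam) * (y t - Y N t)) x.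
    rewrite ZS // [cint (fun t => _ * (_ - _)) x](@eq_cint _ _ (fun t => (q t - lam) * y t - (q t - lam) * Y N t)) //; last first.
      by move=> t _; rewrite mulrBr.
    rewrite cintB //; first by ring.
    exact: cintegrableMprim pf.
  apply: le_trans (nmB _ _) _; rewrite [leRHS]mulrDl; apply: lerD.
    apply: le_trans (hz x hx N.+1) _; rewrite ler_wpM2l //.
    by rewrite lef_pV2 ?posrE ?exprn_gt0 // ler_eXn2l // ltr1n.
  apply: le_trans (cint_le (g := fun t => 4 * A / 2 ^+ N * g t) hx _ _ _) _.
  - apply: (@cintegrable_eq _ (fun t => (q t - lam) * y t - (q t - lam) * Y N t)).
      by move=> t _; rewrite mulrBr.
    by apply: cintegrableB => //; exact: cintegrableMprim pf.
  - exact: rintZ.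
  - move=> t ht; rewrite nmM mulrC; apply: ler_pM; rewrite ?nm_ge0 //; first exact: hyA.
    exact: nm_ReIm.
  rewrite JZ // le_eqVlt; apply/orP; left; apply/eqP; ring.
have y0 : y 0 = al by rewrite yE ?lexx ?ler01 // cint0 addr0.
have z0 : z 0 = be by rewrite zE ?lexx ?ler01 // cint0 addr0.
exists y, z; split=> //.
  by split=> //; split=> // x hx; rewrite y0 z0 -yE // -zE.
move=> r hr1 hlr x hx N; apply: hy => // n.
by have [] := pic_size_le al be qi hr1 hlr n hx.
Qed.

End Picard.

(** * Polynomial dependence on the spectral parameter *)

Section PolyRep.
Variable R : realType.
Local Notation C := R[i].
Implicit Types (q y z : R -> C) (x t A B : R) (lam c al be : C) (F : C -> R -> C).

(** Absolutely continuous coefficients stay integrable after multiplication by [q], so a Picard step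
    can be taken coefficient by coefficient. *)
Definition polyrep N F := exists c : nat -> R -> C,
  (forall m, exists f, prim f (c m)) /\
  forall lam x, 0 <= x <= 1 -> F lam x = \sum_(m < N) c m x * lam ^+ m.

Lemma cint_sum N (c : nat -> R -> C) lam x : (forall m, cintegrable (c m)) -> 0 <= x <= 1 ->
  cintegrable (fun t => \sum_(m < N) c m t * lam ^+ m) /\
  cint (fun t => \sum_(m < N) c m t * lam ^+ m) x = \sum_(m < N) cint (c m) x * lam ^+ m.
Proof.
move=> ci hx; elim: N => [|N [IHi IH]].
  split; first by apply: cintegrable_eq (cintegrable_cst 0) => t _; rewrite big_ord0.
  rewrite big_ord0; have [_ /(_ x hx)] := prim_cst (0 : C); rewrite add0r => e.
  by rewrite [RHS]e; apply: eq_cint => // t _; rewrite big_ord0.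
have ti : cintegrable (fun t => lam ^+ N * c N t) by exact: cintegrableZ.
split.
  by apply: cintegrable_eq (cintegrableD IHi ti) => t _; rewrite big_ord_recr /= [_ * c _ _]mulrC.
rewrite big_ord_recr /= -IH [cint _ x * _]mulrC -cintZ // -cintD //.
by apply: eq_cint => // t _; rewrite big_ord_recr /= [_ * c _ _]mulrC.
Qed.

Lemma polyrep_widen N F : polyrep N F -> polyrep N.+1 F.
Proof.
move=> [c [pc hc]]; exists (fun m => if (m < N)%N then c m else fun=> 0); split.
  by move=> m; case: ifP => _ //; exists (fun=> 0); exact: prim_cst.
move=> lam x hx; rewrite hc // big_ord_recr /= ltnn mul0r addr0.
by apply: eq_bigr => i _; rewrite ltn_ord.
Qed.

Lemma polyrep_cint N F : polyrep N F -> polyrep N (fun lam => cint (F lam)).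
Proof.
move=> [c [pc hc]]; exists (fun m => cint (c m)).
have ci m : cintegrable (c m) by have [f pf] := pc m; exact: cintegrable_prim pf.
split; first by move=> m; exists (c m); exact: prim_cint.
move=> lam x hx; have [_ <-] := cint_sum N lam ci hx.
by apply: eq_cint => // t ht; exact: hc.
Qed.

Lemma polyrep_step q N F : cintegrable q -> polyrep N F ->
  polyrep N.+1 (fun lam => cint (fun t => (q t - lam) * F lam t)).
Proof.
move=> qi [c [pc hc]].
(* Multiplication by [q] keeps the degree in [lam]; multiplication by [- lam] shifts it by one. *)
pose d m := fun x => (if (m < N)%N then cint (fun t => q t * c m t) x else 0)
  - (if m is k.+1 then cint (c k) x else 0).
have ci m : cintegrable (c m) by have [f pf] := pc m; exact: cintegrable_prim pf.
have qci m : cintegrable (fun t => q t * c m t) by have [f pf] := pc m; exact: cintegrableMprim pf.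
exists d; split.
  move=> m.
  have [f pf] : exists f, prim f (fun x => if (m < N)%N then cint (fun t => q t * c m t) x else 0).
    case: (m < N)%N; first by exists (fun t => q t * c m t); exact: prim_cint.
    by exists (fun=> 0); exact: prim_cst.
  have [g pg] : exists g, prim g (fun x => if m is k.+1 then cint (c k) x else 0).
    case: (m) => [|k]; first by exists (fun=> 0); exact: prim_cst.
    by exists (c k); exact: prim_cint.
  by eexists; exact: primB pf pg.
move=> lam x hx.
have [i1 e1] := cint_sum N lam qci hx; have [i2 e2] := cint_sum N lam ci hx.
rewrite (@eq_cint _ _ (fun t => \sum_(m < N) (q t * c m t) * lam ^+ m - lam * \sum_(m < N) c m t * lam ^+ m)) //; last first.
  move=> t ht; rewrite hc // mulrBl; congr (_ - _).
  by rewrite mulr_sumr; apply: eq_bigr => m _; rewrite mulrA.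
rewrite cintB //; last exact: cintegrableZ.
rewrite cintZ // e1 e2 /d.
under [RHS]eq_bigr do rewrite mulrBl.
rewrite sumrB; congr (_ - _).
  rewrite big_ord_recr /= ltnn mul0r addr0.
  by apply: eq_bigr => m _; rewrite ltn_ord.
rewrite big_ord_recl /= mul0r add0r mulr_sumr; apply: eq_bigr => m _.
by rewrite exprS; ring.
Qed.

Lemma pic_polyrep q al be n : cintegrable q ->
  polyrep n.+1 (fun lam => (pic q lam al be n).1) /\ polyrep n.+1 (fun lam => (pic q lam al be n).2).
Proof.
move=> qi; elim: n => [|n [IH1 IH2]].
  have cst_rep c : polyrep 1 (fun lam => fun=> c).
    exists (fun=> fun=> c); split; first by move=> m; exists (fun=> 0); exact: prim_cst.
    by move=> lam x hx; rewrite big_ord1 expr0 mulr1.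
  by split; exact: cst_rep.
split; first exact: (polyrep_widen (polyrep_cint IH2)).
exact: (polyrep_step qi IH1).
Qed.

Lemma pic_sum_poly q al be x N : cintegrable q -> 0 <= x <= 1 ->
  exists2 p : {poly C}, (size p <= N)%N &
    forall lam, \sum_(n < N) (pic q lam al be n).1 x = p.[lam].
Proof.
move=> qi hx; elim: N => [|N [p sp hp]].
  by exists 0; [rewrite size_poly0|move=> lam; rewrite big_ord0 horner0].
have [[c [_ hc]] _] := pic_polyrep al be N qi.
exists (p + \poly_(m < N.+1) c m x).
  apply: leq_trans (size_polyD _ _) _; rewrite geq_max (leqW sp) /=; exact: size_poly.
move=> lam; rewrite big_ord_recr /= hp hc // hornerD; congr (_ + _).
by rewrite horner_poly.
Qed.

End PolyRep.

(** * A Bernstein inequality on the imaginary axis *)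

Section Bernstein.
Variable R : realType.
Local Notation C := R[i].
Implicit Types (p P Q : {poly C}) (w z : C).

(** ['X^n - 1] splits and is separable, and [n] distinct [n]-th roots of unity include a primitive
    one. *)
Lemma prim_root_existsC n : (0 < n)%N -> exists w : C, n.-primitive_root w.
Proof.
move=> n0; have [rs hrs] := closed_field_poly_normal ('X^n - 1 : {poly C}).
have nn0 : n%:R != 0 :> C by rewrite pnatr_eq0 -lt0n.
have lc : lead_coef ('X^n - 1 : {poly C}) = 1 by apply/monicP; exact: monicXnsubC.
rewrite lc scale1r in hrs.
have us : uniq rs by rewrite -separable_prod_XsubC -hrs; exact: separable_Xn_sub_1.
have sz : size rs = n.
  by have := size_XnsubC (1 : C) n0; rewrite polyC1 hrs size_prod_XsubC => -[].
have al : all n.-unity_root rs.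
  by apply/allP => z zr; rewrite /root_of_unity hrs root_prod_XsubC.
have := has_prim_root n0 al us; rewrite sz leqnn => /(_ isT) /hasP [w _ hw].
by exists w.
Qed.

(** Discrete Fourier inversion. Only exponents congruent to [m] modulo [n] survive the sum, and
    [m < n] with [size Q <= n + m] leaves no such exponent but [m]. *)
Lemma avg_coef w n m Q : n.-primitive_root w -> (m < n)%N -> (size Q <= n + m)%N ->
  \sum_(k < n) (w ^+ k)^-1 ^+ m * Q.[w ^+ k] = n%:R * Q`_m.
Proof.
move=> pw mn sQ.
have w0 : w != 0.
  apply/eqP => w00; have := prim_expr_order pw.
  by rewrite w00 expr0n gtn_eqF ?(prim_order_gt0 pw) // => /eqP; rewrite eq_sym oner_eq0.
under eq_bigr => k _ do rewrite (horner_coef_wide _ sQ) mulr_sumr.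
rewrite exchange_big /= (bigD1 (Ordinal (ltn_addr m mn) : 'I_(n + m))) //=.
rewrite [X in _ + X]big1 ?addr0.
  rewrite (eq_bigr (fun=> Q`_m)) ?sumr_const ?card_ord ?mulr_natl // => k _.
  by rewrite mulrCA -exprMn mulVf ?expf_neq0 // expr1n mulr1.
(* The remaining sums are full geometric sums of an [n]-th root of unity [s] different from 1, hence
   0. *)
move=> j jm; pose s := w ^+ j / w ^+ m.
have s1 : s != 1.
  have wm0 : w ^+ m != 0 by rewrite expf_neq0.
  rewrite /s -(inj_eq (mulIf wm0)) mulfVK // mul1r (eq_prim_root_expr pw).
  have jmn : nat_of_ord j != m by [].
  rewrite (modn_small mn); have := ltn_ord j; case: (ltnP j n) => [jn _|nj jnm].
    by rewrite modn_small.
  by rewrite -(subnK nj) modnDr modn_small; lia.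
have sn : s ^+ n = 1.
  by rewrite /s expr_div_n -!exprM mulnC [(m * n)%N]mulnC !exprM (prim_expr_order pw) !expr1n divr1.
have : (s - 1) * \sum_(k < n) s ^+ k = 0 by rewrite -subrX1 sn subrr.
move/eqP; rewrite mulf_eq0 subr_eq0 (negbTE s1) /= => /eqP hs.
rewrite (eq_bigr (fun k : 'I_n => Q`_j * s ^+ k)); last first.
  move=> k _; rewrite mulrCA /s expr_div_n exprVn -!exprM; congr (_ * _).
  by rewrite [LHS]mulrC ![(k * _)%N]mulnC.
by rewrite -mulr_sumr hs mulr0.
Qed.

Section Functional.
Variables (N : nat) (N0 : (0 < N)%N).

Let S : {poly C} := \poly_(i < N) 1.
(* On the unit circle [V] is, up to a power of the variable, the Fejer kernel
   times [1 - z ^ (2 N)]: averaging against it extracts a derivative at [1]. *)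
Let V : {poly C} := (1 - 'X^(2 * N)) * (S * S).

Let SS_mid : (S * S)`_(N.-1) = N%:R.
Proof.
rewrite coefM (eq_bigr (fun=> 1)) ?sumr_const ?card_ord ?prednK // => i _.
have := ltn_ord i; rewrite /S !coef_poly => hi.
have -> : (i < N)%N by lia.
have -> : (N.-1 - i < N)%N by lia.
by rewrite mulr1.
Qed.

(** Multiplying by [1 - 'X] takes differences of coefficients, and from degree [N] to [3 N - 1] the
    coefficients of [V * (1 - 'X)] are all [-1]. So the coefficients of [V] fall linearly from [N]
    to [- N]. *)
Let V_coef e : (e <= 2 * N)%N -> V`_(N.-1 + e) = N%:R - e%:R.
Proof.
have VX : V * (1 - 'X) = (1 - 'X^N - 'X^(2 * N) + 'X^(3 * N)) * S.
  have SX : S * (1 - 'X) = 1 - 'X^N.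
    have -> : S = \sum_(i < N) 'X^i.
      by rewrite /S poly_def; apply: eq_bigr => i _; rewrite scale1r.
    by rewrite -[RHS]opprB subrX1 mulrC -mulNr opprB.
  have -> : V * (1 - 'X) = (1 - 'X^(2 * N)) * S * (S * (1 - 'X)) by rewrite /V; ring.
  rewrite SX (_ : (3 * N = 2 * N + N)%N); last by lia.
  by rewrite exprD; ring.
elim: e => [|e IH] he.
  rewrite addn0 subr0 /V mulrBl mul1r coefB coefXnM SS_mid ifT ?subr0 //; lia.
have := congr1 (fun P : {poly C} => P`_(N.-1 + e).+1) VX.
rewrite mulrBr mulr1 coefB coefMX /= IH; last by lia.
rewrite !(mulrDl, mulNr, mul1r) !(coefD, coefN) !coefXnM /S !coef_poly.
have -> : ((N.-1 + e).+1 < N)%N = false by lia.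
have -> : ((N.-1 + e).+1 < 3 * N)%N by lia.
have -> : (N.-1 + e).+1 = (N + e)%N by lia.
rewrite addKn -addSnnS prednK // -natr1.
have [eN|Ne] := ltnP e N.
  have -> : (N + e < 2 * N)%N by lia.
  by move=> h; rewrite -[LHS](subrK (N%:R - e%:R)) h; ring.
have -> : (N + e < 2 * N)%N = false by lia.
have -> : (N + e - 2 * N < N)%N by lia.
by move=> h; rewrite -[LHS](subrK (N%:R - e%:R)) h; ring.
Qed.

(** The coefficient of [V] meeting [P_i] in degree [3 N - 1] is [N - (2 N - i) = i - N]. *)
Let VP_coef P : (size P <= (2 * N).+1)%N ->
  (V * P)`_(3 * N).-1 = P^`().[1] - N%:R * P.[1].
Proof.
move=> sP.
have -> : P^`().[1] = \sum_(i < (2 * N).+1) P`_i * i%:R.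
  have sP' : (size P^`() <= 2 * N)%N.
    by have [->|P0] := eqVneq P 0; [rewrite deriv0 size_poly0|rewrite -ltnS; apply: leq_trans sP; exact: lt_size_deriv].
  rewrite (horner_coef_wide _ sP') big_ord_recl /= mulr0 add0r.
  by apply: eq_bigr => i _; rewrite expr1n mulr1 coef_deriv mulr_natr.
rewrite (horner_coef_wide _ sP) mulr_sumr -sumrB.
rewrite mulrC coefM.
have -> : (3 * N).-1.+1 = ((2 * N).+1 + N.-1)%N by lia.
rewrite big_split_ord /= [X in _ + X]big1 ?addr0; last first.
  move=> i _; rewrite nth_default ?mul0r //; apply: leq_trans sP _; exact: leq_addr.
apply: eq_bigr => i _; have := ltn_ord i => hi.
have -> : ((3 * N).-1 - i = N.-1 + (2 * N - i))%N by lia.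
rewrite V_coef; last by lia.
rewrite expr1n mulr1 natrB; last by lia.
by rewrite natrM; ring.
Qed.

(** [S] is palindromic, so on the unit circle [z ^ (- (N - 1)) S(z)] is the conjugate of [S(z)]: the
    Fejer kernel is nonnegative. *)
Let S_unit z : nm z = 1 -> z^-1 ^+ N.-1 * (S * S).[z] = ((nm S.[z]) ^+ 2)%:C%C.
Proof.
move=> z1.
have z0 : z != 0 by rewrite -nm_gt0 z1.
have zc : z^-1 = (z^*)%C.
  apply: (mulfI z0); rewrite mulfV // -sqr_normc normC_nm z1 /= expr1n.
  by [].
have SE x : S.[x] = \sum_(i < N) x ^+ i.
  by rewrite /S horner_poly; apply: eq_bigr => i _; rewrite mul1r.
have cS : z^-1 ^+ N.-1 * S.[z] = (S.[z]^*)%C.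
  rewrite !SE rmorph_sum /= mulr_sumr (reindex_inj rev_ord_inj) /=.
  apply: eq_bigr => i _; have hi := ltn_ord i.
  have -> : (N.-1 = (N - i.+1) + i)%N by lia.
  rewrite exprD mulrAC -exprMn mulVf // expr1n mul1r.
  have -> : ((z ^+ i)^*)%C = ((z^*)%C) ^+ i by exact: (rmorphXn (@conjc R)).
  by rewrite -zc.
by rewrite hornerM mulrA cS mulrC -sqr_normc normC_nm -rmorphXn.
Qed.

(** The substitution [(L / 2) (z - 1 / z) = i L sin theta] maps the unit circle onto the segment,
    and [L p'(0)] becomes a derivative at [z = 1]. The kernel [V] recovers it from samples;
    [|1 - z ^ (2 N)| <= 2] and the mean [N] of [|S| ^ 2] give the constant [2 N]. *)
Lemma bernstein p (L M : R) : 0 < L -> (size p <= N.+1)%N ->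
  (forall t : R, `|t| <= L -> nm p.[(0 +i* t)%C] <= M) ->
  L * nm p`_1 <= 2 * N%:R * M.
Proof.
move=> L0 sp hp.
have [w pw] := @prim_root_existsC (4 * N) (ltac:(lia)).
have nm_w k : nm (w ^+ k) = 1.
  have h : nm w ^+ (4 * N) = 1 by rewrite -nmX (prim_expr_order pw) nm1.
  have n1 : nm w = 1.
    by apply/eqP; rewrite -(@pexpr_eq1 _ (nm w) (4 * N)) ?nm_ge0 ?h ?muln_gt0.
  by rewrite nmX n1 expr1n.
(* [z ^ N p((L / 2) (z - 1 / z))] cleared of denominators, of degree at most [2 N]. *)
pose P : {poly C} := \sum_(d < N.+1) (p`_d * (L / 2)%:C%C ^+ d) *: (('X^2 - 1) ^+ d * 'X^(N - d)).
have sP : (size P <= (2 * N).+1)%N.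
  apply: leq_trans (size_sum _ _ _) _; apply/bigmax_leqP => d _.
  apply: leq_trans (size_scale_leq _ _) _.
  apply: leq_trans (size_polyMleq _ _) _; rewrite size_polyXn addnS /=.
  have : (size (('X^2 - 1 : {poly C}) ^+ d) <= (2 * d).+1)%N.
    apply: leq_trans (size_poly_exp_leq _ _) _.
    by rewrite -polyC1 size_XnsubC //= mulnC.
  move=> h; apply: (leq_trans (leq_add h (leqnn _))); have := ltn_ord d; lia.
have PE z : z != 0 -> P.[z] = z ^+ N * p.[(L / 2)%:C%C * (z - z^-1)].
  move=> z0; rewrite (horner_coef_wide _ sp) mulr_sumr /P horner_sum.
  apply: eq_bigr => d _; rewrite !hornerE.
  have hd : (d <= N)%N by have := ltn_ord d; lia.
  have -> : z ^+ N = z ^+ (N - d) * z ^+ d by rewrite -exprD subnK.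
  have -> : (z ^+ 2 - 1) = z * (z - z^-1) by rewrite mulrBr mulfV // expr2.
  by move: (z - z^-1) => u; rewrite !exprMn /=; ring.
(* [z ^ 2 - 1] vanishes to first order at 1: terms with [d >= 2] drop out, and for [d = 0]
   subtracting [N P(1)] cancels the derivative of [z ^ N]. *)
have D1 : P^`().[1] - N%:R * P.[1] = L%:C%C * p`_1.
  have Qd d : (d <= N)%N -> (('X^2 - 1) ^+ d * 'X^(N - d))^`().[1]
      - N%:R * (('X^2 - 1) ^+ d * 'X^(N - d)).[1] = (if d == 1%N then 2 else 0 : C).
    move=> dN; rewrite derivM deriv_exp derivXn derivB derivXn derivC.
    rewrite -!polyC1 !(hornerD, hornerM, hornerMn, horner_exp, hornerN, hornerXn, hornerC) /=.
    rewrite !hornerX mulr1 !expr1n subrr; case: d dN => [|[|d]] dN /=.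
    - by rewrite subn0 mulr0n; ring.
    - by rewrite expr0 expr1 ?mulr0 mulr1n; ring.
    - by rewrite !exprS !(mul0r, mulr0, mul0rn, subr0, addr0).
  have -> : P^`().[1] - N%:R * P.[1] = \sum_(d < N.+1) (p`_d * (L / 2)%:C%C ^+ d) * (if d == 1%N :> nat then 2 else 0).
    rewrite {1}/P raddf_sum /= /P !horner_sum mulr_sumr -sumrB; apply: eq_bigr => d _.
    rewrite derivZ !hornerZ -(Qd d); last by have := ltn_ord d; lia.
    by ring.
  have h1 : (1 < N.+1)%N by lia.
  rewrite (bigD1 (Ordinal h1)) //= big1 ?addr0.
    rewrite expr1 rmorphM fmorphV rmorph_nat /=.
    by field.
  by move=> d d1; rewrite ifF ?mulr0 //; apply/negbTE.
have sQ : (size (V * P)%R <= 4 * N + (3 * N).-1)%N.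
  have sS : (size S <= N)%N by exact: size_poly.
  have sX : (size (1 - 'X^(2 * N) : {poly C})%R <= (2 * N).+1)%N.
    by rewrite -size_polyN opprB -polyC1 size_XnsubC //; lia.
  have sSS : (size (S * S)%R <= (N + N).-1)%N.
    by apply: leq_trans (size_polyMleq _ _) _; have := leq_add sS sS; lia.
  have sV : (size V <= ((2 * N).+1 + (N + N).-1).-1)%N.
    by apply: leq_trans (size_polyMleq _ _) _; have := leq_add sX sSS; lia.
  apply: leq_trans (size_polyMleq _ _) _; have := leq_add sV sP; lia.
have m_lt : ((3 * N).-1 < 4 * N)%N by lia.
have main := avg_coef pw m_lt sQ.
rewrite (VP_coef sP) D1 in main.
have SSQ : (size (S * S)%R <= 4 * N + N.-1)%N.
  apply: leq_trans (size_polyMleq _ _) _; have sS : (size S <= N)%N by exact: size_poly.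
  by have := leq_add sS sS; lia.
have m_lt2 : (N.-1 < 4 * N)%N by lia.
have energy := avg_coef pw m_lt2 SSQ.
rewrite SS_mid in energy.
(* The mean of [|S| ^ 2] over the sample points is the middle coefficient of [S * S], extracted by
   the same averaging. *)
have {}energy : \sum_(k < 4 * N) (nm S.[w ^+ k]) ^+ 2 = (4 * N)%:R * N%:R.
  apply: (@complexI R); rewrite rmorph_sum rmorphM !rmorph_nat /= -energy.
  by apply: eq_bigr => k _; rewrite S_unit.
have n0 : 0 < (4 * N)%:R :> R by rewrite ltr0n; lia.
rewrite -(ler_pM2l n0).
have M0 : 0 <= M by apply: le_trans (nm_ge0 _) (hp 0 _); rewrite normr0 ltW.
have -> : (4 * N)%:R * (L * nm p`_1) = nm ((4 * N)%:R * (L%:C%C * p`_1)).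
  by rewrite !nmM nm_nat nm_real gtr0_norm.
rewrite -main.
apply: (@le_trans _ _ (\sum_(k < 4 * N) 2 * M * (nm S.[w ^+ k]) ^+ 2)).
  elim/big_ind2: _ => [|x1 x2 y1 y2 h1 h2|k _]; first by rewrite nm0.
    by apply: le_trans (nmD _ _) _; exact: lerD.
  set z := w ^+ k; have z1 : nm z = 1 by exact: nm_w.
  have z0 : z != 0 by rewrite -nm_gt0 z1.
  have zc : z^-1 = (z^*)%C.
    by apply: (mulfI z0); rewrite mulfV // -sqr_normc normC_nm z1 /= expr1n.
  rewrite /V !hornerM PE // nmM nmX nmV z1 invr1 expr1n mul1r !nmM nmX z1 expr1n mul1r.
  have h1 : nm (1 - 'X^(2 * N)).[z] <= 2.
    rewrite !(hornerD, hornerN, hornerXn, hornerC).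
    by apply: le_trans (nmB _ _) _; rewrite nm1 nmX z1 expr1n.
  (* On the circle [z - 1 / z = 2 i Im z], so the argument stays in the segment where [M] is a
     bound. *)
  have h2 : nm p.[(L / 2)%:C%C * (z - z^-1)] <= M.
    have -> : (L / 2)%:C%C * (z - z^-1) = (0 +i* (L * complex.Im z))%C.
      rewrite zc; case: (z) => x y.
      apply: complex_ext; rewrite ?cReM ?cImM /=; first by ring.
      by field.
    apply: hp; rewrite normrM gtr0_norm //; apply: ler_piMr; first exact: ltW.
    by rewrite -z1; exact: nm_Im.
  have s0 : 0 <= nm S.[z] by exact: nm_ge0.
  rewrite -expr2 mulrAC; apply: ler_wpM2r; first exact: sqr_ge0.
  by apply: ler_pM => //; exact: nm_ge0.
by rewrite -mulr_sumr energy le_eqVlt; apply/orP; left; apply/eqP; ring.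
Qed.

End Functional.
End Bernstein.

(** * Vanishing from decay on the imaginary axis *)

Section VanishAtZero.
Variable R : realType.
Local Notation C := R[i].

Lemma size_mulX_sqr (g : {poly C}) m : (size g <= 2 * m)%N ->
  (size ('X * (g * g))%R <= (4 * m).+1)%N.
Proof.
move=> sg; have sgg : (size (g * g)%R <= 4 * m)%N.
  by apply: leq_trans (size_polyMleq _ _) _; have := leq_add sg sg; lia.
apply: leq_trans (size_polyMleq _ _) _; rewrite size_polyX; move: sgg; lia.
Qed.

(** Bernstein is applied to ['X * (g * g)], where [g] approximates [G] on the disc of radius
    [n ^ 2]: its coefficient of degree 1 is [g(0) ^ 2]. *)
Lemma vanish_at0 (G : C -> C) (c0 T B E : R) :
  (forall t : R, T <= `|t| -> `|t| * nm (G (0 +i* t)%C) ^+ 2 <= c0) ->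
  1 <= E ->
  (forall n N : nat, (0 < n)%N -> exists2 g : {poly C}, (size g <= 2 * N)%N &
     forall lam, nm lam <= n%:R ^+ 2 ->
       nm (G lam) <= B * E ^+ n /\ nm (G lam - g.[lam]) <= B * E ^+ n / 2 ^+ N) ->
  G 0 = 0.
Proof.
move=> hdec E1 happ.
have E0 : 0 <= E by exact: le_trans E1.
have B0 : 0 <= B.
  have [g _ /(_ 0)] := happ 1%N 0%N isT; rewrite nm0 expr1n => /(_ ler01) [h _].
  have := le_trans (nm_ge0 _) h; rewrite expr1 pmulr_lge0 //; exact: lt_le_trans E1.
have nat_le_exp2 n : n%:R <= 2 ^+ n :> R by rewrite -natrX ler_nat; exact/ltnW/ltn_expl.
(* [2 ^ c >= 4 E ^ 2] makes the squared growth [E ^ (2 n)] over [2 ^ (c n)] at most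
   [4 ^ (- n) <= n ^ (- 2)], so [N = c n] suffices. *)
pose c := (Num.bound (4 * E ^+ 2)).+1.
have hc : 4 * E ^+ 2 <= 2 ^+ c.
  apply: (@le_trans _ _ (Num.bound (4 * E ^+ 2))%:R).
    by apply/ltW/archi_boundP; rewrite mulr_ge0 ?exprn_ge0.
  by apply: le_trans (nat_le_exp2 _) _; rewrite /c ler_eXn2l ?ltr1n.
have decay n : E ^+ n ^+ 2 / 2 ^+ (c * n) * n%:R ^+ 2 <= 1.
  have h1 : n%:R ^+ 2 <= 4 ^+ n :> R.
    rewrite (_ : 4 = 2 ^+ 2); last by rewrite -natrX.
    by rewrite -exprM mulnC exprM; apply: lerXn2r; rewrite ?nnegrE ?ler0n ?exprn_ge0.
  have h2 : (4 * E ^+ 2) ^+ n <= 2 ^+ (c * n).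
    have e40 : 0 <= 4 * E ^+ 2 by rewrite mulr_ge0 ?exprn_ge0.
    by rewrite exprM; apply: lerXn2r hc; rewrite nnegrE ?exprn_ge0.
  rewrite mulrAC ler_pdivrMr ?exprn_gt0 // mul1r; apply: le_trans h2.
  rewrite exprMn -!exprM [(2 * n)%N]mulnC mulrC ler_wpM2r ?exprn_ge0 //.
pose n0 := (Num.bound `|T|).+1.
(* A bound for [lam G ^ 2] on the whole imaginary axis: [hdec] for [|t| >= T], the growth bound on
   the disc of radius [n0 ^ 2] elsewhere. *)
pose M0 := Num.max c0 (n0%:R ^+ 2 * (B * E ^+ n0) ^+ 2).
have n0T : T <= n0%:R ^+ 2.
  have h1 : `|T| < n0%:R by apply: lt_le_trans (archi_boundP (normr_ge0 T)) _; rewrite ler_nat.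
  have h2 : 1 <= n0%:R :> R by rewrite ler1n.
  apply: le_trans (ler_norm T) _; apply: le_trans (ltW h1) _.
  by rewrite expr2 ler_peMl // ler0n.
have bounded (t : R) : `|t| * nm (G (0 +i* t)%C) ^+ 2 <= M0.
  have [tT|Tt] := leP T `|t|; first by rewrite le_max hdec.
  have nt : nm (0 +i* t)%C = `|t| by rewrite /nm /= expr0n add0r sqrtr_sqr.
  have tn : nm (0 +i* t)%C <= n0%:R ^+ 2 by rewrite nt (le_trans (ltW Tt)).
  have [g _ /(_ _ tn) [h _]] := happ n0 0%N isT.
  rewrite le_max; apply/orP; right; apply: ler_pM; rewrite ?sqr_ge0 //; first by rewrite -nt.
  apply: lerXn2r h; rewrite nnegrE ?nm_ge0 //.
  by apply: mulr_ge0 => //; exact: exprn_ge0.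
have M00 : 0 <= M0 by have := bounded 0; rewrite normr0 mul0r.
pose K := 8 * c%:R * (M0 + 3 * B ^+ 2) + 3 * B ^+ 2.
have est n : (0 < n)%N -> nm (G 0) ^+ 2 <= K / n%:R.
  move=> npos; have [g sg hg] := happ n (c * n)%N npos.
  have nR : 0 < n%:R :> R by rewrite ltr0n.
  have n1 : 1 <= n%:R :> R by rewrite ler1n.
  set d := B * E ^+ n in hg; set e := 2 ^+ (c * n) in hg decay *.
  have d0 : 0 <= d by rewrite mulr_ge0 ?exprn_ge0.
  have e1 : 1 <= e by rewrite exprn_ege1 // ler1n.
  have e0 : 0 < e by exact: lt_le_trans e1.
  have de : d / e <= d by rewrite ler_pdivrMr // ler_peMr.
  (* [G ^ 2 - g ^ 2] factors into a difference of size [d / e] and a sum of size at most [3 d]. *)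
  have err lam : nm lam <= n%:R ^+ 2 -> nm (G lam ^+ 2 - g.[lam] ^+ 2) <= 3 * B ^+ 2 / n%:R ^+ 2.
    move=> /hg [h1 h2]; rewrite subr_sqr nmM.
    have h3 : nm (G lam + g.[lam]) <= 3 * d.
      have -> : G lam + g.[lam] = (G lam + G lam) - (G lam - g.[lam]) by ring.
      apply: le_trans (nmB _ _) _; have := nmD (G lam) (G lam).
      by move: h1 h2 de; lra.
    apply: le_trans (ler_pM (nm_ge0 _) (nm_ge0 _) h2 h3) _.
    rewrite ler_pdivlMr ?exprn_gt0 //.
    have := ler_wpM2l (sqr_ge0 B) (decay n); rewrite /d; lra.
  pose p : {poly C} := 'X * (g * g).
  have sp : (size p <= (4 * (c * n)).+1)%N by exact: size_mulX_sqr.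
  have pb (t : R) : `|t| <= n%:R ^+ 2 -> nm p.[(0 +i* t)%C] <= M0 + 3 * B ^+ 2.
    move=> ht; set lam := (0 +i* t)%C.
    have nt : nm lam = `|t| by rewrite /nm /= expr0n add0r sqrtr_sqr.
    have hl : nm lam <= n%:R ^+ 2 by rewrite nt.
    rewrite /p hornerM hornerX hornerM -expr2 nmM nt.
    have h1 := nm_tri (g.[lam] ^+ 2) (G lam ^+ 2); rewrite nm_distC nmX in h1.
    have h2 : nm (G lam ^+ 2 - g.[lam] ^+ 2) * n%:R ^+ 2 <= 3 * B ^+ 2.
      by rewrite -ler_pdivlMr ?exprn_gt0 //; exact: err.
    have h3 : `|t| * nm (G lam ^+ 2 - g.[lam] ^+ 2) <= 3 * B ^+ 2.
      by apply: le_trans h2; rewrite mulrC ler_wpM2l ?nm_ge0.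
    have h4 := ler_wpM2l (normr_ge0 t) h1; have := bounded t; rewrite -/lam nmX in h4 *; lra.
  have n4 : (0 < 4 * (c * n))%N by rewrite !muln_gt0 npos.
  (* Degree [4 c n] on a segment of half-length [n ^ 2] leaves the factor [8 c / n]. *)
  have := bernstein n4 (exprn_gt0 2 nR) sp pb.
  have -> : p`_1 = g.[0] ^+ 2 by rewrite /p coefXM /= -horner_coef0 hornerM expr2.
  rewrite !natrM => hb.
  have h0 : nm (0 : C) <= n%:R ^+ 2 by rewrite nm0 exprn_ge0 // ltW.
  have e3 := nm_tri (G 0 ^+ 2) (g.[0] ^+ 2).
  have := err _ h0; rewrite ler_pdivlMr ?exprn_gt0 // => e2.
  rewrite ler_pdivlMr // -nmX.
  have h5 : nm (g.[0] ^+ 2) * n%:R <= 8 * c%:R * (M0 + 3 * B ^+ 2).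
    rewrite -(ler_pM2r nR); apply: le_trans (_ : _ <= 2 * (4%:R * (c%:R * n%:R)) * (M0 + 3 * B ^+ 2)) _.
      by apply: le_trans hb; rewrite le_eqVlt; apply/orP; left; apply/eqP; ring.
    by rewrite le_eqVlt; apply/orP; left; apply/eqP; ring.
  have h6 : nm (G 0 ^+ 2 - g.[0] ^+ 2) * n%:R <= 3 * B ^+ 2.
    apply: le_trans e2; rewrite ler_wpM2l ?nm_ge0 //.
    by rewrite expr2 ler_peMl // ltW.
  have := ler_wpM2r (ltW nR) e3; rewrite /K; lra.
apply/eqP; rewrite -nm_eq0 -sqrf_eq0 eq_le sqr_ge0 andbT leNgt; apply/negP => hG.
have K0 : 0 <= K by have := le_trans (ltW hG) (est 1%N isT); rewrite divr1.
have := archi_boundP (divr_ge0 K0 (ltW hG)); set n := Num.bound _ => hn.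
have n0' : (0 < n)%N.
  by rewrite -(ltr0n R); apply: le_lt_trans hn; rewrite divr_ge0 // ltW.
have := est n n0'; rewrite ler_pdivlMr ?ltr0n // mulrC.
by move: hn; rewrite ltr_pdivrMr // => /lt_le_trans h /h; rewrite ltxx.
Qed.

End VanishAtZero.

(** * Propagation along the tree *)

Section Large.
Variable R : realType.
Local Notation C := R[i].
Local Notation re := (@complex.Re R).

(** The threshold is on [Re kap], not on [|kap|], because [exp (- Re kap)] is what separates the two
    components. *)
Definition large (P : C -> Prop) := exists s0 : R, forall kap, s0 <= re kap -> P kap.

Lemma large_and (P Q : C -> Prop) : large P -> large Q -> large (fun kap => P kap /\ Q kap).
Proof.
move=> [s1 h1] [s2 h2]; exists (Num.max s1 s2) => kap; rewrite ge_max => /andP[k1 k2].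
by split; [exact: h1|exact: h2].
Qed.

Lemma large_imp (P Q : C -> Prop) : (forall kap, P kap -> Q kap) -> large P -> large Q.
Proof. by move=> PQ [s hs]; exists s => kap /hs /PQ. Qed.

Lemma large_ge (s : R) : large (fun kap => s <= re kap).
Proof. by exists s. Qed.

Lemma large_forall n (P : nat -> C -> Prop) : (forall j, (j < n)%N -> large (P j)) ->
  large (fun kap => forall j, (j < n)%N -> P j kap).
Proof.
elim: n => [|n IH] hP; first by exists 0.
have h1 := IH (fun j hj => hP j (ltnW hj)).
have := large_and h1 (hP n (ltnSn n)).
apply: large_imp => kap [h2 h3] j; rewrite ltnS leq_eqVlt => /predU1P[->//|]; exact: h2.
Qed.

Lemma re_le_nm (kap : C) : re kap <= nm kap.
Proof. exact: le_trans (ler_norm _) (nm_Re _). Qed.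

End Large.

(** * Ratios of derivative to value at the ends of an edge *)

Section EdgeRatio.
Variable R : realType.
Local Notation C := R[i].
Local Notation re := (@complex.Re R).
Implicit Types (q y z : R -> C) (kap : C).

(** Turns a thin cone into [z ~ kap y] or [z ~ - kap y], since [u] and [v] differ by [2 kap y]. *)
Lemma cone_ratio (u v w : C) (e : R) : 0 <= e -> e <= 1 / 2 -> u = v + w -> nm v <= e * nm u ->
  nm v <= 2 * e * nm w.
Proof.
move=> e0 e2 uE hv; have := nmD v w; rewrite -uE => hu.
have := nm_ge0 v; have := nm_ge0 w; nra.
Qed.

(** Data near [z = S kap y] has [u] near [(S + 1) kap y], which [S != -1] keeps away from zero; so
    it lies in some cone, and [forward_cone] narrows it. [del] precedes the choice of threshold so
    that it can be distributed among the child edges. *)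
Lemma forward_ratio q (S : C) (eps : R) : cintegrable q -> S != -1 -> 0 < eps ->
  exists2 del, 0 < del & large (fun kap => forall y z, edge_sol q (- kap ^+ 2) y z ->
    nm (z 0 - S * kap * y 0) <= del * nm kap * nm (y 0) ->
    nm (z 1 - kap * y 1) <= eps * nm kap * nm (y 1)).
Proof.
move=> qi S1 eps0.
pose d := nm (S + 1).
have d0 : 0 < d by rewrite nm_gt0 addr_eq0.
exists (d / 2); first by rewrite divr_gt0.
(* The quotient of the upper bound [hv] for [v] and the lower bound [hu] for [u]; adding 1 ensures
   [1 <= K]. *)
pose K := 1 + 2 * (nm (S - 1) + d) / d.
have K1 : 1 <= K by rewrite lerDl divr_ge0 ?mulr_ge0 ?addr_ge0 ?nm_ge0 // ltW.
(* [cone_ratio] needs [e <= 1 / 2] and returns [2 e |2 kap y|], whence [eps / 4]. *)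
pose e := Num.min (1 / 2) (eps / 4).
have e0 : 0 < e by rewrite lt_min !divr_gt0.
have e2 : e <= 1 / 2 by rewrite ge_min lexx.
have e4 : e <= eps / 4 by rewrite ge_min lexx orbT.
have e1 : e <= 1 by apply: le_trans e2 _; lra.
exists (2 * K * (1 + 4 * mass q) / e) => kap; rewrite ler_pdivrMr // mulrC => hk y z yz h0.
set k := nm kap in h0 *; set y0 := nm (y 0) in h0.
have ky : 0 <= k * y0 by rewrite mulr_ge0 ?nm_ge0.
have hu : d / 2 * (k * y0) <= nm (uu kap y z 0).
  have -> : uu kap y z 0 = (S + 1) * (kap * y 0) + (z 0 - S * kap * y 0) by rewrite /uu; ring.
  have := nm_tri ((S + 1) * (kap * y 0)) (- (z 0 - S * kap * y 0)).
  rewrite opprK nmN !nmM -/d -/k -/y0; lra.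
have hv : nm (vv kap y z 0) <= (nm (S - 1) + d) * (k * y0).
  have -> : vv kap y z 0 = (S - 1) * (kap * y 0) + (z 0 - S * kap * y 0) by rewrite /vv; ring.
  apply: le_trans (nmD _ _) _; rewrite !nmM -/k -/y0.
  have := mulr_ge0 (ltW d0) ky; lra.
have hK : nm (vv kap y z 0) <= K * nm (uu kap y z 0).
  apply: le_trans hv _.
  have h1 : (nm (S - 1) + d) * (k * y0) <= 2 * (nm (S - 1) + d) / d * nm (uu kap y z 0).
    have -> : (nm (S - 1) + d) * (k * y0) = 2 * (nm (S - 1) + d) / d * (d / 2 * (k * y0)).
      by field; rewrite lt0r_neq0.
    by rewrite ler_wpM2l // divr_ge0 ?mulr_ge0 ?addr_ge0 ?nm_ge0 // ltW.
  apply: le_trans h1 _; rewrite ler_wpM2r ?nm_ge0 // /K; lra.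
have hk' : 2 * K * (1 + 4 * mass q) <= e * re kap by rewrite mulrC; lra.
have := @forward_cone R q kap y z K e qi yz K1 e0 e1 hk' hK.
move=> /(cone_ratio (ltW e0) e2 (w := 2 * kap * y 1)) h1.
apply: le_trans (h1 _) _; first by rewrite /uu /vv; ring.
rewrite !nmM nm_nat -/k.
have := mulr_ge0 (nm_ge0 kap) (nm_ge0 (y 1)); rewrite -/k => h2.
have := ler_wpM2r h2 e4; lra.
Qed.

(** An arbitrary cone dominated by [v] at the initial end suffices: crossing the edge towards
    [x = 0] narrows it to [z ~ - kap y]. *)
Lemma backward_ratio q (K eps : R) : cintegrable q -> 1 <= K -> 0 < eps ->
  large (fun kap => forall y z, edge_sol q (- kap ^+ 2) y z ->
    nm (uu kap y z 1) <= K * nm (vv kap y z 1) ->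
    nm (z 0 + kap * y 0) <= eps * nm kap * nm (y 0)).
Proof.
move=> qi K1 eps0.
pose e := Num.min (1 / 2) (eps / 4).
have e0 : 0 < e by rewrite lt_min !divr_gt0.
have e2 : e <= 1 / 2 by rewrite ge_min lexx.
have e4 : e <= eps / 4 by rewrite ge_min lexx orbT.
have e1 : e <= 1 by apply: le_trans e2 _; lra.
exists (2 * K * (1 + 4 * mass q) / e) => kap; rewrite ler_pdivrMr // mulrC => hk y z yz hK.
have hk' : 2 * K * (1 + 4 * mass q) <= e * re kap by rewrite mulrC; lra.
have [+ _] := @backward_cone R q kap y z K e qi yz K1 e0 e1 hk' hK.
move=> /(cone_ratio (ltW e0) e2 (w := - (2 * kap * y 0))) h1.
apply: le_trans (h1 _) _; first by rewrite /uu /vv; ring.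
rewrite nmN !nmM nm_nat.
have h2 := mulr_ge0 (nm_ge0 kap) (nm_ge0 (y 0)).
have := ler_wpM2r h2 e4; lra.
Qed.

End EdgeRatio.

Section Tree.
Variable R : realType.
Local Notation C := R[i].
Local Notation re := (@complex.Re R).
Variables (r p : nat) (par : nat -> nat) (a a1 a0 : nat -> C).
Variables (q : nat -> R -> C) (h : nat -> C).
Hypothesis tree : tree_ok r p par.
Hypothesis coeffs : coeffs_ok r p par a a1.
Hypothesis qi : forall j, (1 <= j <= r)%N -> cintegrable (q j).
Implicit Types (kap : C) (Y : nat -> R -> C) (j k m : nat).

Local Notation sol kap := (tree_sol r p par a a1 a0 q (- kap ^+ 2)).

(** The quantity that the regularity condition keeps away from [-1]. *)
Definition transmission m : C := \sum_(1 <= i < r.+1 | par i == m) (a1 i / a i).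

Lemma child_neq_root i m : (p < m)%N -> par i = m -> i != p.+1.
Proof.
move=> pm im; apply/eqP => ip; have [_ hp _ _ _] := tree.
by move: im; rewrite ip hp => m0; rewrite -m0 in pm.
Qed.

Lemma child_coef i m : (p < m)%N -> (1 <= i <= r)%N -> par i = m -> a i != 0 /\ a1 i != 0.
Proof.
move=> pm hi im; have [h1 _] := coeffs.
by have := h1 i hi (child_neq_root pm im); rewrite mulf_eq0 negb_or => /andP[].
Qed.

Lemma child_value kap Y Y' i m : sol kap Y Y' -> (p < m <= r)%N -> (1 <= i <= r)%N -> par i = m ->
  Y i 1 = Y m 0 / a i.
Proof.
move=> [_ hm] hmr hi im; have [/(_ i hi im) -> _] := hm m hmr.
have /andP[pm _] := hmr; have [a_i _] := child_coef pm hi im.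
by rewrite mulrC mulKf.
Qed.

(** By continuity [a1 i * kap * Y i 1] is [(a1 i / a i) * kap * Y m 0], so the deviation from
    [z = S kap y] at the vertex is a sum of deviations from [z = kap y] on the children, plus terms
    without [kap]. *)
Lemma kirchhoff kap Y Y' m : sol kap Y Y' -> (p < m <= r)%N ->
  Y' m 0 - transmission m * kap * Y m 0 =
  \sum_(1 <= i < r.+1 | par i == m) (a1 i * (Y' i 1 - kap * Y i 1) + a0 i * Y i 1).
Proof.
move=> hs hmr; have [_ hm] := hs; have [_ ->] := hm m hmr.
rewrite /transmission !mulr_suml -sumrB big_nat_cond [RHS]big_nat_cond.
apply: eq_bigr => i /andP[hi /eqP im].
rewrite (child_value hs hmr hi im); have /andP[pm _] := hmr; have [a_i _] := child_coef pm hi im.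
by ring.
Qed.

(** The weight with which errors on the children count against [Y m 0], using
    [Y i 1 = Y m 0 / a i]. *)
Definition load (b : nat -> C) m : R := \sum_(1 <= i < r.+1 | par i == m) (nm (b i) / nm (a i)).

Lemma load_ge0 b m : 0 <= load b m.
Proof. by apply: sumr_ge0 => i _; rewrite divr_ge0 ?nm_ge0. Qed.

Lemma nm_sum (I : eqType) (s : seq I) (P : pred I) (F : I -> C) (G : I -> R) :
  (forall i, i \in s -> P i -> nm (F i) <= G i) -> nm (\sum_(i <- s | P i) F i) <= \sum_(i <- s | P i) G i.
Proof.
move=> FG; rewrite big_seq_cond [leRHS]big_seq_cond.
elim/big_ind2: _ => [|x1 x2 y1 y2 h1 h2|i /andP[si Pi]]; first by rewrite nm0.
  by apply: le_trans (nmD _ _) _; exact: lerD.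
exact: FG.
Qed.

(** Closed under passing to child edges, so that all boundary conditions above such an edge are
    available to the induction. *)
Definition downset (X : nat -> Prop) := forall i j, (1 <= i <= r)%N -> (p < j <= r)%N -> par i = j -> X j -> X i.
Definition bc_on (X : nat -> Prop) Y Y' := forall j, (1 <= j <= p)%N -> X j -> U0 p h Y Y' j = 0.

Definition outgoing X j (eps : R) kap := forall Y Y', sol kap Y Y' -> bc_on X Y Y' ->
  nm (Y' j 1 - kap * Y j 1) <= eps * nm kap * nm (Y j 1).

(** A boundary condition is the case [S = 0]: [z = - h y] is negligible against [kap y]. *)
Lemma outgoing_leaf X j eps : (1 <= j <= p)%N -> X j -> 0 < eps -> large (outgoing X j eps).
Proof.
move=> hj Xj eps0; have [/andP[p0 pr] _ _ _ _] := tree.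
have hjr : (1 <= j <= r)%N by case/andP: hj => -> jp; rewrite (leq_trans jp) // ltnW.
have S1 : (0 : C) != -1 by rewrite eq_sym oppr_eq0 oner_eq0.
have [del del0] := forward_ratio (qi hjr) S1 eps0.
move=> /(large_and (large_ge (nm (h j) / del))); apply: large_imp => kap [].
rewrite ler_pdivrMr // => hk hR Y Y' [hs _] hb; apply: hR; first exact: hs.
have := hb j hj Xj; rewrite /U0 ifN; last by case/andP: hj => j0 _; rewrite -lt0n.
move=> /eqP; rewrite addr_eq0 => /eqP ->; rewrite !mul0r subr0 nmN nmM.
rewrite ler_wpM2r ?nm_ge0 //; apply: le_trans hk _; rewrite mulrC ler_wpM2l ?re_le_nm //; exact: ltW.
Qed.

Lemma outgoing_internal X j eps : (p < j <= r)%N -> 0 < eps ->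
  (forall i eps', (1 <= i <= r)%N -> par i = j -> 0 < eps' -> large (outgoing X i eps')) ->
  large (outgoing X j eps).
Proof.
move=> hj eps0 IH.
have hjr : (1 <= j <= r)%N by case/andP: hj => pj ->; rewrite (leq_ltn_trans _ pj).
have [_ /(_ j hj) S1] := coeffs.
have [del del0 hR] := forward_ratio (qi hjr) S1 eps0.
(* The children may spend half of [del]; the other half absorbs the [a0] terms, which lack the
   factor [kap]. *)
pose e := del / (2 * (1 + load a1 j)).
have l1 := load_ge0 a1 j; have l0 := load_ge0 a0 j.
have l10 : 0 < 1 + load a1 j by lra.
have e0 : 0 < e by rewrite divr_gt0 // mulr_gt0.
have hI : large (fun kap => forall i, (i < r.+1)%N -> (1 <= i)%N -> par i = j -> outgoing X i e kap).
  apply: large_forall => i ir.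
  have [i1|] := pselect ((1 <= i)%N /\ par i = j).
    have [i1' ij] := i1; have := IH i e _ ij e0; rewrite i1' -ltnS ir => /(_ isT).
    by apply: large_imp.
  by move=> hn; exists 0 => kap _ i1 ij; case: hn.
have := large_and (large_and hR hI) (large_ge (2 * load a0 j / del)).
apply: large_imp => kap [[{}hR {}hI]]; rewrite ler_pdivrMr // => hk Y Y' hs hb.
have [hse _] := hs; apply: hR; first exact: hse.
rewrite (kirchhoff hs hj).
apply: le_trans (nm_sum (G := fun i => (e * nm kap * nm (Y j 0)) * (nm (a1 i) / nm (a i)) + nm (Y j 0) * (nm (a0 i) / nm (a i))) _) _.
  move=> i; rewrite mem_index_iota => hi /eqP ij.
  have /andP[i1 ir] := hi; have /andP[pj _] := hj.
  have [a_i _] := child_coef pj hi ij.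
  have an : 0 < nm (a i) by rewrite nm_gt0.
  have yv := child_value hs hj hi ij.
  have nv : nm (Y i 1) = nm (Y j 0) / nm (a i) by rewrite yv nmM nmV.
  have := hI i ir i1 ij Y Y' hs hb; rewrite nv => ho.
  apply: le_trans (nmD _ _) _; rewrite !nmM nv; apply: lerD.
    apply: le_trans (ler_wpM2l (nm_ge0 _) ho) _; rewrite le_eqVlt; apply/orP; left; apply/eqP; ring.
  by rewrite le_eqVlt; apply/orP; left; apply/eqP; ring.
rewrite big_split /= -!mulr_sumr -/(load a1 j) -/(load a0 j).
have kk := re_le_nm kap.
set y0 := nm (Y j 0); have y00 : 0 <= y0 by exact: nm_ge0.
set x := nm kap in kk *; have x0 : 0 <= x by exact: nm_ge0.
have h1 : e * load a1 j <= del / 2.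
  have -> : del / 2 = e * (1 + load a1 j) by rewrite /e; field; rewrite lt0r_neq0.
  by rewrite ler_pM2l //; lra.
have h2 : load a0 j <= del / 2 * x by have := ler_wpM2r (ltW del0) kk; lra.
have h3 := ler_wpM2r (mulr_ge0 x0 y00) h1; have h4 := ler_wpM2r y00 h2.
lra.
Qed.

Lemma outgoing_all X j eps : downset X -> (1 <= j <= r)%N -> X j -> 0 < eps -> large (outgoing X j eps).
Proof.
move=> dX; have [/andP[p0 pr] _ _ hpar _] := tree.
(* Induction from the leaves inward. Internal edges have larger indices farther from the root, but
   boundary edges are numbered first, so they get rank 0 by hand. *)
have [n] := ubnP (if (j <= p)%N then 0%N else (r.+1 - j)%N).
elim: n j eps => // n IH j eps; rewrite ltnS => hn hj Xj eps0.
have [jp|pj] := leqP j p.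
  by apply: outgoing_leaf => //; case/andP: hj => ->.
have hjr : (p < j <= r)%N by rewrite pj; case/andP: hj.
apply: outgoing_internal => // i eps' hi ij eps'0; apply: IH => //; last exact: (dX i j).
have /andP[j1 jr] := hj.
apply: leq_trans hn.
have -> : (j <= p)%N = false by lia.
case: (leqP i p) => [ip|pi]; first by lia.
have inp : i != p.+1 by exact: (child_neq_root pj ij).
have /andP[i1 ir] := hi.
have := hpar i; rewrite ij => /(_ _) => hlt.
have : (j < i)%N by apply: hlt; rewrite ir andbT ltn_neqAle eq_sym inp.
by move=> ji; rewrite ltn_sub2l.
Qed.

Definition all_edges (_ : nat) := True.

(** At the root [z ~ kap y] contradicts [z = - h_0 y] unless [y = 0]. A zero value at the initial
    end of an edge forces a zero derivative there, hence the zero solution, and continuity hands the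
    zero on to the children. *)
Lemma homogeneous_zero : large (fun kap => forall Y Y', sol kap Y Y' ->
  (forall j, (j <= p)%N -> U0 p h Y Y' j = 0) ->
  forall j, (1 <= j <= r)%N -> forall x, 0 <= x <= 1 -> Y j x = 0 /\ Y' j x = 0).
Proof.
have [/andP[p0 pr] _ hint hpar _] := tree.
have q4 : 0 < 1 / 4 :> R by rewrite divr_gt0.
have dA : downset all_edges by [].
have hO : large (fun kap => forall j, (j < r.+1)%N -> (1 <= j)%N -> outgoing all_edges j (1 / 4) kap).
  apply: large_forall => j jr; have [j1|nj] := leqP 1 j; last by exists 0.
  by apply: large_imp (outgoing_all dA (j := j) _ I q4) => //; rewrite j1.
have hQ : large (fun kap => forall j, (j < r.+1)%N -> 4 * mass (q j) <= re kap).
  by apply: large_forall => j jr; exact: large_ge.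
have := large_and (large_and hO hQ) (large_and (large_ge 1) (large_ge (4 * nm (h 0%N)))).
apply: large_imp => kap [[{}hO {}hQ] [k1 kh]] Y Y' hs hb.
have s0 : 0 < re kap by lra.
have kk := re_le_nm kap.
have bA : bc_on all_edges Y Y' by move=> j /andP[_ jp] _; exact: hb.
have [hse hm] := hs.
have zero1 j : (1 <= j <= r)%N -> Y j 1 = 0 -> forall x, 0 <= x <= 1 -> Y j x = 0 /\ Y' j x = 0.
  move=> hj y1 x hx; have /andP[j1 jr] := hj.
  have := hO j jr j1 Y Y' hs bA; rewrite y1 nm0 !mulr0 subr0 => /nm_le0 y1'.
  apply: (zero_at1 (qi hj) (hse j hj)) => //.
  by apply: le_trans kk; exact: hQ.
have root : Y p.+1 1 = 0.
  have hp1 : (1 <= p.+1 <= r)%N by [].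
  have := hO p.+1 pr isT Y Y' hs bA.
  have := hb 0%N (leq0n p); rewrite /U0 /= => /eqP; rewrite addr_eq0 => /eqP ->.
  have -> : - (h 0%N * Y p.+1 1) - kap * Y p.+1 1 = - ((h 0%N + kap) * Y p.+1 1) by ring.
  rewrite nmN nmM => h1; apply: nm_le0.
  have h2 : nm kap - nm (h 0%N) <= nm (h 0%N + kap).
    by have := nm_tri kap (- h 0%N); rewrite nmN opprK [kap + _]addrC; lra.
  have h3 := nm_ge0 (Y p.+1 1); have h4 := ler_wpM2r h3 h2.
  rewrite leNgt; apply/negP => h5.
  have h6 : 0 < nm kap * nm (Y p.+1 1) by rewrite mulr_gt0 //; lra.
  have h7 : nm (h 0%N) * nm (Y p.+1 1) <= nm kap / 4 * nm (Y p.+1 1) by rewrite ler_pM2r //; lra.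
  lra.
(* Induction from the root outward; boundary edges, numbered first, receive the last rank [r.+1]. *)
move=> j; have [n] := ubnP (if (j <= p)%N then r.+1 else j).
elim: n j => // n IH j; rewrite ltnS => hn hj.
have [->|jp] := eqVneq j p.+1; first by apply: zero1.
apply: zero1 => //.
have hm' := hint j hj jp; have /andP[pm mr] := hm'.
rewrite (child_value hs hm' hj erefl).
have mj : (par j < if (j <= p)%N then r.+1 else j)%N.
  case: (leqP j p) => [_|pj]; first by rewrite ltnS.
  by apply: hpar; case/andP: hj => _ ->; rewrite andbT ltn_neqAle eq_sym jp.
have [|||-> _] := IH (par j) _ _ 0; rewrite ?lexx ?ler01 ?mul0r //.
  by rewrite (_ : (par j <= p)%N = false); [exact: leq_trans mj hn|lia].
by rewrite mr andbT; exact: leq_ltn_trans pm.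
Qed.

(** * The path from the boundary vertex [v_k] to the root *)

Section Path.
Variable k : nat.
Hypothesis hk : (1 <= k <= p)%N.

(** Edges are named by their end points, so the path is an orbit of [par]. The second clause stops
    it at the root edge, beyond which [par] carries no meaning. *)
Definition onpath j := exists n, iter n par k = j /\ forall i, (i < n)%N -> iter i par k != p.+1.
Definition offpath j := ~ onpath j.

Lemma onpath_self : onpath k.
Proof. by exists 0%N. Qed.

Lemma onpath_par j : onpath j -> j != p.+1 -> onpath (par j).
Proof.
move=> [n [<- hn]] jp; exists n.+1; split=> // i.
by rewrite ltnS leq_eqVlt => /predU1P[->//|]; exact: hn.
Qed.

Lemma onpath_range j : onpath j -> (1 <= j <= r)%N.
Proof.
have [/andP[p0 pr] _ hint hpar _] := tree.
move=> [n [<- ]]; elim: n => [|n IH] hn /=.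
  by case/andP: hk => -> kp; rewrite (leq_trans kp) // ltnW.
have := hint _ (IH (fun i hi => hn i (ltnW hi))) (hn n (ltnSn n)).
by move=> /andP[pm ->]; rewrite andbT (leq_ltn_trans _ pm).
Qed.

Lemma onpath_le j m n : (p < m)%N -> onpath j -> iter n par m = j ->
  (forall i, (i < n)%N -> onpath (iter i par m) /\ iter i par m != p.+1) -> (j <= m)%N.
Proof.
have [/andP[p0 pr] _ hint hpar _] := tree.
move=> pm _ <-; elim: n => [//|n IH] hn /=.
have {}IH := IH (fun i hi => hn i (ltnW hi)).
have [op np] := hn n (ltnSn n).
have := onpath_range op; set x := iter n par m in IH op np * => xr.
have px : (p < x)%N.
  case: n @x IH op np xr hn => [|n] x IH op np xr hn //.
  have [op' np'] := hn n (leqnSn _).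
  by have /andP[] := hint _ (onpath_range op') np'.
apply: leq_trans IH; apply: ltnW; apply: hpar.
by case/andP: xr => _ ->; rewrite andbT ltn_neqAle eq_sym np.
Qed.

(** Two path edges with the same initial vertex [m] would make the path return to [m], although
    [par] strictly lowers the index from internal vertices on. *)
Lemma onpath_unique i j m : (p < m)%N -> onpath i -> onpath j -> par i = m -> par j = m -> i = j.
Proof.
have [/andP[p0 pr] _ hint hpar _] := tree.
have key x y i' j' : (x < y)%N -> (p < m)%N -> iter x par k = i' -> iter y par k = j' ->
    (forall e, (e < y)%N -> iter e par k != p.+1) -> par i' = m -> par j' = m -> False.
  move=> xy pm ix jy hy pi pj.
  have op e : (e <= y)%N -> onpath (iter e par k).
    by move=> ey; exists e; split=> // d de; apply: hy; exact: leq_trans ey.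
  have mE : iter x.+1 par k = m by rewrite /= ix.
  have jE : iter (y - x.+1) par m = j' by rewrite -mE -iterD subnK.
  have jm : (j' <= m)%N.
    apply: (onpath_le pm _ jE); first by rewrite -jy; exact: op.
    move=> e he; rewrite -mE -iterD; split; first by apply: op; lia.
    by apply: hy; lia.
  have jr : (1 <= j' <= r)%N by rewrite -jy; apply: onpath_range; exact: op.
  have jp : j' != p.+1 by exact: (child_neq_root pm pj).
  (* Here [y > x] makes [j'] itself a parent, hence internal; the first case is empty. *)
  have [j'p|pj'] := leqP j' p.
    case: y xy jy hy op jE {pj} => // y xy jy hy op jE.
    have /andP[+ _] := hint _ (onpath_range (op y (leqnSn y))) (hy y (ltnSn y)).
    by move: jy => /= ->; rewrite ltnNge j'p.
  have : (par j' < j')%N.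
    by apply: hpar; case/andP: jr => _ ->; rewrite andbT ltn_neqAle eq_sym jp.
  by rewrite pj ltnNge jm.
move=> pm [x [ix hx]] [y [jy hy]] pi pj.
have [xy|yx|xy] := ltngtP x y.
- by case: (key x y i j).
- by case: (key y x j i).
- by rewrite -ix -jy xy.
Qed.

Lemma downset_offpath : downset offpath.
Proof.
move=> i j hi /andP[pj _] ij nj oi; apply: nj; rewrite -ij; apply: onpath_par => //.
exact: (child_neq_root pj ij).
Qed.

(** The condition at [v_k] is left out: the Weyl solution is driven from there, so on the path [v]
    must dominate. *)
Definition incoming (K : R) j kap := forall Y Y', sol kap Y Y' ->
  (forall i, (i <= p)%N -> i != k -> U0 p h Y Y' i = 0) ->
  nm (uu kap (Y j) (Y' j) 1) <= K * nm (vv kap (Y j) (Y' j) 1).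

(** The root condition makes [u] and [v] equal to [(kap - h_0) y] and [- (kap + h_0) y], whose ratio
    is at most 2 once [4 |h_0| <= |kap|]. *)
Lemma incoming_root : large (incoming 2 p.+1).
Proof.
have := large_and (large_ge 1) (large_ge (4 * nm (h 0%N))).
apply: large_imp => kap [k1 kh] Y Y' hs hb.
have k0 : 0%N != k by case/andP: hk => k1' _; rewrite eq_sym -lt0n.
have := hb 0%N (leq0n p) k0; rewrite /U0 /= => /eqP; rewrite addr_eq0 => /eqP z1.
rewrite /uu /vv z1.
have -> : - (h 0%N * Y p.+1 1) + kap * Y p.+1 1 = (kap - h 0%N) * Y p.+1 1 by ring.
have -> : - (h 0%N * Y p.+1 1) - kap * Y p.+1 1 = - ((kap + h 0%N) * Y p.+1 1) by ring.
rewrite nmN !nmM mulrA ler_wpM2r ?nm_ge0 //.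
have h1 := nmB kap (h 0%N); have h2 := nm_tri kap (- h 0%N).
rewrite nmN opprK in h2; have := re_le_nm kap; lra.
Qed.

(** On the parent edge [z ~ - kap y] at the vertex, on the siblings off the path [z ~ kap y].
    Solving [kirchhoff] for the one remaining child gives [a1 v ~ - (S + 1) kap y], so regularity
    bounds [|v|] below by a multiple of [|kap y|]. *)
Lemma incoming_child j K : (1 <= j <= r)%N -> j != p.+1 -> onpath j -> 1 <= K ->
  large (incoming K (par j)) -> exists2 K', 1 <= K' & large (incoming K' j).
Proof.
have [/andP[p0 pr] _ hint hpar _] := tree.
move=> hj jp oj K1 hin; set m := par j in hin.
have hm : (p < m <= r)%N by exact: hint.
have hmr : (1 <= m <= r)%N by case/andP: hm => pm ->; rewrite (leq_ltn_trans _ pm).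
have /andP[pm _] := hm.
have [a_j a1_j] := child_coef pm hj (erefl m).
have an : 0 < nm (a j) by rewrite nm_gt0.
have a1n : 0 < nm (a1 j) by rewrite nm_gt0.
have [_ /(_ m hm) S1] := coeffs; rewrite -/(transmission m) in S1.
pose d := nm (transmission m + 1).
have d0 : 0 < d by rewrite nm_gt0 addr_eq0.
have l1 := load_ge0 a1 m; have l0 := load_ge0 a0 m.
have l10 : 0 < 1 + load a1 m by lra.
pose e := d / (8 * (1 + load a1 m)).
have e0 : 0 < e by rewrite divr_gt0 // mulr_gt0.
have d8 : 0 < d / 8 by rewrite divr_gt0.
have hI : large (fun kap => forall i, (i < r.+1)%N -> (1 <= i)%N -> par i = m -> i != j -> outgoing offpath i e kap).
  apply: large_forall => i ir.
  have [[i1 im ij]|] := pselect [/\ (1 <= i)%N, par i = m & i != j].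
    have oi : offpath i by move=> oi; move/eqP: ij; apply; exact: (onpath_unique pm).
    have hi : (1 <= i <= r)%N by rewrite i1.
    by have := outgoing_all downset_offpath hi oi e0; apply: large_imp.
  by move=> hn; exists 0 => kap _ i1 im ij; case: hn.
have hB := backward_ratio (qi hmr) K1 d8.
pose c := d * nm (a j) / (2 * nm (a1 j)).
have c0 : 0 < c by rewrite divr_gt0 // mulr_gt0.
exists (1 + 2 / c); first by rewrite lerDl divr_ge0 // ltW.
have := large_and (large_and hB hI) (large_and hin (large_ge (8 * load a0 m / d))).
apply: large_imp => kap [[{}hB {}hI] [{}hin]]; rewrite ler_pdivrMr // => hkap Y Y' hs hb.
have [hse _] := hs.
have hb' : bc_on offpath Y Y'.
  move=> i /andP[_ ip] oi; apply: hb => //; apply/eqP => ik; apply: oi; rewrite ik; exact: onpath_self.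
have hm0 := hB _ _ (hse m hmr) (hin Y Y' hs hb).
set y0 := nm (Y m 0) in hm0; set x := nm kap in hm0.
have y00 : 0 <= y0 by exact: nm_ge0.
have x0 : 0 <= x by exact: nm_ge0.
have kk := re_le_nm kap; rewrite -/x in kk.
have nY : nm (Y j 1) = y0 / nm (a j) by rewrite (child_value hs hm hj erefl) nmM nmV.
have kir := kirchhoff hs hm.
(* All error terms of the vertex: everything on the siblings, and only the [a0] term on [j], whose
   [a1] term is the unknown. *)
set T := \sum_(1 <= i < r.+1 | par i == m) (if i == j then a0 i * Y i 1 else a1 i * (Y' i 1 - kap * Y i 1) + a0 i * Y i 1).
have hT : nm T <= d / 4 * x * y0.
  apply: le_trans (nm_sum (G := fun i => (e * x * y0) * (nm (a1 i) / nm (a i)) + y0 * (nm (a0 i) / nm (a i))) _) _.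
    move=> i; rewrite mem_index_iota => hi /eqP im.
    have /andP[i1 ir] := hi.
    have [a_i _] := child_coef pm hi im.
    have ain : 0 < nm (a i) by rewrite nm_gt0.
    have yv := child_value hs hm hi im.
    have nv : nm (Y i 1) = y0 / nm (a i) by rewrite yv nmM nmV.
    have ta : nm (a0 i * Y i 1) = y0 * (nm (a0 i) / nm (a i)) by rewrite nmM nv; ring.
    have [_|nij] := eqVneq i j.
      rewrite ta lerDr; apply: mulr_ge0; last by rewrite divr_ge0 ?nm_ge0.
      by apply: mulr_ge0 => //; apply: mulr_ge0 => //; exact: ltW.
    have := hI i ir i1 im nij Y Y' hs hb'; rewrite nv -/x => ho.
    apply: le_trans (nmD _ _) _; rewrite ta lerD2r nmM.
    apply: le_trans (ler_wpM2l (nm_ge0 _) ho) _; rewrite le_eqVlt; apply/orP; left; apply/eqP; ring.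
  rewrite big_split /= -!mulr_sumr -/(load a1 m) -/(load a0 m).
  have h1 : e * load a1 m <= d / 8.
    have -> : d / 8 = e * (1 + load a1 m) by rewrite /e; field; rewrite lt0r_neq0.
    by rewrite ler_pM2l //; lra.
  have h2 : load a0 m <= d / 8 * x by have := ler_wpM2r (ltW d0) kk; lra.
  have h3 := ler_wpM2r (mulr_ge0 x0 y00) h1; have h4 := ler_wpM2r y00 h2.
  lra.
have vE : a1 j * vv kap (Y j) (Y' j) 1 = (Y' m 0 + kap * Y m 0) - (transmission m + 1) * (kap * Y m 0) - T.
  have hjm : j \in index_iota 1 r.+1 by rewrite mem_index_iota.
  have -> : (Y' m 0 + kap * Y m 0) - (transmission m + 1) * (kap * Y m 0) = Y' m 0 - transmission m * kap * Y m 0 by ring.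
  rewrite kir /T -sumrB big_mkcond (bigD1_seq j) ?iota_uniq //= big1 ?addr0.
    by rewrite !eqxx /vv; ring.
  by move=> i /negbTE ->; rewrite subrr if_same.
(* The errors [d / 8] and [d / 4] together stay below [d / 2], so half of the main term survives;
   this fixes [c]. *)
have hv : c * (x * nm (Y j 1)) <= nm (vv kap (Y j) (Y' j) 1).
  rewrite -(ler_pM2l a1n) -[leRHS]nmM vE.
  have h1 := nm_tri ((transmission m + 1) * (kap * Y m 0)) (- ((Y' m 0 + kap * Y m 0) - (transmission m + 1) * (kap * Y m 0) - T)).
  rewrite nmN in h1.
  have h2 : nm ((transmission m + 1) * (kap * Y m 0) - - ((Y' m 0 + kap * Y m 0) - (transmission m + 1) * (kap * Y m 0) - T)) <= d / 8 * x * y0 + d / 4 * x * y0.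
    have -> : (transmission m + 1) * (kap * Y m 0) - - ((Y' m 0 + kap * Y m 0) - (transmission m + 1) * (kap * Y m 0) - T) = (Y' m 0 + kap * Y m 0) - T by ring.
    by apply: le_trans (nmB _ _) _; exact: lerD.
  rewrite !nmM -/d -/x -/y0 in h1.
  have -> : nm (a1 j) * (c * (x * nm (Y j 1))) = d / 2 * (x * y0).
    by rewrite nY /c; field; rewrite !lt0r_neq0.
  have := mulr_ge0 (mulr_ge0 (ltW d0) x0) y00; lra.
have -> : uu kap (Y j) (Y' j) 1 = vv kap (Y j) (Y' j) 1 + 2 * kap * Y j 1 by rewrite /uu /vv; ring.
apply: le_trans (nmD _ _) _; rewrite [leRHS]mulrDl mul1r lerD2l !nmM nm_nat -/x.
have -> : 2 * x * nm (Y j 1) = 2 / c * (c * (x * nm (Y j 1))) by field; rewrite lt0r_neq0.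
by rewrite ler_wpM2l // divr_ge0 // ltW.
Qed.

Lemma incoming_target : exists2 K, 1 <= K & large (incoming K k).
Proof.
have [/andP[p0 pr] _ hint hpar _] := tree.
suff : forall j, onpath j -> exists2 K, 1 <= K & large (incoming K j) by apply; exact: onpath_self.
(* Descent from the root along the path, with the same ranking as in [homogeneous_zero]. *)
move=> j; have [n] := ubnP (if (j <= p)%N then r.+1 else j).
elim: n j => // n IH j; rewrite ltnS => hn oj.
have hj := onpath_range oj.
have [->|jp] := eqVneq j p.+1.
  by exists 2; [lra|exact: incoming_root].
have /andP[pm mr] := hint j hj jp.
have mj : (par j < if (j <= p)%N then r.+1 else j)%N.
  case: (leqP j p) => [_|pj]; first by rewrite ltnS.
  by apply: hpar; case/andP: hj => _ ->; rewrite andbT ltn_neqAle eq_sym jp.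
have [||K K1 hin] := IH (par j).
- by rewrite (_ : (par j <= p)%N = false); [exact: leq_trans mj hn|lia].
- exact: onpath_par.
exact: (incoming_child hj jp oj K1 hin).
Qed.

End Path.
End Tree.

(** * Existence of Weyl solutions *)

Lemma linear_inj_surj (F : fieldType) n (f : 'rV[F]_n -> 'rV[F]_n) :
  (forall (c : F) u v, f (c *: u + v) = c *: f u + f v) ->
  (forall u, f u = 0 -> u = 0) -> forall w, exists u, f u = w.
Proof.
move=> flin finj w.
pose g : {linear 'rV[F]_n -> 'rV[F]_n} := HB.pack f (GRing.isLinear.Build F _ _ _ f flin).
have gE u : u *m lin1_mx g = f u by rewrite mul_rV_lin1.
have rf : row_free (lin1_mx g) by apply: inj_row_free => v; rewrite gE; exact: finj.
exists (w *m invmx (lin1_mx g)); rewrite -gE mulmxKV //.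
by rewrite -row_free_unit.
Qed.

Section WeylExistence.
Variable R : realType.
Local Notation C := R[i].
Variables (r p : nat) (par : nat -> nat) (a a1 a0 : nat -> C).
Variables (q : nat -> R -> C) (h : nat -> C).
Hypothesis tree : tree_ok r p par.
Hypothesis coeffs : coeffs_ok r p par a a1.
Hypothesis qi : forall j, (1 <= j <= r)%N -> cintegrable (q j).

(** There are as many scalar conditions as unknown edge data, so uniqueness for the homogeneous
    problem gives solvability by linear algebra. *)
Lemma weyl_sol_exists lam k : (1 <= k <= p)%N ->
  (forall Y Y', tree_sol r p par a a1 a0 q lam Y Y' ->
    (forall j, (j <= p)%N -> U0 p h Y Y' j = 0) ->
    forall j, (1 <= j <= r)%N -> forall x, 0 <= x <= 1 -> Y j x = 0 /\ Y' j x = 0) ->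
  exists Y Y', weyl_sol r p par a a1 a0 q h k lam Y Y'.
Proof.
move=> hk unique; have [/andP[p0 pr] _ hint _ _] := tree.
have pick (al be : C) : forall j, exists yz : (R -> C) * (R -> C),
    (1 <= j <= r)%N -> [/\ edge_sol (q j) lam yz.1 yz.2, yz.1 0 = al & yz.2 0 = be].
  move=> j; have [hj|nj] := boolP (1 <= j <= r)%N; last by exists ((fun=> 0), (fun=> 0)).
  by have [y [z [h1 h2 h3 _]]] := picard lam al be (qi hj); exists (y, z).
have [cc hcc] := choice (pick 1 0); have [ss hss] := choice (pick 0 1).
pose n := r.+1.
(* Two coefficients per index [0..r]. Index 0 names no edge; it keeps the numbering intact and is
   killed by the first equation of [ra] and of [rb]. *)
pose al (X : 'rV[C]_(n + n)) j := X 0 (lshift n (inord j)).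
pose be (X : 'rV[C]_(n + n)) j := X 0 (rshift n (inord j)).
pose Y X j x := al X j * (cc j).1 x + be X j * (ss j).1 x.
pose Y' X j x := al X j * (cc j).2 x + be X j * (ss j).2 x.
(* Each edge other than the root edge has one continuity equation, which frees slot [p.+1] for the
   root condition; [rb] has one condition per boundary or internal vertex. *)
pose ra X (i : 'I_n) := if i == 0%N :> nat then al X 0 else if i == p.+1 :> nat then U0 p h (Y X) (Y' X) 0
  else Y X (par i) 0 - a i * Y X i 1.
pose rb X (i : 'I_n) := if i == 0%N :> nat then be X 0 else if (i <= p)%N then U0 p h (Y X) (Y' X) i
  else Y' X i 0 - \sum_(1 <= j < r.+1 | par j == i) (a1 j * Y' X j 1 + a0 j * Y X j 1).
pose f X := row_mx (\row_i ra X i) (\row_i rb X i).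
have Ylin c u v j x : Y (c *: u + v) j x = c * Y u j x + Y v j x by rewrite /Y /al /be !mxE; ring.
have Y'lin c u v j x : Y' (c *: u + v) j x = c * Y' u j x + Y' v j x by rewrite /Y' /al /be !mxE; ring.
have Ulin c u v j : U0 p h (Y (c *: u + v)) (Y' (c *: u + v)) j = c * U0 p h (Y u) (Y' u) j + U0 p h (Y v) (Y' v) j.
  by rewrite /U0; case: ifP => _; rewrite Ylin Y'lin; ring.
have flin c u v : f (c *: u + v) = c *: f u + f v.
  rewrite /f scale_row_mx add_row_mx; congr row_mx; apply/rowP => i; rewrite !mxE.
    rewrite /ra; case: ifP => _; first by rewrite /al !mxE.
    by case: ifP => _; rewrite ?Ulin // !Ylin; ring.
  rewrite /rb; case: ifP => _; first by rewrite /be !mxE.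
  case: ifP => _; rewrite ?Ulin // !Y'lin.
  under eq_bigr do rewrite Ylin Y'lin.
  have -> : \sum_(1 <= j < r.+1 | par j == i) (a1 j * (c * Y' u j 1 + Y' v j 1) + a0 j * (c * Y u j 1 + Y v j 1)) =
     c * \sum_(1 <= j < r.+1 | par j == i) (a1 j * Y' u j 1 + a0 j * Y u j 1)
     + \sum_(1 <= j < r.+1 | par j == i) (a1 j * Y' v j 1 + a0 j * Y v j 1).
    by rewrite mulr_sumr -big_split /=; apply: eq_bigr => j _; ring.
  by ring.
have tsol X : (forall i : 'I_n, (0 < i)%N -> i != p.+1 :> nat -> ra X i = 0) ->
    (forall i : 'I_n, (p < i)%N -> rb X i = 0) -> tree_sol r p par a a1 a0 q lam (Y X) (Y' X).
  move=> hra hrb; split.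
    move=> j hj; have [h1 _ _] := hcc j hj; have [h2 _ _] := hss j hj.
    exact: edge_sol_lin.
  move=> m hm; have /andP[pm mr] := hm; split.
    move=> j hj jm; have /andP[j1 jr] := hj.
    have jp := child_neq_root tree pm jm.
    have jn : (j < n)%N by rewrite ltnS.
    have := hra (Ordinal jn) j1 jp; rewrite /ra /= ifN -?lt0n // ifN // jm => /eqP.
    by rewrite subr_eq0 => /eqP.
  have mn : (m < n)%N by rewrite ltnS.
  have m0 : m != 0%N by rewrite -lt0n (leq_ltn_trans _ pm).
  have := hrb (Ordinal mn) pm; rewrite /rb /= ifN // ifN -?ltnNge // => /eqP.
  by rewrite subr_eq0 => /eqP.
have finj X : f X = 0 -> X = 0.
  move=> fX0.
  have hra i : ra X i = 0.
    by have := congr1 (fun M : 'rV_(n + n) => M 0 (lshift n i)) fX0; rewrite /f row_mxEl !mxE.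
  have hrb i : rb X i = 0.
    by have := congr1 (fun M : 'rV_(n + n) => M 0 (rshift n i)) fX0; rewrite /f row_mxEr !mxE.
  have ts := tsol X (fun i _ _ => hra i) (fun i _ => hrb i).
  have ub j : (j <= p)%N -> U0 p h (Y X) (Y' X) j = 0.
    case: j => [_|j jp].
      have pn : (p.+1 < n)%N by rewrite ltnS.
      by have := hra (Ordinal pn); rewrite /ra /= eqxx.
    have jn : (j.+1 < n)%N by rewrite ltnS (leq_trans jp) // ltnW.
    by have := hrb (Ordinal jn); rewrite /rb /= jp.
  have z := unique _ _ ts ub.
  have x01 : 0 <= (0 : R) <= 1 by rewrite lexx ler01.
  have al0 (i : 'I_n) : al X i = 0.
    have [i0|i0] := eqVneq (i : nat) 0%N.
      by have := hra i; rewrite /ra i0 /=.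
    have hi : (1 <= i <= r)%N by rewrite lt0n i0 -ltnS ltn_ord.
    have [+ _] := z i hi 0 x01; have [_ h1 _] := hcc i hi; have [_ h2 _] := hss i hi.
    by rewrite /Y h1 h2 mulr1 mulr0 addr0.
  have be0 (i : 'I_n) : be X i = 0.
    have [i0|i0] := eqVneq (i : nat) 0%N.
      by have := hrb i; rewrite /rb i0 /=.
    have hi : (1 <= i <= r)%N by rewrite lt0n i0 -ltnS ltn_ord.
    have [_ +] := z i hi 0 x01; have [_ _ h1] := hcc i hi; have [_ _ h2] := hss i hi.
    by rewrite /Y' h1 h2 mulr1 mulr0 add0r.
  apply/rowP => i; rewrite mxE; case: (split_ordP i) => j ->.
    by rewrite -(al0 j) /al inord_val.
  by rewrite -(be0 j) /be inord_val.
have /andP[k1 kp] := hk.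
have kn : (k < n)%N by rewrite ltnS (leq_trans kp) // ltnW.
have [X hX] := linear_inj_surj flin finj (row_mx 0 (delta_mx 0 (Ordinal kn))).
have hra i : ra X i = 0.
  by have := congr1 (fun M : 'rV_(n + n) => M 0 (lshift n i)) hX; rewrite /f !row_mxEl !mxE.
have hrb i : rb X i = (i == k :> nat)%:R.
  have := congr1 (fun M : 'rV_(n + n) => M 0 (rshift n i)) hX; rewrite /f !row_mxEr !mxE /=.
  by move=> ->.
exists (Y X), (Y' X); split.
  apply: tsol => // i ip; rewrite hrb (_ : (i == k :> nat) = false) //; apply/negbTE; lia.
move=> j jp; case: j jp => [_|j jp].
  have pn : (p.+1 < n)%N by rewrite ltnS.
  have := hra (Ordinal pn); rewrite /ra /= eqxx => ->.
  by rewrite ifN // eq_sym -lt0n.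
have jn : (j.+1 < n)%N by rewrite ltnS (leq_trans jp) // ltnW.
by have := hrb (Ordinal jn); rewrite /rb /= jp => ->; case: eqP.
Qed.

End WeylExistence.

(** * Uniqueness *)

Section Decay.
Variable R : realType.
Local Notation C := R[i].
Local Notation re := (@complex.Re R).
Implicit Types (q y z : R -> C) (kap : C).

(** The initial components are at most [2 |kap|], so [forward_bound] gives [4 |kap| exp (s t)] and
    [nm_y] divides by [|kap|]. *)
Lemma regular_growth q (hh : C) kap y z : cintegrable q -> edge_sol q (- kap ^+ 2) y z ->
  y 0 = 1 -> z 0 = - hh -> 0 < re kap -> 4 * mass q <= nm kap -> nm hh <= nm kap ->
  forall t : R, 0 <= t <= 1 -> nm (y t) <= 4 * expR (re kap * t).
Proof.
move=> qi yz y0 z0 s0 kQ hk t ht.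
have k0 : 0 < nm kap by apply: lt_le_trans (re_le_nm kap).
have kn0 : kap != 0 by rewrite -nm_gt0.
have [||hb _ _] := @forward_bound R q kap y z qi yz s0 kQ (2 * nm kap).
- rewrite /uu y0 z0 mulr1; apply: le_trans (nmD _ _) _; rewrite nmN; lra.
- rewrite /vv y0 z0 mulr1; apply: le_trans (nmB _ _) _; rewrite nmN; lra.
have [h1 h2] := hb t ht.
have h3 := nm_y y z t kn0.
rewrite -(ler_pM2r (x := 2 * nm kap)) ?mulr_gt0 //.
apply: le_trans h3 _; lra.
Qed.

(** The backward cone bounds [y] by its decaying part at 0, and the normalisation at [v_k] bounds
    that part by 7, whence [28 = 4 * 7]. *)
Lemma weyl_decay q (hh : C) kap y z (K : R) : cintegrable q -> edge_sol q (- kap ^+ 2) y z ->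
  z 0 + hh * y 0 = 1 -> 1 <= K -> nm (uu kap y z 1) <= K * nm (vv kap y z 1) ->
  2 * K * (1 + 4 * mass q) <= 1 / 2 * re kap -> 8 * nm hh <= nm kap ->
  forall t : R, 0 <= t <= 1 -> nm (y t) <= 28 * K * expR (- (re kap * t)) / nm kap.
Proof.
move=> qi yz bc K1 hK hl hk t ht.
have e0 : 0 < 1 / 2 :> R by rewrite divr_gt0.
have e1 : 1 / 2 <= 1 :> R by lra.
have [hu hy] := @backward_cone R q kap y z K (1 / 2) qi yz K1 e0 e1 hl hK.
have k0 : 0 < nm kap.
  apply: lt_le_trans (re_le_nm kap).
  have h1 : 0 < 2 * K * (1 + 4 * mass q).
    by rewrite !mulr_gt0 //; [lra|have := mass_ge0 q; lra].
  lra.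
have kn0 : kap != 0 by rewrite -nm_gt0.
(* With [|u| <= |v| / 2] and [|hh / kap| <= 1 / 8] the identity [e] gives
   [|v| <= 2 + (11 / 16) |v|]. *)
have v7 : nm (vv kap y z 0) <= 7.
  set u := uu kap y z 0 in hu *; set v := vv kap y z 0 in hu *.
  have e : 2 = u + v + hh / kap * (u - v).
    transitivity (2 * (z 0 + hh * y 0)); first by rewrite bc mulr1.
    by rewrite /u /v /uu /vv; field.
  have h1 : v = 2 - u - hh / kap * (u - v) by rewrite {1}e; ring.
  have h2 : nm v <= 2 + nm u + nm (hh / kap) * (nm u + nm v).
    rewrite {1}h1; apply: le_trans (nmB _ _) _; apply: lerD.
      by apply: le_trans (nmB _ _) _; rewrite nm_nat.
    by rewrite nmM ler_wpM2l ?nm_ge0 //; exact: nmB.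
  have h3 : nm (hh / kap) <= 1 / 8 by rewrite nmM nmV ler_pdivrMr //; lra.
  have h4 : 0 <= nm u + nm v by rewrite addr_ge0 ?nm_ge0.
  have h5 := ler_wpM2r h4 h3; have := nm_ge0 v; lra.
apply: le_trans (hy t ht) _; rewrite ler_wpM2r ?invr_ge0 ?nm_ge0 // ler_wpM2r ?expR_ge0 //.
have -> : 28 * K = 4 * K * 7 by ring.
by rewrite ler_wpM2l // mulr_ge0 //; lra.
Qed.

(** The root is [s (1 - i)] or [s (1 + i)] with [s ^ 2 = |t| / 2]; its real part is comparable with
    its modulus. *)
Lemma imaginary_parameter (t s0 : R) : 0 <= s0 -> 2 * s0 ^+ 2 <= `|t| ->
  exists kap, [/\ s0 <= re kap, - kap ^+ 2 = (0 +i* t)%C & nm kap ^+ 2 = `|t|].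
Proof.
move=> s00 ht; pose s := Num.sqrt (`|t| / 2).
have s2 : s ^+ 2 = `|t| / 2 by rewrite sqr_sqrtr // divr_ge0.
pose b : R := if 0 <= t then - s else s.
have b2 : b ^+ 2 = s ^+ 2 by rewrite /b; case: ifP => _; rewrite ?sqrrN.
have sb : 2 * (s * b) = - t.
  rewrite /b; case: ifP => [t0|/negbT]; last rewrite -ltNge => t0.
    by rewrite mulrN -expr2 s2 ger0_norm //; field.
  by rewrite -expr2 s2 ltr0_norm //; field.
exists (s +i* b)%C; split.
- have h1 : s0 ^+ 2 <= s ^+ 2 by rewrite s2; lra.
  by move: h1; rewrite ler_pXn2r // nnegrE ?sqrtr_ge0.
- rewrite expr2; apply: complex_ext; rewrite ?cReN ?cImN ?cReM ?cImM /=.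
    by rewrite -!expr2 b2 subrr oppr0.
  by rewrite [b * s]mulrC; lra.
- rewrite /nm /= sqr_sqrtr; last by rewrite addr_ge0 ?sqr_ge0.
  by rewrite b2 s2; field.
Qed.

End Decay.

Section Main.
Variable R : realType.
Local Notation C := R[i].
Local Notation re := (@complex.Re R).
Variables (r p : nat) (par : nat -> nat) (a a1 a0 : nat -> C).
Variables (q qt : nat -> R -> C) (h ht : nat -> C) (k : nat).
Hypothesis tree : tree_ok r p par.
Hypothesis coeffs : coeffs_ok r p par a a1.
Hypothesis qi : forall j, (1 <= j <= r)%N -> cintegrable (q j).
Hypothesis qti : forall j, (1 <= j <= r)%N -> cintegrable (qt j).
Hypothesis hk : (1 <= k <= p)%N.

Lemma weyl_eventually (q' : nat -> R -> C) h' : (forall j, (1 <= j <= r)%N -> cintegrable (q' j)) ->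
  exists2 K, 1 <= K & large (fun kap =>
    regular_pt r p par a a1 a0 q' h' (- kap ^+ 2) /\
    exists Y Y', weyl_sol r p par a a1 a0 q' h' k (- kap ^+ 2) Y Y' /\
      nm (uu kap (Y k) (Y' k) 1) <= K * nm (vv kap (Y k) (Y' k) 1)).
Proof.
move=> q'i.
have [K K1 hin] := incoming_target a0 h' tree coeffs q'i hk.
exists K => //.
have := large_and (homogeneous_zero a0 h' tree coeffs q'i) hin.
apply: large_imp => kap [hz {}hin]; split.
  move=> Y Y' ts hb j hj x hx; have [] := hz Y Y' ts hb j hj x hx; exact.
have [Y [Y' hw]] := weyl_sol_exists tree q'i hk hz.
exists Y, Y'; split=> //; apply: hin; first by have [] := hw.
move=> i ip ik; have [_ ->] := hw => //; by rewrite (negbTE ik).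
Qed.

Let kr : (1 <= k <= r)%N.
Proof.
by have [/andP[_ pr] _ _ _ _] := tree; case/andP: hk => -> kp; rewrite (leq_trans kp) // ltnW.
Qed.

Hypothesis same_weyl : forall lam m mt : C,
  weyl_value r p par a a1 a0 q h k lam m ->
  weyl_value r p par a a1 a0 qt ht k lam mt -> m = mt.

Lemma cross_decay : exists c0 s0 : R, [/\ 0 <= s0 & forall kap, s0 <= re kap ->
  forall y1 z1 y2 z2 y3 z3 y4 z4,
  edge_sol (q k) (- kap ^+ 2) y1 z1 -> y1 0 = 1 -> z1 0 = - h k ->
  edge_sol (q k) (- kap ^+ 2) y2 z2 -> y2 0 = 0 -> z2 0 = 1 ->
  edge_sol (qt k) (- kap ^+ 2) y3 z3 -> y3 0 = 1 -> z3 0 = - ht k ->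
  edge_sol (qt k) (- kap ^+ 2) y4 z4 -> y4 0 = 0 -> z4 0 = 1 ->
  forall x, 0 <= x <= 1 -> nm kap ^+ 2 * nm (y2 x * y3 x - y1 x * y4 x) ^+ 2 <= c0].
Proof.
have [K K1 [s1 hs1]] := weyl_eventually h qi.
have [Kt Kt1 [s2 hs2]] := weyl_eventually ht qti.
pose m1 := 4 * K * (1 + 4 * mass (q k)).
pose m2 := 4 * Kt * (1 + 4 * mass (qt k)).
have Q1 := mass_ge0 (q k); have Q2 := mass_ge0 (qt k).
have m10 : 0 <= m1 by rewrite !mulr_ge0 //; lra.
have m20 : 0 <= m2 by rewrite !mulr_ge0 //; lra.
(* One threshold above all those needed: [s1] and [s2] for the Weyl solutions, [m1] and [m2] for
   [weyl_decay], the rest for [regular_growth] and for uniqueness on the edge. *)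
pose s0 := 1 + `|s1| + `|s2| + m1 + m2 + 8 * nm (h k) + 8 * nm (ht k) + 4 * mass (q k) + 4 * mass (qt k).
have n1 := nm_ge0 (h k); have n2 := nm_ge0 (ht k).
have as1 := ler_norm s1; have as2 := ler_norm s2.
have as10 := normr_ge0 s1; have as20 := normr_ge0 s2.
(* [112 = 28 * 4] from [weyl_decay] and [regular_growth]; the exponentials cancel. *)
exists ((112 * (K + Kt)) ^+ 2), s0; split; first by rewrite /s0; lra.
move=> kap hkap y1 z1 y2 z2 y3 z3 y4 z4 e1 y10 z10 e2 y20 z20 e3 y30 z30 e4 y40 z40 x hx.
have kk := re_le_nm kap.
rewrite /s0 in hkap.
have s0' : 0 < re kap by lra.
have k0 : 0 < nm kap by lra.
have [reg1 [Y [Y' [hw hc]]]] := hs1 kap (ltac:(lra)).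
have [reg2 [T [T' [hwt hct]]]] := hs2 kap (ltac:(lra)).
have mE : Y k 0 = T k 0.
  apply: (same_weyl (lam := - kap ^+ 2)); first by split=> //; exists Y, Y'.
  by split=> //; exists T, T'.
have kp : (k <= p)%N by case/andP: hk.
have kn0 : (k == 0%N) = false by case/andP: hk => k1 _; apply/negbTE; rewrite -lt0n.
have bc : Y' k 0 + h k * Y k 0 = 1.
  by have [_ /(_ k kp)] := hw; rewrite /U0 kn0 eqxx.
have bct : T' k 0 + ht k * T k 0 = 1.
  by have [_ /(_ k kp)] := hwt; rewrite /U0 kn0 eqxx.
have eY : edge_sol (q k) (- kap ^+ 2) (Y k) (Y' k) by have [[+ _] _] := hw; exact.
have eT : edge_sol (qt k) (- kap ^+ 2) (T k) (T' k) by have [[+ _] _] := hwt; exact.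
(* the Weyl solution is [y2 + m y1], with the same [m] for both problems *)
have Yx : Y k x = y2 x + Y k 0 * y1 x.
  have e := edge_sol_lin 1 (-1) eY (edge_sol_lin 1 (Y k 0) e2 e1).
  have [|||+ _] := zero_at0 (qi kr) e s0' _ _ _ hx; rewrite ?y20 ?y10 ?z20 ?z10.
  - lra.
  - ring.
  - by transitivity ((Y' k 0 + h k * Y k 0) - 1); [ring|rewrite bc subrr].
  by move=> e0; rewrite -[LHS]subr0 -e0; ring.
have Tx : T k x = y4 x + T k 0 * y3 x.
  have e := edge_sol_lin 1 (-1) eT (edge_sol_lin 1 (T k 0) e4 e3).
  have [|||+ _] := zero_at0 (qti kr) e s0' _ _ _ hx; rewrite ?y40 ?y30 ?z40 ?z30.
  - lra.
  - ring.
  - by transitivity ((T' k 0 + ht k * T k 0) - 1); [ring|rewrite bct subrr].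
  by move=> e0; rewrite -[LHS]subr0 -e0; ring.
have -> : y2 x * y3 x - y1 x * y4 x = Y k x * y3 x - y1 x * T k x by rewrite Yx Tx mE; ring.
have b1 := regular_growth (qi kr) e1 y10 z10 s0' (ltac:(lra)) (ltac:(lra)) hx.
have b3 := regular_growth (qti kr) e3 y30 z30 s0' (ltac:(lra)) (ltac:(lra)) hx.
have bY := weyl_decay (qi kr) eY bc K1 hc (ltac:(rewrite /m1 in hkap m10; lra)) (ltac:(lra)) hx.
have bT := weyl_decay (qti kr) eT bct Kt1 hct (ltac:(rewrite /m2 in hkap m20; lra)) (ltac:(lra)) hx.
set E := expR (re kap * x) in b1 b3; set F := expR (- (re kap * x)) in bY bT.
have EF : E * F = 1 by rewrite -expRD subrr expR0.
have E0 : 0 <= E by exact: expR_ge0.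
have F0 : 0 <= F by exact: expR_ge0.
rewrite -exprMn; apply: lerXn2r; rewrite ?nnegrE ?mulr_ge0 ?nm_ge0 //; try lra.
apply: le_trans (ler_wpM2l (ltW k0) (nmB _ _)) _; rewrite !nmM.
have p1 := ler_pM (nm_ge0 _) (nm_ge0 _) bY b3.
have p2 := ler_pM (nm_ge0 _) (nm_ge0 _) b1 bT.
apply: le_trans (ler_wpM2l (ltW k0) (lerD p1 p2)) _.
rewrite le_eqVlt; apply/orP; left; apply/eqP.
have -> : nm kap * (28 * K * F / nm kap * (4 * E) + 4 * E * (28 * Kt * F / nm kap)) = 112 * (K + Kt) * (E * F).
  by field; rewrite lt0r_neq0.
by rewrite EF mulr1.
Qed.

Lemma solution_family (Q : R -> C) (al be : C) : cintegrable Q ->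
  exists F : C -> (R -> C) * (R -> C), forall lam,
    [/\ edge_sol Q lam (F lam).1 (F lam).2, (F lam).1 0 = al, (F lam).2 0 = be &
      forall n N : nat, (0 < n)%N -> nm lam <= n%:R ^+ 2 -> forall x : R, 0 <= x <= 1 ->
        nm ((F lam).1 x) <= 4 * pic_size Q al be n%:R /\
        nm ((F lam).1 x - \sum_(i < N) (pic Q lam al be i).1 x) <= 4 * pic_size Q al be n%:R / 2 ^+ N].
Proof.
move=> Qi.
have ex lam : exists yz : (R -> C) * (R -> C), [/\ edge_sol Q lam yz.1 yz.2, yz.1 0 = al, yz.2 0 = be &
      forall n N : nat, (0 < n)%N -> nm lam <= n%:R ^+ 2 -> forall x : R, 0 <= x <= 1 ->
        nm (yz.1 x) <= 4 * pic_size Q al be n%:R /\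
        nm (yz.1 x - \sum_(i < N) (pic Q lam al be i).1 x) <= 4 * pic_size Q al be n%:R / 2 ^+ N].
  have [y [z [h1 h2 h3 h4]]] := picard lam al be Qi; exists (y, z); split=> // n N n0 hn x hx.
  have n1 : 1 <= n%:R :> R by rewrite ler1n.
  split; last exact: h4.
  by have := h4 n%:R n1 hn x hx 0%N; rewrite big_ord0 subr0 expr0 divr1.
have [F hF] := choice ex; by exists F.
Qed.

(** Each factor grows like [exp (4 n)] on the disc of radius [n ^ 2], hence [expR 8]; the product of
    the two Picard polynomials is the approximant. *)
Lemma cross_approx (Q1 Q2 : R -> C) (al1 be1 al2 be2 : C) (x : R) :
  cintegrable Q1 -> cintegrable Q2 -> 0 <= x <= 1 ->
  forall (F1 F2 : C -> (R -> C) * (R -> C)),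
  (forall lam (n N : nat), (0 < n)%N -> nm lam <= n%:R ^+ 2 ->
     nm ((F1 lam).1 x) <= 4 * pic_size Q1 al1 be1 n%:R /\
     nm ((F1 lam).1 x - \sum_(i < N) (pic Q1 lam al1 be1 i).1 x) <= 4 * pic_size Q1 al1 be1 n%:R / 2 ^+ N) ->
  (forall lam (n N : nat), (0 < n)%N -> nm lam <= n%:R ^+ 2 ->
     nm ((F2 lam).1 x) <= 4 * pic_size Q2 al2 be2 n%:R /\
     nm ((F2 lam).1 x - \sum_(i < N) (pic Q2 lam al2 be2 i).1 x) <= 4 * pic_size Q2 al2 be2 n%:R / 2 ^+ N) ->
  exists B, forall n N : nat, (0 < n)%N -> exists2 g : {poly C}, (size g <= 2 * N)%N &
    forall lam, nm lam <= n%:R ^+ 2 ->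
      nm ((F1 lam).1 x * (F2 lam).1 x) <= B * expR 8 ^+ n /\
      nm ((F1 lam).1 x * (F2 lam).1 x - g.[lam]) <= B * expR 8 ^+ n / 2 ^+ N.
Proof.
move=> Q1i Q2i hx F1 F2 h1 h2.
pose b1 := (nm al1 + nm be1) * expR (4 * mass Q1); pose b2 := (nm al2 + nm be2) * expR (4 * mass Q2).
have b10 : 0 <= b1 by rewrite mulr_ge0 ?expR_ge0 // addr_ge0 ?nm_ge0.
have b20 : 0 <= b2 by rewrite mulr_ge0 ?expR_ge0 // addr_ge0 ?nm_ge0.
(* [48 = 4 * 4 + 8 * 4]: error of one factor times the other, the polynomial being at most
   [8 A1]. *)
exists (48 * (b1 * b2)) => n N n0.
have [p1 s1 hp1] := pic_sum_poly al1 be1 N Q1i hx.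
have [p2 s2 hp2] := pic_sum_poly al2 be2 N Q2i hx.
exists (p1 * p2).
  by apply: leq_trans (size_polyMleq _ _) _; have := leq_add s1 s2; lia.
move=> lam hl.
have [g1 a1'] := h1 lam n N n0 hl; have [g2 a2'] := h2 lam n N n0 hl.
rewrite hp1 in a1'; rewrite hp2 in a2'.
pose e := expR 4 ^+ n : R.
have S1 : pic_size Q1 al1 be1 n%:R = b1 * e.
  by rewrite /pic_size mulrDr expRD /b1 /e -expRM_natr mulr_natr; ring.
have S2 : pic_size Q2 al2 be2 n%:R = b2 * e.
  by rewrite /pic_size mulrDr expRD /b2 /e -expRM_natr mulr_natr; ring.
have E8 : expR 8 ^+ n = e * e.
  by rewrite /e -exprMn -expRD; congr (expR _ ^+ _); ring.
rewrite S1 in g1 a1'; rewrite S2 in g2 a2'; rewrite E8 hornerM.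
have e0 : 0 <= e by rewrite exprn_ge0 ?expR_ge0.
set A1 := b1 * e in g1 a1'; set A2 := b2 * e in g2 a2'.
have A10 : 0 <= A1 by exact: mulr_ge0.
have A20 : 0 <= A2 by exact: mulr_ge0.
have AA : 0 <= A1 * A2 by exact: mulr_ge0.
have -> : 48 * (b1 * b2) * (e * e) = 48 * (A1 * A2) by rewrite /A1 /A2; ring.
split.
  rewrite nmM; have := ler_pM (nm_ge0 _) (nm_ge0 _) g1 g2; lra.
set y1 := (F1 lam).1 x in g1 a1' *; set y2 := (F2 lam).1 x in g2 a2' *.
set w := 2 ^+ N in a1' a2' *.
have w1 : 1 <= w by rewrite exprn_ege1 // ler1n.
have w0 : 0 < w by exact: lt_le_trans w1.
have i1 : 4 * A1 / w <= 4 * A1 by rewrite ler_pdivrMr // ler_peMr // mulr_ge0.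
have l1 : nm p1.[lam] <= 8 * A1 by have := nm_tri p1.[lam] y1; rewrite nm_distC; lra.
have -> : y1 * y2 - p1.[lam] * p2.[lam] = (y1 - p1.[lam]) * y2 + p1.[lam] * (y2 - p2.[lam]) by ring.
apply: le_trans (nmD _ _) _; rewrite !nmM.
have t1 := ler_pM (nm_ge0 _) (nm_ge0 _) a1' g2.
have t2 := ler_pM (nm_ge0 _) (nm_ge0 _) l1 a2'.
lra.
Qed.

Lemma cross_zero : exists y1 z1 y2 z2 y3 z3 y4 z4,
  [/\ [/\ edge_sol (q k) 0 y1 z1, y1 0 = 1 & z1 0 = - h k],
      [/\ edge_sol (q k) 0 y2 z2, y2 0 = 0 & z2 0 = 1],
      [/\ edge_sol (qt k) 0 y3 z3, y3 0 = 1 & z3 0 = - ht k],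
      [/\ edge_sol (qt k) 0 y4 z4, y4 0 = 0 & z4 0 = 1] &
      forall x, 0 <= x <= 1 -> y2 x * y3 x = y1 x * y4 x].
Proof.
have [F1 h1] := solution_family 1 (- h k) (qi kr).
have [F2 h2] := solution_family 0 1 (qi kr).
have [F3 h3] := solution_family 1 (- ht k) (qti kr).
have [F4 h4] := solution_family 0 1 (qti kr).
exists (F1 0).1, (F1 0).2, (F2 0).1, (F2 0).2, (F3 0).1, (F3 0).2, (F4 0).1, (F4 0).2.
split; [by case: (h1 0)|by case: (h2 0)|by case: (h3 0)|by case: (h4 0)|].
move=> x hx; apply/eqP; rewrite -subr_eq0; apply/eqP.
have [B1 hB1] := cross_approx (qi kr) (qti kr) hx
  (F1 := F2) (F2 := F3) (al1 := 0) (be1 := 1) (al2 := 1) (be2 := - ht k)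
  (fun lam n N n0 hl => let: And4 _ _ _ H := h2 lam in H n N n0 hl x hx)
  (fun lam n N n0 hl => let: And4 _ _ _ H := h3 lam in H n N n0 hl x hx).
have [B2 hB2] := cross_approx (qi kr) (qti kr) hx
  (F1 := F1) (F2 := F4) (al1 := 1) (be1 := - h k) (al2 := 0) (be2 := 1)
  (fun lam n N n0 hl => let: And4 _ _ _ H := h1 lam in H n N n0 hl x hx)
  (fun lam n N n0 hl => let: And4 _ _ _ H := h4 lam in H n N n0 hl x hx).
have [c0 [s0 [s00 hdec]]] := cross_decay.
pose G lam := (F2 lam).1 x * (F3 lam).1 x - (F1 lam).1 x * (F4 lam).1 x.
apply: (@vanish_at0 R G c0 (2 * s0 ^+ 2) (B1 + B2) (expR 8)).
- move=> t htt; have [kap [k1 kE kn]] := imaginary_parameter s00 htt.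
  rewrite -kn -kE /G.
  have [e1 y1 z1 _] := h1 (- kap ^+ 2); have [e2 y2 z2 _] := h2 (- kap ^+ 2).
  have [e3 y3 z3 _] := h3 (- kap ^+ 2); have [e4 y4 z4 _] := h4 (- kap ^+ 2).
  exact: (hdec kap k1 _ _ _ _ _ _ _ _ e1 y1 z1 e2 y2 z2 e3 y3 z3 e4 y4 z4 x hx).
- by rewrite -expR0 ler_expR.
move=> n N n0; have [g1 s1 hg1] := hB1 n N n0; have [g2 s2 hg2] := hB2 n N n0.
exists (g1 - g2).
  by apply: leq_trans (size_polyD _ _) _; rewrite size_polyN geq_max s1.
move=> lam hl; have [a1' b1'] := hg1 lam hl; have [a2' b2'] := hg2 lam hl.
rewrite /G; split.
  by apply: le_trans (nmB _ _) _; rewrite mulrDl; exact: lerD.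
rewrite hornerD hornerN !mulrDl.
have -> : forall u v w z : C, u - v - (w - z) = (u - w) - (v - z) by move=> u v w z; ring.
by apply: le_trans (nmB _ _) _; exact: lerD.
Qed.

Lemma weyl_uniqueness :
  {ae (@lebesgue_measure R), forall x : R, 0 <= x <= 1 -> q k x = qt k x} /\ h k = ht k.
Proof.
have [y1 [z1 [y2 [z2 [y3 [z3 [y4 [z4 [[e1 y10 z10] [e2 y20 z20] [e3 y30 z30] [e4 y40 z40] cross]]]]]]]]] := cross_zero.
have x0 : 0 <= (0 : R) <= 1 by rewrite lexx ler01.
have w12 x : 0 <= x <= 1 -> y1 x * z2 x - y2 x * z1 x = 1.
  by move=> hx; rewrite (wronskian_const e1 e2 hx) y10 y20 z20 mul0r subr0 mulr1.
have w34 x : 0 <= x <= 1 -> y3 x * z4 x - y4 x * z3 x = 1.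
  by move=> hx; rewrite (wronskian_const e3 e4 hx) y30 y40 z40 mul0r subr0 mulr1.
have /edge_solP[p1 r1] := e1; have /edge_solP[p2 r2] := e2.
have /edge_solP[p3 r3] := e3; have /edge_solP[p4 r4] := e4.
have cross' x : 0 <= x <= 1 -> z2 x * y3 x + y2 x * z3 x - (z1 x * y4 x + y1 x * z4 x) = 0.
  apply: (prim_eq0 (primB (prim_mul p2 p3) (prim_mul p1 p4))).
    by apply: primB; apply: primD; apply: prim_mul; eassumption.
  by move=> t htt; rewrite !cross // !subrr.
(* [phi ^ 2] times one Wronskian minus [phi~ ^ 2] times the other is a combination of [G] and its
   derivative at [lam = 0], both zero; likewise for [s]. *)
have sq x : 0 <= x <= 1 -> y1 x ^+ 2 = y3 x ^+ 2 /\ y2 x ^+ 2 = y4 x ^+ 2.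
  move=> hx; have := w12 x hx; have := w34 x hx; have := cross x hx; have := cross' x hx.
  move: (y1 x) (z1 x) (y2 x) (z2 x) (y3 x) (z3 x) (y4 x) (z4 x) => u1 v1 u2 v2 u3 v3 u4 v4 c' c a34 a12.
  split.
    have -> : u1 ^+ 2 = u1 ^+ 2 * (u3 * v4 - u4 * v3) by rewrite a34 mulr1.
    have -> : u3 ^+ 2 = u3 ^+ 2 * (u1 * v2 - u2 * v1) by rewrite a12 mulr1.
    apply/eqP; rewrite -subr_eq0; apply/eqP.
    transitivity (u1 * v3 * (u2 * u3 - u1 * u4) - u1 * u3 * (v2 * u3 + u2 * v3 - (v1 * u4 + u1 * v4))
      + u3 * v1 * (u2 * u3 - u1 * u4)); first by ring.
    by rewrite c c' subrr !mulr0 subrr addr0.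
  have -> : u2 ^+ 2 = u2 ^+ 2 * (u3 * v4 - u4 * v3) by rewrite a34 mulr1.
  have -> : u4 ^+ 2 = u4 ^+ 2 * (u1 * v2 - u2 * v1) by rewrite a12 mulr1.
  apply/eqP; rewrite -subr_eq0; apply/eqP.
  transitivity (u2 * v4 * (u2 * u3 - u1 * u4) - u2 * u4 * (v2 * u3 + u2 * v3 - (v1 * u4 + u1 * v4))
      + u4 * v2 * (u2 * u3 - u1 * u4)); first by ring.
  by rewrite c c' subrr !mulr0 subrr addr0.
have yz (u v u' v' Q Q' : R -> C) : edge_sol Q 0 u v -> edge_sol Q' 0 u' v' ->
    (forall x, 0 <= x <= 1 -> u x ^+ 2 = u' x ^+ 2) ->
    (forall x, 0 <= x <= 1 -> u x * v x = u' x * v' x) /\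
    {ae (@lebesgue_measure R), forall x : R, 0 <= x <= 1 -> (Q x - Q' x) * u x ^+ 4 = 0}.
  move=> /edge_solP[pu pv] /edge_solP[pu' pv'] hsq.
  (* The derivative of [u ^ 2 - u' ^ 2] is absolutely continuous, so the identity holds at every
     point, in particular at 0, where it yields [h k]. *)
  have eq1 x : 0 <= x <= 1 -> u x * v x = u' x * v' x.
    move=> hx; have pF := primB (prim_mul pu pu) (prim_mul pu' pu').
    have pf : exists f, prim f (fun t => v t * u t + u t * v t - (v' t * u' t + u' t * v' t)).
      by eexists; apply: primB; apply: primD; apply: prim_mul; eassumption.
    have [f pf'] := pf.
    have F0 t : 0 <= t <= 1 -> u t * u t - u' t * u' t = u 0 * u 0 - u' 0 * u' 0.
      by move=> htt; rewrite -!expr2 !hsq // !subrr.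
    have e0 := prim_eq0 pF pf' F0 hx.
    have two : (2 : C) != 0 by rewrite pnatr_eq0.
    apply: (mulfI two); apply/eqP; rewrite -subr_eq0; apply/eqP; rewrite -[RHS]e0; ring.
  split=> //.
  have pG := primB (prim_mul pu pv) (prim_mul pu' pv').
  have G0 t : 0 <= t <= 1 -> u t * v t - u' t * v' t = u 0 * v 0 - u' 0 * v' 0.
    by move=> htt; rewrite !eq1 // !subrr.
  have := prim_eq0_ae pG G0; apply: filterS; first exact: (ae_filter_ringOfSetsType (@lebesgue_measure R)).
  move=> x hx0 hx; have := hx0 hx; have := eq1 x hx; have := hsq x hx.
  move: (u x) (v x) (u' x) (v' x) (Q x) (Q' x) => U V U' V' A A' sU UV e.
  (* The second derivative reads [v ^ 2 + Q u ^ 2 = v' ^ 2 + Q' u' ^ 2]. Multiplying by [u ^ 2] and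
     using [u v = u' v'] and [u ^ 2 = u' ^ 2] removes [v] without dividing by [u]. *)
  have : U ^+ 2 * (V * V + U * ((A - 0) * U) - (V' * V' + U' * ((A' - 0) * U'))) = 0 by rewrite e mulr0.
  have -> : U ^+ 2 * (V * V + U * ((A - 0) * U) - (V' * V' + U' * ((A' - 0) * U'))) =
    (U * V) ^+ 2 + A * U ^+ 4 - U ^+ 2 * V' ^+ 2 - U ^+ 2 * A' * U' ^+ 2 by ring.
  rewrite UV -sU => e'; rewrite -[RHS]e' exprMn -sU; ring.
have [a13 ae1] := yz _ _ _ _ _ _ e1 e3 (fun x hx => (sq x hx).1).
have [_ ae2] := yz _ _ _ _ _ _ e2 e4 (fun x hx => (sq x hx).2).
split; last first.
  by have := a13 0 x0; rewrite y10 y30 z10 z30 !mul1r => /oppr_inj.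
move: ae1 ae2; apply: filterS2; first exact: (ae_filter_ringOfSetsType (@lebesgue_measure R)).
(* Where the potentials differed, [phi] and [s] would both vanish, against their Wronskian 1. *)
move=> x ha hb hx; have {}ha := ha hx; have {}hb := hb hx.
apply/eqP; rewrite -subr_eq0; apply/negPn/negP => nz.
have u1 : y1 x = 0 by move/eqP: ha; rewrite mulf_eq0 (negbTE nz) /= expf_eq0 /= => /eqP.
have u2 : y2 x = 0 by move/eqP: hb; rewrite mulf_eq0 (negbTE nz) /= expf_eq0 /= => /eqP.
have := w12 x hx; rewrite u1 u2 !mul0r subrr => /eqP.
by rewrite eq_sym oner_eq0.
Qed.

End Main.

Theorem theorem2p5 (R : realType) (r p : nat) (par : nat -> nat)
  (a a1 a0 : nat -> R[i])
  (q qt : nat -> R -> R[i]) (h ht : nat -> R[i]) (k : nat) :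
  tree_ok r p par ->
  coeffs_ok r p par a a1 ->
  (forall j, (1 <= j <= r)%N -> cintegrable (q j)) ->
  (forall j, (1 <= j <= r)%N -> cintegrable (qt j)) ->
  (1 <= k <= p)%N ->
  (* M_k = Mt_k as meromorphic functions: they agree at every lam that is
     a pole of neither (not a zero of Delta nor of Delta~) *)
  (forall lam m mt : R[i],
     weyl_value r p par a a1 a0 q h k lam m ->
     weyl_value r p par a a1 a0 qt ht k lam mt -> m = mt) ->
  {ae (@lebesgue_measure R), forall x : R, 0 <= x <= 1 -> q k x = qt k x} /\
  h k = ht k.

Proof.
move=> tree coeffs qi qti hk same.
exact: (weyl_uniqueness tree coeffs qi qti hk same).
Qed.
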